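(* Let $b\ge2$ be a fixed integer and $\sigma_{\mathrm{crit}}=\frac{b+1}{b-1}\log b$. For any fixed $\alpha>b+1$, $G^\bullet_n(\sigma_{\mathrm{crit}}n+\alpha\log n)$ is connected with high probability, and for any fixed $\beta>\frac{b+1}{b-1}$, $G^\bullet_n(\sigma_{\mathrm{crit}}n-\beta\log n)$ is disconnected with high probability.
   Context: $\log$ is the natural logarithm; ''with high probability'' means with probability tending to $1$ as $n\to\infty$. $T_n$ is the complete $b$-ary tree of height $n$ ($T_0$ is a single vertex; $T_{h+1}$ is obtained from $b$ disjoint copies of $T_h$ by adding a new vertex, the apex, joined to the apex of each copy), with set of leaves $L_n$, $|L_n|=b^n$. Poisson particle model $G^\bullet_n(\lambda)$: a random multigraph with vertex set $L_n$. At each $v\in L_n$ start a number of particles, these numbers being i.i.d. with distribution $\mathrm{Po}(\lambda/2)$ (Poisson with mean $\lambda/2$). The particles perform independent simple random walks on $T_n$, each stopped at its first return to $L_n$. For each particle put an edge connecting its starting leaf to the leaf where it stopped. *)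

(* Defs.v *)
From HB Require Import structures.
From mathcomp Require Import all_boot all_order all_algebra.
From mathcomp Require Import all_classical all_reals all_analysis.

Set Implicit Arguments.
Unset Strict Implicit.
Unset Printing Implicit Defensive.

Import Order.TTheory GRing.Theory Num.Theory.
Import numFieldNormedType.Exports.

Local Open Scope classical_set_scope.
Local Open Scope ring_scope.

(* A vertex of the b-ary tree T_n is the word of child labels read along the
   path from the apex (the empty word), so the i-th copy of T_{n-1} inside T_n
   is the set of words beginning with i. The leaves are the words of length n;
   they become vertices through the coercion bseq_of_tuple. *)
Definition vertex (b n : nat) : finType := n.-bseq 'I_b.

Definition leaf (b n : nat) : finType := n.-tuple 'I_b.

Definition leaf_vertex (b n : nat) (v : leaf b n) : vertex b n :=
  bseq_of_tuple v.

Definition is_leaf (b n : nat) (x : vertex b n) : bool := size x == n.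

Definition tree_adj (b n : nat) : rel (vertex b n) :=
  fun x y => [exists c : 'I_b,
    ((y : seq 'I_b) == rcons x c) || ((x : seq 'I_b) == rcons y c)].

(* A multigraph on V is the list of its edges, with repetitions; an edge is
   stored with an arbitrary orientation, and loops are allowed. *)
Definition multigraph (V : finType) := seq (V * V).

Definition mg_adj (V : finType) (E : multigraph V) : rel V :=
  fun u v => ((u, v) \in E) || ((v, u) \in E).

Definition mg_connected (V : finType) (E : multigraph V) : bool :=
  [forall u, forall v, connect (mg_adj E) u v].

Section RandomWalk.
Context {R : realType} {d : measure_display} {T : measurableType d}.
Context (P : probability T R).

Definition srw_step (V : finType) (e : rel V) (x y : V) : R :=
  if e x y then #|[pred z | e x z]|%:R^-1 else 0.

Definition simple_random_walk (V : finType) (e : rel V) (v : V)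
    (X : nat -> T -> V) : Prop :=
  (forall t x, measurable (X t @^-1` [set x])) /\
  (forall (t : nat) (p : nat -> V),
    P [set w | forall s, (s <= t)%N -> X s w = p s] =
    ((p 0%N == v)%:R * \prod_(s < t) srw_step e (p s) (p s.+1))%:E).

Definition mutually_independent (I : eqType) (F : I -> set (set T)) : Prop :=
  forall (J : seq I) (A : I -> set T), uniq J ->
    (forall j, j \in J -> F j (A j)) ->
    P (\bigcap_(j in [set` J]) A j) = (\prod_(j <- J) P (A j))%E.

Definition sigma_of_process (V : finType) (X : nat -> T -> V) : set (set T) :=
  <<s [set A | exists t x, A = X t @^-1` [set x]] >>.

End RandomWalk.

Section ParticleModel.
Context {R : realType} {d : measure_display} {T : measurableType d}.
Context (P : probability T R) (b n : nat).

(* N v is the number of particles started at v, and X v i is the (unstopped)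
   trajectory of the i-th walk available at v; only the walks with i < N v
   are particles of the model. *)
Context (N : leaf b n -> {RV P >-> nat}).
Context (X : leaf b n -> nat -> nat -> T -> vertex b n).

Definition source_sigma (j : leaf b n + leaf b n * nat) : set (set T) :=
  match j with
  | inl v => preimage_set_system setT (N v) measurable
  | inr (v, i) => sigma_of_process (X v i)
  end.

(* poisson_prob ignores its second argument. *)
Definition poisson_particles (lam : R) : Prop :=
  [/\ forall v A, distribution P (N v) A = poisson_prob (lam / 2) 0 A,
      forall v i,
        simple_random_walk P (@tree_adj b n) (leaf_vertex v) (X v i)
    & mutually_independent P source_sigma].

Definition first_return (p : nat -> vertex b n) (u : leaf b n) : Prop :=
  exists t : nat, [/\ (0 < t)%N, p t = leaf_vertex u
    & forall s, (0 < s < t)%N -> ~~ is_leaf (p s)].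

(* The default value v is used only on the null event that the walk never
   returns to the leaves. *)
Definition stop_leaf (v : leaf b n) (p : nat -> vertex b n) : leaf b n :=
  xget v [set u | first_return p u].

Definition particle_graph (w : T) : multigraph (leaf b n) :=
  [seq (v, stop_leaf v (fun t => X v i t w)) |
    v <- enum (leaf b n), i <- iota 0 (N v w)].

End ParticleModel.

Definition sigma_crit (R : realType) (b : nat) : R :=
  (b%:R + 1) / (b%:R - 1) * ln b%:R.

(* With high probability: the probability of the event A n tends to 1. *)
Definition whp (R : realType) (d : nat -> measure_display)
    (T : forall n, measurableType (d n)) (P : forall n, probability (T n) R)
    (A : forall n, set (T n)) : Prop :=
  (fun n => P n (A n)) @ \oo --> 1%E.

(* Main.v *)
Require Import Defs.
From mathcomp Require Import all_boot all_order all_algebra.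
From mathcomp Require Import all_classical all_reals all_analysis.
From mathcomp Require Import ring lra zify.

Set Implicit Arguments.
Unset Strict Implicit.
Unset Printing Implicit Defensive.

Import Order.TTheory GRing.Theory Num.Theory.
Import numFieldNormedType.Exports.

Local Open Scope classical_set_scope.
Local Open Scope ring_scope.

(**
A walk which climbs from a leaf to maximal height j stops at a uniform leaf below
the vertex it has reached. Equivalently, if rho_y is the average over the block
below y of a function f on the leaves, its harmonic extension at a vertex x_k of
height k with ancestors x_j is
  rho_{x_k} + (b^k - 1) sum_{j > k} (rho_{x_j} - rho_{x_{j-1}}) / (b^j - 1).
Evaluating it next to the leaves and thinning the Poisson particles, a set S of
leaves has no edge to its complement with probability
  exp (- lam (b - 1) sum_x w_j Var_x),   w_j = b^j / (b^j - 1),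
where Var_x is the variance of the densities of S in the b child blocks of x and j
is the height of x. A subtree of height k has cost about N = lam (b - 1) / (b + 1),
and there are b^(n-k) of them, which gives the critical value N = n log b.

Connectedness is a union bound over all S, organised as a recursion on the height:
the weight b^h rho exp (- (b + 1) N sum_x Var_x - N rho^2) of S of density rho in a
tree of height h is preserved when the siblings of the block are empty, full
siblings or several mixed children cost a further small factor, and each height
creates new weight O(b^h exp (- N)) from full children. The total is
O(n b^n exp (- N)), a negative power of n.

For disconnectedness, Chebyshev's inequality is applied to the number of isolated
subtrees of height k, where b^k <= n < b^(k+1).
*)

(** * Block averages, harmonic extension and energy on the b-ary tree *)

Section TreeAverages.
Context {R : realFieldType} (b : nat).
Implicit Types (f g : seq 'I_b -> R) (x : seq 'I_b) (n : nat).

Local Notation B := (b%:R : R).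

(** The factor b^h rho in the weight is the number of leaves of S. Like the exponent, it survives
    the passage to a parent with empty siblings, so that only the choice of the child multiplies the
    total. It is there to absorb interactions: with several mixed children, the square of the parent
    density contains cross terms worth up to exp (N u) for every mixed child but the largest, u
    being the smaller of its density and codensity, and for b^-h <= u <= 1/2 this exponential is
    below a multiple of b^h u. The price is that the b^(n-k) blocks of height k, of b^k leaves each,
    have total weight about b^n exp (- N) for every k; hence the n in the final bound, which alpha
    log n has to beat.

    For isolated subtrees, k balances two losses. The cost N grows by a factor up to 1 / (1 -
    b^-(k+1)), which changes exp (- N) by a constant only if b^k is at least of order n; and there
    are b^(n-k) blocks, not b^n. With b^k about n and N = n log b - g, the mean number is about exp
    (g) / n, and beta makes exp (g) a power of n with exponent above 1. *)

Fixpoint avg n f : R :=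
  if n is m.+1 then B^-1 * \sum_(i < b) avg m (fun w => f (i :: w))
  else f [::].

Fixpoint block_avg n f x : R :=
  match x, n with
  | i :: y, m.+1 => block_avg m (fun w => f (i :: w)) y
  | _, _ => avg n f
  end.

(* Gambler's ruin: from height k > 0 the walk reaches height j >= k before
   returning to the leaves with probability esc j / esc k. *)
Definition esc n : R := (B ^+ n - 1)^-1.

(* Sum over the ancestors y of x (heights j above that of x) of
   esc j * (block average at y - block average at the child of y towards x). *)
Fixpoint drift n f x : R :=
  match x, n with
  | i :: y, m.+1 =>
      esc n * (avg n f - avg m (fun w => f (i :: w)))
      + drift m (fun w => f (i :: w)) y
  | _, _ => 0
  end.

(* The harmonic extension of f from the leaves to the vertex x, a word read from
   the apex. *)
Definition harm n f x : R :=
  block_avg n f x + (B ^+ (n - size x) - 1) * drift n f x.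

Definition child_var n f : R :=
  B^-1 * (\sum_(i < b) avg n (fun w => f (i :: w)) ^+ 2) - avg n.+1 f ^+ 2.

(** A vertex of height j enters with the factor b^(j-n) esc j, so [B ^+ n * energy n f] is the sum
    of w_j Var_x over all inner vertices. It is the Dirichlet form of the walk observed on the
    leaves. *)
Fixpoint energy n f : R :=
  if n is m.+1 then
    esc n * child_var m f + B^-1 * \sum_(i < b) energy m (fun w => f (i :: w))
  else 0.

Hypothesis b2 : (2 <= b)%N.

Let B2 : 2 <= B. Proof. by rewrite ler_nat. Qed.
Let B0 : B != 0. Proof. by rewrite pnatr_eq0; lia. Qed.

Lemma expb_gt1 n : (0 < n)%N -> 1 < B ^+ n.
Proof. by move=> n0; rewrite exprn_egt1 -?lt0n//; have := B2; lra. Qed.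

Lemma mul_esc n : (0 < n)%N -> (B ^+ n - 1) * esc n = 1.
Proof. by move=> n0; rewrite mulfV// subr_eq0 gt_eqF// expb_gt1. Qed.

Lemma eq_avg n f g : (forall w, size w = n -> f w = g w) -> avg n f = avg n g.
Proof.
elim: n f g => [|n IH] f g fg /=; first exact: fg.
by congr (_ * _); apply: eq_bigr => i _; apply: IH => w sw; rewrite fg//= sw.
Qed.

Lemma avgD n f g : avg n (fun w => f w + g w) = avg n f + avg n g.
Proof.
elim: n f g => [//|n IH] f g /=.
by under eq_bigr do rewrite IH; rewrite big_split mulrDr.
Qed.

Lemma avgZ n f (c : R) : avg n (fun w => c * f w) = c * avg n f.
Proof.
elim: n f => [//|n IH] f /=.
by under eq_bigr do rewrite IH; rewrite -mulr_sumr mulrCA.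
Qed.

Lemma avg_const n (c : R) : avg n (fun=> c) = c.
Proof.
elim: n => [//|n IH] /=; under eq_bigr do rewrite IH.
by rewrite sumr_const card_ord -[c *+ b]mulr_natl mulKf.
Qed.

Lemma block_avg_leaf n f x : size x = n -> block_avg n f x = f x.
Proof. by elim: x n f => [|i x IH] [|n] f //= [?]; rewrite IH. Qed.

Lemma block_avg_rcons n f x : (size x < n)%N ->
  \sum_c block_avg n f (rcons x c) = B * block_avg n f x.
Proof.
elim: x n f => [|i x IH] [|n] f //= sx; last by rewrite IH.
by rewrite mulVKf//; apply: eq_bigr => c _; case: n {sx}.
Qed.

Lemma drift_rcons n f x c : (size x < n)%N ->
  drift n f (rcons x c) = drift n f x +
    esc (n - size x) * (block_avg n f x - block_avg n f (rcons x c)).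
Proof.
elim: x n f => [|i x IH] [|n] f //= sx; last by rewrite IH// subSS addrA.
by rewrite subn0 addrC; case: n {sx}.
Qed.

Lemma harm_leaf n f x : size x = n -> harm n f x = f x.
Proof. by move=> sx; rewrite /harm block_avg_leaf// sx subnn subrr mul0r addr0. Qed.

(** The last step of the drift towards [c] carries the factor [esc] of the height of [x], which B^h
    - 1 cancels. So the value at a parent can be written with the data of any child. *)
Lemma harm_parent n f x c : (size x < n)%N ->
  harm n f x = block_avg n f (rcons x c) +
    (B ^+ (n - size x) - 1) * drift n f (rcons x c).
Proof.
move=> sx; rewrite /harm drift_rcons// mulrDr mulrA mul_esc ?subn_gt0//.
ring.
Qed.

Lemma harm_children n f x : (size x < n)%N ->
  \sum_c harm n f (rcons x c) =
  B * block_avg n f x + (B ^+ (n - size x) - B) * drift n f x.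
Proof.
move=> sx; rewrite /harm big_split/= block_avg_rcons//; congr (_ + _).
under eq_bigr do rewrite drift_rcons// size_rcons mulrDr mulrA.
rewrite big_split/= sumr_const card_ord -mulr_sumr.
rewrite big_split/= sumr_const card_ord sumrN block_avg_rcons//.
rewrite -[block_avg n f x *+ b]mulr_natl subrr mulr0 addr0 -[_ *+ b]mulr_natl mulrA.
by rewrite subnS mulrBr mulr1 -exprS prednK ?subn_gt0.
Qed.

Lemma harm_root n f : (0 < n)%N ->
  \sum_c harm n f [:: c] = B * harm n f [::].
Proof.
move=> n0; rewrite (@harm_children n f [::])// /harm.
by case: n n0 => //= n _; rewrite !mulr0 !addr0.
Qed.

(** With average a and drift t at the middle vertex, of height h, the children sum to b a + (b^h -
    b) t and the parent has a + (b^(h+1) - 1) t; the total is (b + 1) (a + (b^h - 1) t). *)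
Lemma harm_node n f x c : (size x < n.-1)%N ->
  \sum_e harm n f (rcons (rcons x c) e) + harm n f x =
  (B + 1) * harm n f (rcons x c).
Proof.
move=> sx; have sxn : (size x < n)%N by lia.
rewrite harm_children ?size_rcons; last by lia.
rewrite (harm_parent _ c)// /harm size_rcons.
have -> : (n - size x = (n - (size x).+1).+1)%N by lia.
rewrite exprS; ring.
Qed.

Lemma driftD n f g x :
  drift n (fun w => f w + g w) x = drift n f x + drift n g x.
Proof.
elim: x n f g => [|i x IH] [|n] f g //=; rewrite ?addr0//.
rewrite -/(avg n.+1 (fun w => f w + g w)) -/(avg n.+1 f) -/(avg n.+1 g).
by rewrite !avgD IH; ring.
Qed.

Lemma driftZ n f (c : R) x : drift n (fun w => c * f w) x = c * drift n f x.
Proof.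
elim: x n f => [|i x IH] [|n] f //=; rewrite ?mulr0//.
rewrite -/(avg n.+1 (fun w => c * f w)) -/(avg n.+1 f).
by rewrite !avgZ IH; ring.
Qed.

Lemma drift_const n (c : R) x : drift n (fun=> c) x = 0.
Proof.
elim: x n => [|i x IH] [|n] //=.
by rewrite -/(avg n.+1 (fun=> c)) !avg_const IH subrr mulr0 addr0.
Qed.

Lemma avg_drift n f : avg n (drift n f) = 0.
Proof.
elim: n f => [//|n IH] f /=.
under eq_bigr do rewrite avgD avg_const IH addr0.
by rewrite -mulr_sumr sumrB sumr_const card_ord -[(_ * _) *+ b]mulr_natl mulVKf// subrr !mulr0.
Qed.

(** Discrete integration by parts: at each ancestor, pairing f with the increment (average - child
    average) leaves minus the variance of the child averages. *)
Lemma avg_mul_drift n f : avg n (fun w => f w * drift n f w) = - energy n f.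
Proof.
elim: n f => [|n IH] f; first by rewrite /= mulr0 oppr0.
rewrite [LHS]/= -/(avg n.+1 f).
under eq_bigr => i _.
  rewrite (_ : avg _ _ = esc n.+1 * (avg n.+1 f - avg n (fun w => f (i :: w))) *
      avg n (fun w => f (i :: w)) - energy n (fun w => f (i :: w))).
    over.
  by rewrite -IH -avgZ -avgD; apply: eq_avg => w _ /=; ring.
rewrite sumrB [energy _ _]/= mulrBr opprD; congr (_ + _).
rewrite (eq_bigr (fun i => esc n.+1 * avg n.+1 f * avg n (fun w => f (i :: w))
   - esc n.+1 * avg n (fun w => f (i :: w)) ^+ 2)); last by move=> i _; ring.
rewrite sumrB -!mulr_sumr /child_var.
have -> : \sum_(i < b) avg n (fun w => f (i :: w)) = B * avg n.+1 f.
  by rewrite /= mulVKf.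
by field.
Qed.

Lemma sum_leaf n f : \sum_(v : n.-tuple 'I_b) f v = B ^+ n * avg n f.
Proof.
elim: n f => [|n IH] f /=.
  rewrite expr0 mul1r (bigD1 [tuple])//= big_pred0 ?addr0// => v.
  by apply/negbTE; rewrite negbK tuple0.
rewrite exprS -mulrA mulrCA mulVKf// mulr_sumr.
rewrite (reindex (fun p : 'I_b * n.-tuple 'I_b => [tuple of p.1 :: p.2])) /=; last first.
  exists (fun v => (thead v, [tuple of behead v])) => [[i v] _|v _] /=.
    by congr (_, _); apply: val_inj.
  by rewrite [RHS]tuple_eta.
rewrite -(pair_bigA _ (fun i (v : n.-tuple 'I_b) => f (i :: v)))/=.
by apply: eq_bigr => i _; rewrite (IH (fun w => f (i :: w))).
Qed.

Lemma child_varE n f : child_var n f =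
  B^-1 * \sum_(i < b) (avg n (fun w => f (i :: w)) - avg n.+1 f) ^+ 2.
Proof.
rewrite (eq_bigr (fun i : 'I_b => avg n (fun w => f (i :: w)) ^+ 2 +
  ((-2 * avg n.+1 f) * avg n (fun w => f (i :: w)) + avg n.+1 f ^+ 2))); last first.
  by move=> i _; ring.
rewrite !big_split/= -mulr_sumr sumr_const card_ord -/(avg n.+1 f).
have -> : \sum_(i < b) avg n (fun w => f (i :: w)) = B * avg n.+1 f.
  by rewrite /= mulVKf.
rewrite /child_var -[_ *+ b]mulr_natl; field; exact: B0.
Qed.

Lemma child_var_ge0 n f : 0 <= child_var n f.
Proof.
by rewrite child_varE mulr_ge0 ?invr_ge0// sumr_ge0// => i _; rewrite sqr_ge0.
Qed.

(** For an indicator, 1 - 2 f is the sign that turns the drift into a rate of crossing the cut from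
    either side. The constant part vanishes because the drift has mean zero. *)
Lemma sum_drift_sign n f :
  \sum_(v : n.-tuple 'I_b) (1 - 2 * f v) * drift n f v =
  2 * B ^+ n * energy n f.
Proof.
rewrite (sum_leaf _ (fun w => (1 - 2 * f w) * drift n f w)).
rewrite (@eq_avg _ _ (fun w => drift n f w + (-2) * (f w * drift n f w))).
  by rewrite avgD avgZ avg_mul_drift avg_drift; ring.
by move=> w _; ring.
Qed.

End TreeAverages.

(** * Exponential inequalities and the cost of a single vertex *)

Section RealIneq.
Context {R : realType}.
Implicit Types (u N M : R).

Lemma expR1_le3 : expR 1 <= 3 :> R.
Proof.
have h : 1 - 1 / 10 <= expR (- (1 / 10)) :> R.
  by have := expR_ge1Dx (- (1 / 10) : R).
have e10 : expR (-1) = expR (- (1/10)) ^+ 10 :> R.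
  by rewrite -expRM_natl; congr expR; lra.
have h2 : (1 - 1/10) ^+ 10 <= expR (-1) :> R.
  by rewrite e10 lerXn2r// ?nnegrE ?expR_ge0//; lra.
have h3 : 1/3 <= expR (-1) :> R by apply: le_trans h2; lra.
have h4 : expR 1 * expR (-1) = 1 :> R by rewrite -expRD subrr expR0.
have := expR_gt0 (1 : R); nra.
Qed.

(** Trades an interaction factor for a leaf count M u. If N u <= 1 the left side is at most 3;
    otherwise it is at most exp (N / 2), and the spare factor N u exceeds 1. *)
Lemma expR_le_linear u N M : 0 <= N -> 0 < M -> 1 <= M * u -> u <= 1 / 2 ->
  expR (N * u) <= (3 + N * expR (N / 2) / M) * (M * u).
Proof.
move=> N0 M0 Mu u2; have u0 : 0 < u by rewrite -(pmulr_rgt0 _ M0); lra.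
rewrite mulrDl (_ : N * expR (N / 2) / M * (M * u) = (N * u) * expR (N / 2)); last first.
  by field; lra.
have [Nu|Nu] := leP (N * u) 1.
  apply: ler_wpDr; first by rewrite !mulr_ge0 ?expR_ge0//; lra.
  apply: (@le_trans _ _ 3); last by lra.
  by apply: le_trans expR1_le3; rewrite ler_expR.
apply: ler_wpDl; first by lra.
apply: (@le_trans _ _ (expR (N / 2))); first by rewrite ler_expR; nra.
by rewrite ler_peMl ?expR_ge0// ltW.
Qed.

Lemma expR4_le81 : expR 4 <= 81 :> R.
Proof.
rewrite (_ : 4 = 4%:R * 1); last by rewrite mulr1.
rewrite expRM_natl (_ : 81 = 3 ^+ 4); last by rewrite -natrX.
by rewrite lerXn2r ?nnegrE ?expR_ge0// expR1_le3.
Qed.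

(** Extracts a factor u, needed when a nearly full child is replaced by its complement and its
    weight must become proportional to u. The three terms serve u >= 1/8, N u <= 1 (where 81 = 3^4
    bounds exp 4), and the intermediate range, where g >= 1/2. *)
Lemma expRN_le_linear u N M g : 0 <= N -> 0 < M -> 1 <= M * u -> u <= 1 / 2 ->
  (1 - 2 * u) ^+ 2 <= g ->
  expR (- (N * g)) <= u * (8 * expR (- (N * g)) + 81 * (M * expR (- N))
                           + N * expR (- (N / 2))).
Proof.
move=> N0 M0 Mu u2 hg; have u0 : 0 < u by rewrite -(pmulr_rgt0 _ M0); lra.
have e1 := expR_ge0 (- N); have e2 := expR_ge0 (- (N / 2)).
have e3 := expR_ge0 (- (N * g)).
have [u8|u8] := leP (1 / 8) u.
  rewrite !mulrDr -addrA ler_wpDr//; first by rewrite addr_ge0 ?mulr_ge0//; lra.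
  nra.
have g4 : 1 - 4 * u <= g by apply: le_trans hg; nra.
have [Nu|Nu] := leP (N * u) 1.
  apply: (@le_trans _ _ (81 * expR (- N))).
    apply: (@le_trans _ _ (expR (4 + - N))); first by rewrite ler_expR; nra.
    by rewrite expRD ler_wpM2r// expR4_le81.
  rewrite !mulrDr -addrA ler_wpDl//; first by rewrite !mulr_ge0//; lra.
  rewrite ler_wpDr//; first by rewrite !mulr_ge0//; lra.
  rewrite [leRHS](_ : _ = 81 * (M * u * expR (- N))); last by ring.
  by rewrite ler_wpM2l// ler_peMl.
rewrite mulrDr ler_wpDl//; first by rewrite !mulr_ge0 ?addr_ge0 ?mulr_ge0//; lra.
apply: (@le_trans _ _ (expR (- (N / 2)))); first by rewrite ler_expR; nra.
by rewrite mulrA [u * N]mulrC ler_peMl// ltW.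
Qed.

Lemma sum_ord_le n (f : 'I_n -> R) : (forall i, f i <= 1) -> \sum_i f i <= n%:R.
Proof.
move=> f1; apply: (@le_trans _ _ (\sum_(i < n) 1)); first by apply: ler_sum.
by rewrite sumr_const card_ord.
Qed.

Section Children.
Context (b : nat) (rho : 'I_b -> R).
Local Notation B := (b%:R : R).
Hypothesis rho01 : forall i, 0 <= rho i <= 1.

Definition minor (x : R) : R := Num.min x (1 - x).

(* For child densities rho and the variance v at their parent,
   N * node_cost = (b + 1) * N * v + N * (parent density)^2. *)
Definition node_cost : R :=
  ((B + 1) * (\sum_i rho i ^+ 2) - (\sum_i rho i) ^+ 2) / B.

Lemma minor_ge0 x : 0 <= x <= 1 -> 0 <= minor x.
Proof. by rewrite /minor le_min subr_ge0. Qed.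

Lemma minor_le2 x : minor x <= 1 / 2.
Proof. by rewrite /minor ge_min; have [//|] := leP x (1/2) => h; apply/orP; right; lra. Qed.

(* phi marks the children more than half full; they are compared with their
   complements. *)
Let u i := minor (rho i).
Let phi i : R := (1 / 2 < rho i)%R%:R.

Let u_ge0 i : 0 <= u i. Proof. exact: minor_ge0. Qed.
Let u_le2 i : u i <= 1 / 2. Proof. exact: minor_le2. Qed.

Let rhoE i : rho i = u i + phi i * (1 - 2 * u i).
Proof.
rewrite /u /phi /minor; case: ltP => /= h.
  by rewrite min_r; lra.
by rewrite min_l; lra.
Qed.

Let phi01 i : phi i = 0 \/ phi i = 1.
Proof. by rewrite /phi; case: ltP => _; [right|left]. Qed.

(** The cross terms are at most (b + 1) / 2 times the sum of the other u, since u at [i0] is at most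
    1/2 and that sum at most (b - 1) / 2. After division by b, one child thus causes no loss in the
    cost; it is later chosen to be the largest. *)
Let cross_le (i0 : 'I_b) :
  (\sum_i u i) ^+ 2 - \sum_i u i ^+ 2 <= B * \sum_(i | i != i0) u i.
Proof.
rewrite (bigD1 i0)//= [X in _ - X](bigD1 i0)//=.
set U := \sum_(i | i != i0) u i.
set S := \sum_(i | i != i0) u i ^+ 2.
have U0 : 0 <= U by apply: sumr_ge0.
have S0 : 0 <= S by apply: sumr_ge0 => i _; rewrite sqr_ge0.
have b1 : 1 <= B by rewrite ler1n (leq_trans _ (ltn_ord i0)).
have Ub : U <= (B - 1) / 2.
  apply: (@le_trans _ _ (\sum_(i | i != i0) 1/2)); first by apply: ler_sum.
  rewrite sumr_const cardC1 card_ord -[_ *+ _]mulr_natr.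
  have [b' ->] : exists b', b = b'.+1.
    by exists b.-1; rewrite prednK// (leq_trans _ (ltn_ord i0)).
  by rewrite /= -natr1; lra.
have := u_ge0 i0; have := u_le2 i0; nra.
Qed.

Let card_phi : \sum_i phi i <= B.
Proof. by apply: sum_ord_le => i; rewrite /phi lern1 leq_b1. Qed.

(** Substituting rho = u + phi (1 - 2 u) separates the gain due to the children more than half full,
    the first product, from the interaction of the minor densities. *)
Lemma node_costE : node_cost * B - B * \sum_i u i ^+ 2 =
  (\sum_i phi i * (1 - 2 * u i)) *
    (B + 1 - \sum_i (phi i + 2 * (1 - phi i) * u i))
  - ((\sum_i u i) ^+ 2 - \sum_i u i ^+ 2).
Proof.
have [b0|b0] := posnP b.
  rewrite /node_cost; move: rho u phi; rewrite b0 => r v p.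
  by rewrite !big_ord0; ring.
rewrite /node_cost mulfVK ?pnatr_eq0; last by lia.
have -> : \sum_i rho i = \sum_i u i + \sum_i phi i * (1 - 2 * u i).
  by rewrite -big_split; apply: eq_bigr => i _; exact: rhoE.
have -> : \sum_i rho i ^+ 2 = \sum_i u i ^+ 2 + \sum_i phi i * (1 - 2 * u i).
  rewrite -big_split/=; apply: eq_bigr => i _; rewrite [in LHS]rhoE.
  by case: (phi01 i) => ->; ring.
have -> : \sum_i (phi i + 2 * (1 - phi i) * u i) =
   2 * (\sum_i u i) + \sum_i phi i * (1 - 2 * u i).
  by rewrite mulr_sumr -big_split; apply: eq_bigr => i _ /=; ring.
ring.
Qed.

Lemma node_cost_ge (i0 : 'I_b) : (forall i, u i <= u i0) ->
  \sum_i u i ^+ 2 - \sum_(i | i != i0) u i +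
    [exists i, (1 / 2 < rho i)%R]%:R * (1 - 2 * u i0) ^+ 2 <= node_cost.
Proof.
move=> umax; set w := u i0.
have b1 : 1 <= B by rewrite ler1n (leq_trans _ (ltn_ord i0)).
have B0 : 0 < B by lra.
have cr := cross_le i0.
suff g : B * ([exists i, (1 / 2 < rho i)%R]%:R * (1 - 2 * w) ^+ 2) <=
  (\sum_i phi i * (1 - 2 * u i)) *
    (B + 1 - \sum_i (phi i + 2 * (1 - phi i) * u i)).
  rewrite -(ler_pM2l B0) [X in X <= _]mulrDr [X in X + _ <= _]mulrBr.
  by have := node_costE; lra.
set k := \sum_i phi i.
have w0 : 0 <= w := u_ge0 i0. have w2 : w <= 1 / 2 := u_le2 i0.
have phi_ge0 i : 0 <= phi i by case: (phi01 i) => ->.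
have phi_le1 i : phi i <= 1 by case: (phi01 i) => ->.
have k0 : 0 <= k by apply: sumr_ge0.
have kb : k <= B := card_phi.
have h1 : k * (1 - 2 * w) <= \sum_i phi i * (1 - 2 * u i).
  rewrite mulr_suml; apply: ler_sum => i _; rewrite ler_wpM2l//.
  have := umax i; rewrite -/w; lra.
have h2 : \sum_i (phi i + 2 * (1 - phi i) * u i) <= k + 2 * (B - k) * w.
  rewrite (_ : k + _ = \sum_i (phi i + 2 * (1 - phi i) * w)); last first.
    rewrite big_split/=; congr (_ + _); rewrite -mulr_suml -mulr_sumr sumrB.
    by rewrite sumr_const card_ord.
  apply: ler_sum => i _; rewrite lerD2l ler_wpM2l//.
  by have := phi_le1 i; lra.
have h3 : (B + 1 - k) * (1 - 2 * w) <= B + 1 - \sum_i (phi i + 2 * (1 - phi i) * u i).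
  by apply: (@le_trans _ _ (B + 1 - (k + 2 * (B - k) * w))); [nra|lra].
apply: (@le_trans _ _ ((k * (1 - 2 * w)) * ((B + 1 - k) * (1 - 2 * w)))); last first.
  by apply: ler_pM => //; rewrite mulr_ge0//; lra.
have [/existsP[i hi]|_] := boolP [exists i, (1 / 2 < rho i)%R]; last first.
  by rewrite mul0r mulr0 !mulr_ge0//; lra.
have k1 : 1 <= k.
  rewrite /k (bigD1 i)//= {1}/phi hi lerDl; exact: sumr_ge0.
(* On 1 <= k <= b one has k (b + 1 - k) >= b, with equality at both ends: one full child costs as
   much as all b of them. *)
rewrite mul1r [leRHS](_ : _ = (k * (B + 1 - k)) * (1 - 2 * w) ^+ 2); last by ring.
by rewrite ler_wpM2r ?sqr_ge0//; nra.
Qed.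

(** The product pays a factor [D] for each mixed child, but the largest one needs no exp (N u), by
    [cross_le]. The [D] on the left records this saving; the density of the largest child comes from
    the sum of the rho, via [lead]. *)
Lemma multi_mixed_bound (N M D : R) (i0 : 'I_b) :
  0 <= N -> 0 < M -> M * expR (- N) <= 1 -> N * expR (- (N / 2)) <= 1 ->
  0 < D ->
  (forall v, 1 <= M * v -> v <= 1 / 2 -> expR (N * v) <= D * (M * v)) ->
  (forall i, u i = 0 \/ 1 <= M * u i) ->
  (forall i, u i <= u i0) -> 1 <= M * u i0 ->
  D * (M * (\sum_i rho i) * expR (- (N * node_cost))) <=
  90 * B * \prod_i (if u i == 0 then 1 else D * (M * u i * expR (- (N * u i ^+ 2)))).
Proof.
move=> N0 M0 h1 h2 D0 hD hu umax Mu0.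
set w := u i0 in umax Mu0 *.
have w0 : 0 < w by rewrite -(pmulr_rgt0 _ M0); lra.
have w2 : w <= 1 / 2 := u_le2 i0.
set a : R := [exists i, (1 / 2 < rho i)%R]%:R.
have key := node_cost_ge umax; rewrite -/w -/a in key.
have sB : \sum_i rho i <= B.
  by apply: sum_ord_le => i; case/andP: (rho01 i).
have B1 : 1 <= B by rewrite ler1n (leq_trans _ (ltn_ord i0)).
have lead : (\sum_i rho i) * expR (- (N * (a * (1 - 2 * w) ^+ 2))) <= 90 * B * w.
  rewrite /a; have [/existsP[i hi]|noF] := boolP [exists i, (1 / 2 < rho i)%R].
    rewrite mul1r; have := @expRN_le_linear w N M _ N0 M0 Mu0 w2 (lexx _).
    set e := expR (- (N * (1 - 2 * w) ^+ 2)) => q.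
    have e1 : e <= 1 by rewrite -expR0 ler_expR oppr_le0 mulr_ge0// sqr_ge0.
    have e0 : 0 <= e by apply: expR_ge0.
    apply: (@le_trans _ _ (B * e)); first by rewrite ler_wpM2r.
    (* 90 = 8 + 81 + 1: each of the three exponential expressions is at most 1 here. *)
    rewrite [leRHS](_ : _ = B * (w * 90)); last by ring.
    rewrite ler_wpM2l//.
    apply: (le_trans q); rewrite ler_wpM2l//; lra.
  rewrite mul0r mulr0 oppr0 expR0 mulr1.
  apply: (@le_trans _ _ (\sum_(i < b) w)); last first.
    by rewrite sumr_const card_ord -[_ *+ _]mulr_natl; nra.
  apply: ler_sum => i _; apply: le_trans (umax i).
  move: noF; rewrite negb_exists => /forallP /(_ i); rewrite -leNgt => hi.
  by rewrite /u /minor min_l//; lra.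
rewrite [X in _ <= _ * X](bigD1 i0)//= -/w gt_eqF//.
have step : expR (- (N * node_cost)) <= expR (- (N * (a * (1 - 2 * w) ^+ 2))) *
   (expR (- (N * w ^+ 2)) * \prod_(i | i != i0) (expR (N * u i) * expR (- (N * u i ^+ 2)))).
  have -> : \prod_(i | i != i0) (expR (N * u i) * expR (- (N * u i ^+ 2))) =
    expR (\sum_(i | i != i0) (N * u i - N * u i ^+ 2)).
    by rewrite expR_sum; apply: eq_bigr => i _; rewrite expRD.
  rewrite -!expRD ler_expR sumrB -!mulr_sumr.
  move: key; rewrite (bigD1 i0)//= -/w.
  set U := \sum_(i | i != i0) u i; set S := \sum_(i | i != i0) u i ^+ 2 => key.
  nra.
set PR := \prod_(i | _) _ in step.
have PR0 : 0 <= PR by apply: prodr_ge0 => i _; rewrite mulr_ge0 ?expR_ge0.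
have pr : PR <= \prod_(i | i != i0) (if u i == 0 then 1 else D * (M * u i * expR (- (N * u i ^+ 2)))).
  apply: ler_prod => i _; rewrite mulr_ge0 ?expR_ge0//=.
  have [->|ne] := eqVneq (u i) 0; first by rewrite expr0n/= mulr0 oppr0 expR0 mulr1.
  rewrite !mulrA ler_wpM2r ?expR_ge0// -mulrA; apply: hD => //.
  by case: (hu i) => // e; rewrite e eqxx in ne.
set PP := \prod_(i | _) _ in pr.
have s0 : 0 <= \sum_i rho i by apply: sumr_ge0 => i _; case/andP: (rho01 i).
apply: (@le_trans _ _ (D * (M * (\sum_i rho i) * (expR (- (N * (a * (1 - 2 * w) ^+ 2))) *
   (expR (- (N * w ^+ 2)) * PR))))).
  by rewrite ler_wpM2l ?(ltW D0)// ler_wpM2l ?mulr_ge0// ltW.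
rewrite [leLHS](_ : _ = ((\sum_i rho i) * expR (- (N * (a * (1 - 2 * w) ^+ 2)))) *
   (D * M * expR (- (N * w ^+ 2)) * PR)); last by ring.
rewrite [leRHS](_ : _ = (90 * B * w) * (D * M * expR (- (N * w ^+ 2)) * PP)); last by (rewrite -/PP; ring).
have DM : 0 <= D * M * expR (- (N * w ^+ 2)) by rewrite !mulr_ge0 ?expR_ge0 ?ltW.
apply: ler_pM => //; [by rewrite mulr_ge0 ?expR_ge0|by rewrite mulr_ge0|].
by rewrite ler_wpM2l.
Qed.

Lemma single_mixed_bound (N M : R) (i0 : 'I_b) :
  (2 <= b)%N -> 0 <= N -> 0 < M -> 1 <= M * u i0 ->
  (forall i, i != i0 -> rho i = 0 \/ rho i = 1) ->
  (exists2 i, i != i0 & rho i = 1) ->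
  M * (\sum_i rho i) * expR (- (N * node_cost)) <=
  B * (8 * expR (- (N / 2)) + 81 * (M * expR (- N)) + N * expR (- (N / 2)))
    * (M * u i0 * expR (- (N * u i0 ^+ 2))).
Proof.
move=> b2 N0 M0 Mu0 h01 [i1 i10 hi1].
set w := u i0 in Mu0 *.
have w0 : 0 < w by rewrite -(pmulr_rgt0 _ M0); lra.
have w2 : w <= 1 / 2 := u_le2 i0.
have B2 : 2 <= B by rewrite ler_nat.
have uz i : i != i0 -> u i = 0.
  by move=> /h01[] h; rewrite /u /minor h; [rewrite min_l|rewrite min_r]; lra.
have umax i : u i <= w.
  by have [->//|/uz->] := eqVneq i i0; exact: ltW.
have sB : \sum_i rho i <= B.
  by apply: sum_ord_le => i; case/andP: (rho01 i).
set g := node_cost - w ^+ 2.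
have g1 : (1 - 2 * w) ^+ 2 <= g.
  have U0 : \sum_(i | i != i0) u i = 0 by apply: big1 => i /uz.
  have S0 : \sum_(i | i != i0) u i ^+ 2 = 0.
    by apply: big1 => i /uz ->; rewrite expr0n.
  have := node_cost_ge umax; rewrite U0 (bigD1 i0)//= S0 -/w subr0.
  have -> : [exists i, (1 / 2 < rho i)%R].
    by apply/existsP; exists i1; rewrite hi1; lra.
  rewrite mul1r addr0 -/w /g; lra.
(* The bound (1 - 2 w)^2 degenerates at w = 1/2, so a uniform one is needed to make exp (- N g)
   small. With k the total density of the siblings, b g >= k (b - k), and 1 <= k <= b - 1. *)
have g2 : 1 / 2 <= g.
  set k := \sum_(i | i != i0) rho i.
  have k1 : 1 <= k.
    rewrite /k (bigD1 i1)//= hi1 lerDl; apply: sumr_ge0 => i _.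
    by case/andP: (rho01 i).
  have kb : k <= B - 1.
    apply: (@le_trans _ _ (\sum_(i | i != i0) 1)).
      by apply: ler_sum => i _; case/andP: (rho01 i).
    by rewrite sumr_const cardC1 card_ord -subn1 natrB// ltnW.
  have nc : node_cost * B = (B + 1) * (rho i0 ^+ 2 + k) - (rho i0 + k) ^+ 2.
    rewrite /node_cost mulfVK; last by lra.
    rewrite (bigD1 i0)//= [in X in _ - X](bigD1 i0)//= -/k; congr (_ * (_ + _) - _).
    by apply: eq_bigr => i /h01[] ->; rewrite ?expr0n ?expr1n.
  suff : B * (1 / 2) <= B * g by rewrite ler_pM2l//; lra.
  rewrite /g mulrBr [B * node_cost]mulrC nc.
  have kk : B / 2 <= k * (B - k) by nra.
  have /andP[r0 r1] := rho01 i0.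
  rewrite /w /u /minor; have [hr|hr] := leP (rho i0) (1 - rho i0); nra.
have e1 : expR (- (N * node_cost)) = expR (- (N * g)) * expR (- (N * w ^+ 2)).
  by rewrite -expRD; congr expR; rewrite /g; ring.
have q := @expRN_le_linear w N M g N0 M0 Mu0 w2 g1.
have e2 : expR (- (N * g)) <= expR (- (N / 2)) by rewrite ler_expR; nra.
set eps := 8 * _ + _ + _.
have q2 : expR (- (N * g)) <= w * eps.
  apply: (le_trans q); rewrite ler_wpM2l ?(ltW w0)// /eps !lerD2r ler_wpM2l//.
rewrite e1 [leLHS](_ : _ = M * expR (- (N * w ^+ 2)) * ((\sum_i rho i) * expR (- (N * g))));
  last by ring.
rewrite [leRHS](_ : _ = M * expR (- (N * w ^+ 2)) * (B * (w * eps))); last by ring.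
apply: ler_wpM2l; first by rewrite mulr_ge0 ?expR_ge0// ltW.
apply: ler_pM => //.
by apply: sumr_ge0 => i _; case/andP: (rho01 i).
Qed.

End Children.
End RealIneq.

(** * Leaf sets as configurations, and the recursion for their total weight *)

Section Configurations.
Context {R : realType} (b : nat).
Local Notation B := (b%:R : R).

(* Sets of leaves of T_n, in a form for which a sum of products over the b
   subtrees factors. *)
Fixpoint cfg (n : nat) : finType :=
  if n is m.+1 then {ffun 'I_b -> cfg m} else bool.

Fixpoint dens (n : nat) : cfg n -> R :=
  match n return cfg n -> R with
  | 0 => fun c : bool => c%:R
  | m.+1 => fun c : {ffun 'I_b -> cfg m} => B^-1 * \sum_i dens (c i)
  end.

Fixpoint varsum (n : nat) : cfg n -> R :=
  match n return cfg n -> R with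
  | 0 => fun=> 0
  | m.+1 => fun c : {ffun 'I_b -> cfg m} =>
      B^-1 * (\sum_i dens (c i) ^+ 2) - (B^-1 * \sum_i dens (c i)) ^+ 2
      + \sum_i varsum (c i)
  end.

Fixpoint cneg (n : nat) : cfg n -> cfg n :=
  match n return cfg n -> cfg n with
  | 0 => negb
  | m.+1 => fun c : {ffun 'I_b -> cfg m} => [ffun i => cneg (c i)]
  end.

Definition mixed n (c : cfg n) : bool := 0 < dens c < 1.

Hypothesis b2 : (2 <= b)%N.
Let B2 : 2 <= B. Proof. by rewrite ler_nat. Qed.
Let B0 : B != 0. Proof. by have := B2; lra. Qed.

Let sum1 : B = \sum_(i < b) 1. Proof. by rewrite sumr_const card_ord. Qed.

Lemma cnegK n : involutive (@cneg n).
Proof.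
elim: n => [|n IH] /=; first exact: negbK.
by move=> c; apply/ffunP => i; rewrite !ffunE IH.
Qed.

Lemma dens_neg n (c : cfg n) : dens (cneg c) = 1 - dens c.
Proof.
elim: n c => [[]|n IH c] /=; rewrite ?subrr ?subr0//.
under eq_bigr do rewrite ffunE IH.
by rewrite sumrB sumr_const card_ord mulrBr -[1 *+ b]mulr_natl mulr1 mulVf.
Qed.

Lemma varsum_neg n (c : cfg n) : varsum (cneg c) = varsum c.
Proof.
elim: n c => [//|n IH c] /=.
have -> : \sum_i dens ([ffun i => cneg (c i)] i) ^+ 2 =
    B - 2 * (\sum_i dens (c i)) + \sum_i dens (c i) ^+ 2.
  rewrite mulr_sumr [X in X - _ + _]sum1 -sumrB -big_split.
  by apply: eq_bigr => i _; rewrite ffunE dens_neg /=; ring.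
have -> : \sum_i dens ([ffun i => cneg (c i)] i) = B - \sum_i dens (c i).
  rewrite [X in X - _]sum1 -sumrB.
  by apply: eq_bigr => i _; rewrite ffunE dens_neg.
under [X in _ + X]eq_bigr do rewrite ffunE IH.
by congr (_ + _); field; exact: B0.
Qed.

Lemma dens_nat n (c : cfg n) : exists k : nat, B ^+ n * dens c = k%:R.
Proof.
elim: n c => [c|n IH c]; first by exists c; rewrite expr0 mul1r.
have [k hk] := choice (fun i => IH (c i)).
exists (\sum_i k i)%N; rewrite /= exprS -mulrA mulrCA mulVKf// mulr_sumr natr_sum.
by apply: eq_bigr => i _; rewrite hk.
Qed.

Lemma dens01 n (c : cfg n) : 0 <= dens c <= 1.
Proof.
elim: n c => [[]|n IH c] /=; rewrite ?lexx ?ler01//.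
rewrite mulr_ge0 ?invr_ge0//=; last first.
  by apply: sumr_ge0 => i _; case/andP: (IH (c i)).
rewrite mulrC ler_pdivrMr ?mul1r; last by have := B2; lra.
by apply: sum_ord_le => i; case/andP: (IH (c i)).
Qed.

Lemma varsum_ge0 n (c : cfg n) : 0 <= varsum c.
Proof.
elim: n c => [//|n IH c] /=.
apply: addr_ge0; last by apply: sumr_ge0.
set m := B^-1 * \sum_i dens (c i).
rewrite [leRHS](_ : _ = B^-1 * \sum_i (dens (c i) - m) ^+ 2).
  by rewrite mulr_ge0 ?invr_ge0// sumr_ge0// => i _; rewrite sqr_ge0.
have e : \sum_i dens (c i) = B * m by rewrite mulVKf.
rewrite [X in _ = _ * X](eq_bigr (fun i => dens (c i) ^+ 2 + ((-2 * m) * dens (c i) + m ^+ 2))); last first.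
  by move=> i _; ring.
rewrite !big_split/= -mulr_sumr e sumr_const card_ord -[_ *+ b]mulr_natl.
by field; exact: B0.
Qed.

Lemma dens0_inj n (c c' : cfg n) : dens c = 0 -> dens c' = 0 -> c = c'.
Proof.
elim: n c c' => [[] [] /= h h'|n IH c c' h h'] //; rewrite -?h -?h'//.
- by move/eqP: h; rewrite oner_eq0.
- by move/eqP: h'; rewrite oner_eq0.
have z (d : cfg n.+1) : dens d = 0 -> forall i, dens (d i) = 0.
  move=> /= /eqP; rewrite mulf_eq0 invr_eq0 (negbTE B0)/= => hd i; apply/eqP.
  move: hd; rewrite psumr_eq0; last by move=> j _; case/andP: (dens01 (d j)).
  by move/allP => /(_ i); rewrite mem_index_enum => /(_ isT).
by apply/ffunP => i; apply: IH; apply: z.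
Qed.

Lemma dens1_inj n (c c' : cfg n) : dens c = 1 -> dens c' = 1 -> c = c'.
Proof.
move=> h h'; apply: (can_inj (@cnegK n)); apply: dens0_inj;
  by rewrite dens_neg ?h ?h' subrr.
Qed.

Lemma not_mixed n (c : cfg n) : ~~ mixed c -> dens c = 0 \/ dens c = 1.
Proof.
have /andP[h0 h1] := dens01 c; rewrite /mixed negb_and -!leNgt => /orP[h|h].
- by left; lra.
- by right; lra.
Qed.

(** A nonempty set has at least one leaf, and so has its complement if nonempty. This is the lower
    end b^-n of the range of u in the exponential inequalities. *)
Lemma mixed_minor n (c : cfg n) :
  minor (dens c) = 0 \/ 1 <= B ^+ n * minor (dens c).
Proof.
have [m|/not_mixed[] ->] := boolP (mixed c); last 2 first.
- by left; rewrite /minor min_l; lra.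
- by left; rewrite /minor min_r; lra.
right; have pos (d : cfg n) : 0 < dens d -> 1 <= B ^+ n * dens d.
  move=> d0; have [k hk] := dens_nat d; rewrite hk ler1n lt0n.
  apply/eqP => k0; move: hk; rewrite k0 => /eqP.
  by rewrite mulf_eq0 expf_eq0 (negbTE B0) andbF gt_eqF.
case/andP: m => m0 m1; rewrite /minor minEle; case: ifP => _; first exact: pos.
by rewrite -dens_neg; apply: pos; rewrite dens_neg subr_gt0.
Qed.

Section Weights.
Variable N : R.
Hypothesis N0 : 0 <= N.

(* With v = varsum c, the term c ^+ 2 is the variance cost of c at all further
   ancestors, in an infinite tree, if everything outside its block is empty.
   Hence the weight below is unchanged when one passes to a parent whose other
   children are empty. *)
Definition gibbs (c : R) (v : R) : R := expR (- (N * ((B + 1) * v + c ^+ 2))).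

Definition outer_weight n (c : cfg n) : R := B ^+ n * dens c * gibbs (dens c) (varsum c).

(** The weight of the smaller of the set and its complement. It is used for a mixed child whose
    siblings are not all empty, where the emptier side need not be the set itself. *)
Definition minor_weight n (c : cfg n) : R :=
  B ^+ n * minor (dens c) * gibbs (minor (dens c)) (varsum c).

Definition mass n : R := \sum_(c : cfg n | mixed c) outer_weight c.

Lemma outer_weight_ge0 n (c : cfg n) : 0 <= outer_weight c.
Proof. by rewrite /outer_weight !mulr_ge0 ?expR_ge0 ?exprn_ge0//; case/andP: (dens01 c). Qed.

Lemma minor_weight_ge0 n (c : cfg n) : 0 <= minor_weight c.
Proof. by rewrite /minor_weight !mulr_ge0 ?expR_ge0 ?exprn_ge0 ?minor_ge0 ?dens01. Qed.

Lemma mass_ge0 n : 0 <= mass n.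
Proof. by apply: sumr_ge0 => c _; apply: outer_weight_ge0. Qed.

(** The minor weight is the outer weight of [c] or of [cneg c], and [cneg] permutes the mixed
    configurations. *)
Lemma sum_minor_weight n : \sum_(c : cfg n | mixed c) minor_weight c <= 2 * mass n.
Proof.
have -> : 2 * mass n = \sum_(c : cfg n | mixed c) (outer_weight c + outer_weight (cneg c)).
  rewrite big_split/= mulr2n mulrDl mul1r; congr (_ + _).
  rewrite /mass (reindex_inj (can_inj (@cnegK n))); apply: eq_bigl => c.
  by rewrite /mixed dens_neg subr_gt0 gtrBl andbC.
apply: ler_sum => c _; have y1 := outer_weight_ge0 c; have y2 := outer_weight_ge0 (cneg c).
rewrite /minor_weight /minor minEle; case: ifP => _; first by rewrite -/(outer_weight c); lra.
by rewrite -dens_neg -(varsum_neg c) -/(outer_weight (cneg c)); lra.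
Qed.

Lemma mass0 : mass 0 = 0.
Proof. by rewrite /mass big1// => -[]; rewrite /mixed /= ltxx ?andbF. Qed.

(** The children interact only through their densities in [node_cost]; what remains is a product
    over the children. *)
Lemma outer_weight_node n (c : cfg n.+1) :
  outer_weight c = B ^+ n * (\sum_i dens (c i)) * expR (- (N * node_cost (fun i => dens (c i)))) *
         \prod_i expR (- (N * ((B + 1) * varsum (c i)))).
Proof.
rewrite -expR_sum sumrN -!mulr_sumr -mulrA -expRD /outer_weight /gibbs exprS.
rewrite [_ * dens c](_ : _ = B ^+ n * \sum_i dens (c i)); last first.
  by rewrite /=; field; exact: B0.
congr (_ * expR _).
by rewrite /node_cost /=; field; exact: B0.
Qed.

Lemma sum_dens_eq n (a : R) : a = 0 \/ a = 1 ->
  \sum_(x : cfg n) (dens x == a)%:R <= 1 :> R.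
Proof.
move=> a01; rewrite -natr_sum lern1.
have -> : (\sum_(x : cfg n) (dens x == a) = #|[pred x : cfg n | dens x == a]|)%N.
  by rewrite -sum1_card [RHS]big_mkcond; apply: eq_bigr => x _; rewrite !inE; case: ifP.
apply/card_le1_eqP => x y; rewrite !inE => /eqP hx /eqP hy.
by case: a01 => a01; [apply: dens0_inj|apply: dens1_inj]; rewrite ?hx ?hy.
Qed.

Lemma sum_trivial n : \sum_(x : cfg n) (~~ mixed x)%:R <= 2 :> R.
Proof.
apply: (@le_trans _ _ (\sum_(x : cfg n) ((dens x == 0)%:R + (dens x == 1)%:R))).
  apply: ler_sum => x _; have [_|/not_mixed[]->] := boolP (mixed x).
  - by rewrite addr_ge0.
  - by rewrite eqxx lerDl.
  - by rewrite eqxx lerDr.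
rewrite big_split/= (_ : 2 = 1 + 1)//.
by apply: lerD; apply: sum_dens_eq; [left|right].
Qed.

Lemma sum_prod_node n (F : 'I_b -> cfg n -> R) :
  \sum_(c : cfg n.+1) \prod_i F i (c i) = \prod_i \sum_x F i x.
Proof. by rewrite bigA_distr_bigA. Qed.

Section Step.
Variable n : nat.
Let M : R := B ^+ n.
(** The factor of [expR_le_linear], the price of interaction per mixed child; [M] is the number of
    leaves below a child. *)
Let D : R := 3 + N * expR (N / 2) / M.
Let eps : R := 8 * expR (- (N / 2)) + 81 * (M * expR (- N)) + N * expR (- (N / 2)).
Hypothesis small1 : M * expR (- N) <= 1.
Hypothesis small2 : N * expR (- (N / 2)) <= 1.

Let M0 : 0 < M. Proof. by rewrite exprn_gt0//; have := B2; lra. Qed.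
Let D0 : 0 < D.
Proof. by rewrite ltr_pwDl// !mulr_ge0 ?expR_ge0// invr_ge0 ltW. Qed.
Let eps0 : 0 <= eps.
Proof. by rewrite !addr_ge0 ?mulr_ge0 ?expR_ge0// ltW. Qed.

Let mixD_ge0 (x : cfg n) : 0 <= (mixed x)%:R * (D * minor_weight x).
Proof. by rewrite mulr_ge0// mulr_ge0 ?minor_weight_ge0// ltW. Qed.

(* G0: no mixed child; G1: one mixed child, empty siblings; G2: one mixed child,
   trivial siblings, some of them full; G3: at least two mixed children. *)
Let G0 (c : cfg n.+1) : R :=
  B * M * expR (- N) * \prod_i (~~ mixed (c i))%:R.
Let G1 (c : cfg n.+1) : R :=
  \sum_i0 \prod_i (if i == i0 then (mixed (c i))%:R * outer_weight (c i)
                   else (dens (c i) == 0)%:R).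
Let G2 (c : cfg n.+1) : R :=
  B * eps * \sum_i0 \prod_i (if i == i0 then (mixed (c i))%:R * minor_weight (c i)
                             else (~~ mixed (c i))%:R).
Let G3 (c : cfg n.+1) : R :=
  90 * B / D * \sum_i0 \sum_(i1 | i1 != i0)
    \prod_i (if (i == i0) || (i == i1) then (mixed (c i))%:R * (D * minor_weight (c i))
             else (~~ mixed (c i))%:R + (mixed (c i))%:R * (D * minor_weight (c i))).

Let G0_ge0 c : 0 <= G0 c.
Proof.
rewrite /G0 !mulr_ge0 ?expR_ge0 ?prodr_ge0//; exact: ltW.
Qed.

Let G1_ge0 c : 0 <= G1 c.
Proof.
apply: sumr_ge0 => i0 _; apply: prodr_ge0 => i _.
by case: ifP => // _; rewrite mulr_ge0 ?outer_weight_ge0.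
Qed.

Let G2_ge0 c : 0 <= G2 c.
Proof.
rewrite /G2 mulr_ge0 ?mulr_ge0//; apply: sumr_ge0 => i0 _; apply: prodr_ge0 => i _.
by case: ifP => // _; rewrite mulr_ge0 ?minor_weight_ge0.
Qed.

Let G3_ge0 c : 0 <= G3 c.
Proof.
rewrite /G3 mulr_ge0 ?mulr_ge0 ?invr_ge0 ?(ltW D0)//.
apply: sumr_ge0 => i0 _; apply: sumr_ge0 => i1 _; apply: prodr_ge0 => i _.
by case: ifP => _; [exact: mixD_ge0|apply: addr_ge0 (mixD_ge0 _)].
Qed.

Let E (x : cfg n) : R := expR (- (N * ((B + 1) * varsum x))).

Let E_le1 x : E x <= 1.
Proof.
by rewrite -expR0 ler_expR oppr_le0 !mulr_ge0 ?varsum_ge0.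
Qed.

Let prodE_le (c : cfg n.+1) (i0 : 'I_b) : \prod_i E (c i) <= E (c i0).
Proof.
rewrite (bigD1 i0)//= ler_piMr ?expR_ge0//.
by apply: prodr_ile1 => i _; rewrite expR_ge0 E_le1.
Qed.

Let gibbsE (a : R) x : gibbs a (varsum x) = expR (- (N * a ^+ 2)) * E x.
Proof. by rewrite /gibbs /E -expRD; congr expR; ring. Qed.

(** With k full children and the others empty, the node cost is k (b + 1 - k) / b >= 1. These
    configurations are the source of new mass at each height. *)
Let bound0 (c : cfg n.+1) : (forall i, ~~ mixed (c i)) -> mixed c -> outer_weight c <= G0 c.
Proof.
move=> tr mc; rewrite /G0 big1 ?mulr1 => [|i _]; last by rewrite tr.
have d01 i : dens (c i) = 0 \/ dens (c i) = 1 by apply: not_mixed.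
set k := \sum_i dens (c i).
have kB : k = B * dens c by rewrite /= mulVKf.
have k0 : 0 < k by rewrite kB; case/andP: mc => *; rewrite mulr_gt0//; have := B2; lra.
have k1 : 1 <= k.
  have [i /eqP hi|none] := pickP (fun i => dens (c i) == 1).
    by rewrite /k (bigD1 i)//= hi lerDl; apply: sumr_ge0 => j _; case/andP: (dens01 (c j)).
  have : k = 0 by apply: big1 => i _; case: (d01 i) => // h; move: (none i); rewrite h eqxx.
  lra.
have kb : k <= B by apply: sum_ord_le => i; case/andP: (dens01 (c i)).
have nc : 1 <= node_cost (fun i => dens (c i)).
  rewrite /node_cost (eq_bigr (fun i => dens (c i))) -/k; last first.
    by move=> i _; case: (d01 i) => ->; rewrite ?expr0n ?expr1n.
  by rewrite ler_pdivlMr; have := B2; [nra|lra].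
rewrite outer_weight_node -/k -/M [M * k]mulrC -[leLHS]mulrA.
apply: ler_pM.
- by rewrite mulr_ge0// ltW.
- by rewrite mulr_ge0 ?expR_ge0// prodr_ge0// => i _; rewrite expR_ge0.
- by rewrite ler_wpM2r// ltW.
rewrite -[leRHS]mulr1; apply: ler_pM; rewrite ?expR_ge0//.
- by apply: prodr_ge0 => i _; rewrite expR_ge0.
- by rewrite ler_expR lerN2 ler_peMr.
by apply: prodr_ile1 => i _; rewrite expR_ge0 E_le1.
Qed.

Let bound1 (c : cfg n.+1) i0 : mixed (c i0) ->
  (forall i, i != i0 -> dens (c i) = 0) -> outer_weight c <= G1 c.
Proof.
move=> mc d0; rewrite /G1 (bigD1 i0)//= (bigD1 i0)//= eqxx mc mul1r.
rewrite big1 ?mulr1 => [|i ii]; last by rewrite (negbTE ii) d0// eqxx.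
rewrite ler_wpDr//.
  apply: sumr_ge0 => i1 _; apply: prodr_ge0 => i _.
  by case: ifP => // _; rewrite mulr_ge0 ?outer_weight_ge0.
have s1 : \sum_i dens (c i) = dens (c i0).
  by rewrite (bigD1 i0)//= big1 ?addr0.
have s2 : \sum_i dens (c i) ^+ 2 = dens (c i0) ^+ 2.
  by rewrite (bigD1 i0)//= big1 ?addr0// => i /d0 ->; rewrite expr0n.
rewrite outer_weight_node /node_cost s1 s2.
(* The exponent reproduces itself: ((b + 1) a^2 - a^2) / b = a^2. This fixes the coefficient b + 1
   of the variances in [gibbs]. *)
rewrite (_ : (_ - _) / _ = dens (c i0) ^+ 2); last by field; exact: B0.
rewrite /outer_weight gibbsE mulrA ler_wpM2l ?prodE_le// mulr_ge0 ?expR_ge0// mulr_ge0 ?ltW//.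
by case/andP: mc.
Qed.

Let bound2 (c : cfg n.+1) i0 : mixed (c i0) ->
  (forall i, i != i0 -> ~~ mixed (c i)) ->
  (exists2 i, i != i0 & dens (c i) = 1) -> outer_weight c <= G2 c.
Proof.
move=> mc tr ex; rewrite /G2 (bigD1 i0)//= (bigD1 i0)//= eqxx mc mul1r.
rewrite big1 ?mulr1 => [|i ii]; last by rewrite (negbTE ii) tr.
apply: (@le_trans _ _ (B * eps * minor_weight (c i0))); last first.
  rewrite ler_wpM2l ?mulr_ge0// lerDl.
  apply: sumr_ge0 => i1 _; apply: prodr_ge0 => i _.
  by case: ifP => // _; rewrite mulr_ge0 ?minor_weight_ge0.
have Mu : 1 <= M * minor (dens (c i0)).
  case: (mixed_minor (c i0)) => //; move: mc => /andP[h0 h1].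
  by rewrite /minor minEle; case: ifP => _; lra.
have := @single_mixed_bound _ _ _ (fun i => dens01 (c i)) N M i0 b2 N0 M0 Mu
   (fun i ii => not_mixed (tr i ii)) ex.
rewrite -/eps outer_weight_node -/M => h.
apply: (@le_trans _ _ (B * eps * (M * minor (dens (c i0)) *
  expR (- (N * minor (dens (c i0)) ^+ 2))) * E (c i0))).
  apply: ler_pM => //; last exact: prodE_le.
  - rewrite !mulr_ge0 ?expR_ge0 ?(ltW M0)//; apply: sumr_ge0 => i _.
    by case/andP: (dens01 (c i)).
  - by apply: prodr_ge0 => i _; rewrite expR_ge0.
by rewrite /minor_weight gibbsE -/M !mulrA.
Qed.

Let bound3 (c : cfg n.+1) i0 i1 :
  (forall i, minor (dens (c i)) <= minor (dens (c i0))) ->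
  mixed (c i0) -> mixed (c i1) -> i1 != i0 -> outer_weight c <= G3 c.
Proof.
move=> umax m0 m1 ii; rewrite /G3 (bigD1 i0)//= (bigD1 i1)//=.
set T := \prod_i _; set X := \sum_(i | _) _; set Y := \sum_(i | _) _.
have nn j0 j1 : 0 <= \prod_i (if (i == j0) || (i == j1)
    then (mixed (c i))%:R * (D * minor_weight (c i))
    else (~~ mixed (c i))%:R + (mixed (c i))%:R * (D * minor_weight (c i))).
  apply: prodr_ge0 => i _.
  by case: ifP => _; [exact: mixD_ge0|apply: addr_ge0 (mixD_ge0 _)].
have X0 : 0 <= X by apply: sumr_ge0 => j1 _; apply: nn.
have Y0 : 0 <= Y by apply: sumr_ge0 => j0 _; apply: sumr_ge0 => j1 _; apply: nn.
apply: (@le_trans _ _ (90 * B / D * T)); last first.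
  by rewrite ler_wpM2l ?mulr_ge0 ?invr_ge0 ?(ltW D0)// -addrA lerDl addr_ge0.
have Mu : 1 <= M * minor (dens (c i0)).
  case: (mixed_minor (c i0)) => //; move: m0 => /andP[h0 h1].
  by rewrite /minor minEle; case: ifP => _; lra.
pose t i := if minor (dens (c i)) == 0 then 1 else
  D * (M * minor (dens (c i)) * expR (- (N * minor (dens (c i)) ^+ 2))).
have h : D * (M * (\sum_i dens (c i)) *
    expR (- (N * node_cost (fun i => dens (c i))))) <= 90 * B * \prod_i t i.
  by apply: (@multi_mixed_bound _ _ _ _ _ _ _ i0) => //;
    [move=> i; exact: dens01|move=> v; exact: expR_le_linear|move=> i; exact: mixed_minor].
have t0 i : 0 <= t i.
  rewrite /t; case: ifP => // _.
  by rewrite !mulr_ge0 ?expR_ge0 ?minor_ge0 ?dens01 ?(ltW D0) ?(ltW M0).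
have tT : \prod_i t i * \prod_i E (c i) <= T.
  rewrite -big_split; apply: ler_prod => i _ /=; rewrite mulr_ge0 ?expR_ge0//=.
  have mz : mixed (c i) = (minor (dens (c i)) != 0).
    have [/andP[h0 h1]|/not_mixed[]->] := boolP (mixed (c i)).
    - by apply/esym; rewrite /minor minEle; case: ifP => _; apply/eqP; lra.
    - by apply/esym/negbTE; rewrite negbK /minor min_l; [apply/eqP|]; lra.
    - by apply/esym/negbTE; rewrite negbK /minor min_r; [apply/eqP|]; lra.
  have mt : mixed (c i) -> t i * E (c i) = D * minor_weight (c i).
    by rewrite mz /t => /negbTE ->; rewrite /minor_weight gibbsE -/M !mulrA.
  case: ifP => [/orP[]/eqP ii0|_].
  - by rewrite -ii0 in m0; rewrite m0 mul1r mt.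
  - by rewrite -ii0 in m1; rewrite m1 mul1r mt.
  have [mi|mi] := boolP (mixed (c i)); first by rewrite add0r mul1r mt.
  move: mi; rewrite mz negbK /t => ->; rewrite /= mul0r addr0 mul1r.
  exact: E_le1.
rewrite outer_weight_node -/M mulrAC [leRHS]mulrAC ler_pdivlMr//.
apply: (@le_trans _ _ (90 * B * (\prod_i t i * \prod_i E (c i)))); last first.
  by rewrite ler_wpM2l// mulr_ge0.
rewrite [leRHS]mulrA.
rewrite [leLHS](_ : _ = D * (M * (\sum_i dens (c i)) *
   expR (- (N * node_cost (fun i => dens (c i))))) * \prod_i E (c i)); last first.
  by rewrite /E; ring.
by rewrite ler_wpM2r// prodr_ge0// => i _; rewrite expR_ge0.
Qed.

Lemma outer_weight_node_le (c : cfg n.+1) : mixed c -> outer_weight c <= G0 c + G1 c + G2 c + G3 c.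
Proof.
move=> mc.
have g0 := G0_ge0 c; have g1 := G1_ge0 c; have g2 := G2_ge0 c; have g3 := G3_ge0 c.
have [j mj|none] := pickP (fun i => mixed (c i)); last first.
  have := bound0 (fun i => negbT (none i)) mc; lra.
(* The child exempt from the interaction factor is the one of largest minor density; by maximality
   it is mixed as soon as some child is. *)
pose i0 := [arg max_(i > j) minor (dens (c i))]%O.
have umax i : minor (dens (c i)) <= minor (dens (c i0)).
  by rewrite /i0; case: arg_maxP => // k _; apply.
have m0 : mixed (c i0).
  apply: contraT => /not_mixed h; have := umax j; move: mj => /andP[h0 h1].
  have -> : minor (dens (c i0)) = 0.
    by rewrite /minor minEle; case: h => ->; case: ifP; lra.
  by rewrite /minor minEle; case: ifP => _; lra.
have [i1 /andP[ii m1]|none] := pickP (fun i => (i != i0) && mixed (c i)).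
  have := bound3 umax m0 m1 ii; lra.
have tr i : i != i0 -> ~~ mixed (c i).
  by move=> ii; move: (none i); rewrite ii/= => ->.
have [i1 /andP[ii /eqP d1]|nof] := pickP (fun i => (i != i0) && (dens (c i) == 1)).
  have := bound2 m0 tr (ex_intro2 _ _ i1 ii d1); lra.
have := @bound1 c i0 m0; suff dz i : i != i0 -> dens (c i) = 0.
  by move=> /(_ dz); lra.
by move=> ii; case: (not_mixed (tr i ii)) => // d1; move: (nof i); rewrite ii d1 eqxx.
Qed.

(** The bounds G0 to G3 are sums of products over the children, so their sums over all
    configurations factor. A trivial child has two states, whence 2^b; in G3 an unmarked child
    contributes at most 2 + 1, by the hypothesis, whence 3^b. The two marked children make the last
    term quadratic in the mass. *)
Lemma mass_step : D * (2 * mass n) <= 1 ->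
  mass n.+1 <= B * mass n + 2 ^+ b * (B * M * expR (- N))
    + B * eps * (B * 2 ^+ b * (2 * mass n))
    + 90 * B / D * (B ^+ 2 * 3 ^+ b * (D * (2 * mass n)) ^+ 2).
Proof.
move=> hD.
have sz := sum_minor_weight n; have m0 := mass_ge0 n.
set Z := 2 * mass n in hD sz *.
have Z0 : 0 <= Z by rewrite mulr_ge0.
have smix (F : cfg n -> R) : \sum_(x : cfg n) (mixed x)%:R * F x = \sum_(x | mixed x) F x.
  by rewrite [RHS]big_mkcond; apply: eq_bigr => x _; case: (mixed x); rewrite ?mul1r ?mul0r.
have prodle (F : 'I_b -> R) (a : R) : 1 <= a -> (forall i, 0 <= F i <= a) ->
    \prod_i F i <= a ^+ b.
  move=> a1 Fa; rewrite -[X in _ ^+ X]card_ord -prodr_const.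
  by apply: ler_prod => i _.
have mz_ge0 x : 0 <= (mixed x)%:R * minor_weight x by rewrite mulr_ge0// minor_weight_ge0.
have scst (F : 'I_b -> R) (a : R) : (forall i, F i <= a) -> \sum_i F i <= B * a.
  move=> Fa; apply: (@le_trans _ _ (\sum_(i < b) a)); first exact: ler_sum.
  by rewrite sumr_const card_ord mulr_natl.
apply: (@le_trans _ _ (\sum_(c : cfg n.+1) (G0 c + G1 c + G2 c + G3 c))).
  rewrite /mass big_mkcond; apply: ler_sum => c _; case: ifP => [/outer_weight_node_le//|_].
  by rewrite !addr_ge0.
rewrite !big_split/=.
have S0 : \sum_c G0 c <= 2 ^+ b * (B * M * expR (- N)).
  rewrite /G0 -mulr_sumr mulrC ler_wpM2r//; first by rewrite !mulr_ge0 ?expR_ge0 ?(ltW M0).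
  rewrite (sum_prod_node (fun _ x => (~~ mixed x)%:R)); apply: prodle; first by rewrite ler1n.
  by move=> i; rewrite sum_trivial sumr_ge0.
have S1 : \sum_c G1 c <= B * mass n.
  rewrite /G1 exchange_big/=; apply: scst => i0.
  rewrite (sum_prod_node (fun i x => if i == i0 then (mixed x)%:R * outer_weight x
                   else (dens x == 0)%:R)) (bigD1 i0)//= eqxx smix.
  rewrite -/(mass n); apply: ler_piMr; first exact: mass_ge0.
  apply: prodr_ile1 => i /negbTE ->; rewrite sum_dens_eq ?sumr_ge0//; by left.
have S2 : \sum_c G2 c <= B * eps * (B * 2 ^+ b * Z).
  rewrite /G2 -mulr_sumr ler_wpM2l ?mulr_ge0//.
  rewrite exchange_big/= -mulrA; apply: scst => i0.
  rewrite (sum_prod_node (fun i x => if i == i0 then (mixed x)%:R * minor_weight x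
                   else (~~ mixed x)%:R)) (bigD1 i0)//= eqxx smix mulrC.
  apply: ler_pM => //.
  - by rewrite prodr_ge0// => i _; apply: sumr_ge0 => x _; case: ifP => _ //; exact: mz_ge0.
  - by apply: sumr_ge0 => x _; apply: minor_weight_ge0.
  apply: (@le_trans _ _ (\prod_(i < b) 2)); last by rewrite prodr_const card_ord.
  rewrite [leRHS](bigD1 i0)//= -[leLHS]mul1r; apply: ler_pM => //.
  - by rewrite prodr_ge0// => i _; apply: sumr_ge0 => x _; case: ifP => _ //; exact: mz_ge0.
  - by rewrite ler1n.
  by apply: ler_prod => i /negbTE ->; rewrite sum_trivial sumr_ge0.
have S3 : \sum_c G3 c <= 90 * B / D * (B ^+ 2 * 3 ^+ b * (D * Z) ^+ 2).
  rewrite /G3 -mulr_sumr ler_wpM2l ?mulr_ge0 ?invr_ge0 ?(ltW D0)//.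
  rewrite exchange_big/=; under eq_bigr do rewrite exchange_big/=.
  have DZ0 : 0 <= D * Z by rewrite mulr_ge0 ?(ltW D0).
  have sD : \sum_(x : cfg n) (mixed x)%:R * (D * minor_weight x) <= D * Z.
    have := smix (fun x => D * minor_weight x); rewrite /= => ->.
    by rewrite -mulr_sumr ler_wpM2l// ltW.
  have sD0 : 0 <= \sum_(x : cfg n) (mixed x)%:R * (D * minor_weight x).
    by apply: sumr_ge0 => x _; apply: mixD_ge0.
  have st : 0 <= \sum_(x : cfg n) (~~ mixed x)%:R :> R by apply: sumr_ge0.
  apply: (@le_trans _ _ (\sum_(i0 < b) \sum_(i1 < b) 3 ^+ b * (D * Z) ^+ 2)); last first.
    by rewrite !sumr_const card_ord -mulrnA -[_ *+ _]mulr_natl natrM expr2 !mulrA.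
  apply: ler_sum => i0 _.
  rewrite [leRHS](bigID (fun i1 => i1 != i0))/= ler_wpDr//.
    by apply: sumr_ge0 => i1 _; rewrite mulr_ge0 ?sqr_ge0 ?exprn_ge0.
  apply: ler_sum => i1 i10.
  rewrite (sum_prod_node (fun i x => if (i == i0) || (i == i1)
      then (mixed x)%:R * (D * minor_weight x)
      else (~~ mixed x)%:R + (mixed x)%:R * (D * minor_weight x))).
  rewrite (bigD1 i0)//= (bigD1 i1)//= !eqxx orbT/=.
  rewrite mulrA mulrC; apply: ler_pM.
  - rewrite prodr_ge0// => i _; apply: sumr_ge0 => x _.
    by case: ifP => _; [exact: mixD_ge0|apply: addr_ge0 (mixD_ge0 _)].
  - by rewrite mulr_ge0.
  - apply: (@le_trans _ _ (\prod_(i < b | (i != i0) && (i != i1)) 3)).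
      apply: ler_prod => i /andP[/negbTE -> /negbTE ->] /=.
      rewrite big_split/= addr_ge0//=.
      by have := sum_trivial n; lra.
    apply: (@le_trans _ _ (\prod_(i < b) 3)); last by rewrite prodr_const card_ord.
    rewrite [leRHS](bigD1 i0)//= [X in _ <= _ * X](bigD1 i1)//= mulrA.
    by rewrite ler_peMl ?prodr_ge0//; lra.
  - by rewrite expr2; apply: ler_pM.
lra.
Qed.

End Step.

End Weights.
End Configurations.

(** * Solving the recursion and bounding the sum over all cuts *)

Section CutSum.
Context {R : realType} (b : nat).
Local Notation B := (b%:R : R).
Hypothesis b2 : (2 <= b)%N.
Let B2 : 2 <= B. Proof. by rewrite ler_nat. Qed.
Let B0 : B != 0. Proof. by have := B2; lra. Qed.
Variable N : R.
Hypothesis N0 : 0 <= N.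
Local Notation mass := (@mass R b N).
Local Notation cfg := (cfg b).
Local Notation dens := (@dens R b _).
Local Notation varsum := (@varsum R b _).
Local Notation mixed := (@mixed R b _).
Local Notation minor_weight := (@minor_weight R b N _).

(** The recursion is normalised by b^h exp (- N), so that each height adds 2^b plus an error. The
    errors depend on the mass, hence a bootstrap: under the a priori bound [vb], twice the main term
    2^b n, they sum to at most 2^b n, which gives [vb] back. *)
Lemma mass_le n (C Q : R) :
  (0 < n)%N -> C = 360 * B ^+ 2 * 3 ^+ b ->
  Q = 81 * (B ^+ n * expR (- N)) + n%:R * ((N + 8) * expR (- (N / 2))) ->
  2 ^+ (b + 4) * C * (n%:R * Q) <= 1 ->
  mass n <= B ^+ n * expR (- N) * (2 ^+ b.+1 * n%:R).
Proof.
move=> n0 CE QE small.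
have e1 := expR_ge0 (- N : R); have e2 := expR_ge0 (- (N / 2) : R).
have n1 : 1 <= n%:R :> R by rewrite ler1n.
have p2 : 1 <= 2 ^+ b :> R by rewrite exprn_ege1// ler1n.
have p3 : 2 ^+ b <= 3 ^+ b :> R by rewrite lerXn2r ?nnegrE// ler_nat.
have BB : B <= B ^+ 2 by rewrite expr2; have := B2; nra.
have C1 : 2 ^+ b.+1 * B <= C.
  rewrite CE exprS -mulrA [_ ^+ b * B]mulrC.
  have : B * 2 ^+ b <= B ^+ 2 * 3 ^+ b by apply: ler_pM => //; rewrite exprn_ge0.
  have : 0 <= B ^+ 2 * 3 ^+ b by rewrite mulr_ge0 ?exprn_ge0.
  lra.
have C4 : 4 <= C.
  by apply: le_trans C1; rewrite exprS; have := B2; nra.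
have W0 h : 0 <= B ^+ h * expR (- N) by rewrite mulr_ge0 ?exprn_ge0.
have Q0 : 0 <= Q.
  by rewrite QE addr_ge0 ?mulr_ge0// addr_ge0.
have nQ0 : 0 <= n%:R * Q by rewrite mulr_ge0.
set vb := 2 ^+ b.+1 * n%:R.
have vb1 : 1 <= vb by rewrite /vb [2 ^+ b.+1]exprS; nra.
have small3 : 2 * C * vb ^+ 2 * Q <= 2 ^+ b * n%:R.
  rewrite [leLHS](_ : _ = (2 ^+ b * n%:R) * (2 ^+ 3 * 2 ^+ b * C * (n%:R * Q))); last first.
    by rewrite /vb [2 ^+ b.+1]exprS; ring.
  apply: ler_piMr; first by rewrite mulr_ge0// exprn_ge0.
  apply: (le_trans _ small); apply: ler_wpM2r => //; apply: ler_wpM2r; first by lra.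
  by rewrite exprD; lra.
have small4 : 2 * Q * vb <= 1.
  apply: le_trans small; rewrite /vb [2 ^+ b.+1]exprS exprD.
  rewrite [leLHS](_ : _ = 2 ^+ b * (n%:R * Q) * 4); last by ring.
  rewrite [leRHS](_ : _ = 2 ^+ b * (n%:R * Q) * (16 * C)); last by ring.
  by rewrite ler_wpM2l ?mulr_ge0//; lra.
have Q1 : Q <= 1 by nra.
(* A common bound at height h for the factor [eps] of the full siblings and for [D * W], the
   interaction price times the size of the mass. *)
pose q h : R := 81 * (B ^+ h * expR (- N)) + (N + 8) * expR (- (N / 2)).
have q0 h : 0 <= q h by rewrite addr_ge0 ?mulr_ge0 ?addr_ge0.
have N8 : 0 <= (N + 8) * expR (- (N / 2)) by rewrite mulr_ge0 ?addr_ge0.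
have Bmono h : (h <= n)%N -> B ^+ h <= B ^+ n.
  by move=> hn; apply: ler_weXn2l => //; have := B2; lra.
have qQ h : (h <= n)%N -> q h <= Q.
  move=> hn; rewrite QE /q lerD//; first by rewrite ler_wpM2l// ler_wpM2r// Bmono.
  by rewrite ler_peMl.
(* The terms growing like b^i form a geometric sum dominated by b^h, as b >= 2; only the others
   collect a factor h. *)
have sq h : \sum_(i < h) q i <= 81 * (B ^+ h * expR (- N)) + h%:R * ((N + 8) * expR (- (N / 2))).
  elim: h => [|h IH]; first by rewrite big_ord0 mul0r addr0 mulr_ge0// W0.
  rewrite big_ord_recr/= exprS -natr1.
  have : 0 <= (B - 2) * (B ^+ h * expR (- N)) by rewrite mulr_ge0// subr_ge0.
  have -> : q h = 81 * (B ^+ h * expR (- N)) + (N + 8) * expR (- (N / 2)) by [].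
  by move: IH; lra.
have sQ h : (h <= n)%N -> \sum_(i < h) q i <= Q.
  move=> hn; apply: (le_trans (sq h)); rewrite QE lerD//.
    by rewrite ler_wpM2l// ler_wpM2r// Bmono.
  by rewrite ler_wpM2r// ler_nat.
pose v h := 2 ^+ b * h%:R + 2 * C * vb ^+ 2 * \sum_(i < h) q i.
have vvb h : (h <= n)%N -> v h <= vb.
  move=> hn; rewrite [leRHS](_ : _ = 2 ^+ b * n%:R + 2 ^+ b * n%:R); last first.
    by rewrite /vb [2 ^+ b.+1]exprS; ring.
  rewrite /v lerD//.
    by rewrite ler_wpM2l ?ler_nat.
  apply: le_trans small3; rewrite ler_wpM2l ?sQ// !mulr_ge0 ?sqr_ge0//; lra.
have v0 h : 0 <= v h.
  by rewrite /v addr_ge0 ?mulr_ge0 ?exprn_ge0 ?sumr_ge0//; lra.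
suff claim h : (h <= n)%N -> mass h <= B ^+ h * expR (- N) * v h.
  by apply: (le_trans (claim n (leqnn n))); rewrite ler_wpM2l// vvb.
elim: h => [_|h IH hn].
  by rewrite mass0 expr0 mul1r mulr_ge0.
have {}IH := IH (ltnW hn); have hn' : (h <= n)%N := ltnW hn.
set M := B ^+ h in IH; set W := M * expR (- N) in IH.
have M0 : 0 < M by rewrite exprn_gt0//; have := B2; lra.
have W0' : 0 <= W := W0 h.
have sm1 : W <= 1.
  by have := qQ h hn'; rewrite /q -/M -/W; lra.
have sm2 : N * expR (- (N / 2)) <= 1.
  by have := qQ h hn'; rewrite /q -/M -/W; lra.
set D := 3 + N * expR (N / 2) / M.
have D0 : 0 < D by rewrite ltr_pwDl// !mulr_ge0 ?expR_ge0// invr_ge0 ltW.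
have DW : D * W <= q h.
  rewrite /D mulrDl (_ : N * expR (N / 2) / M * W = N * expR (- (N / 2))).
    rewrite /q -/M -/W; lra.
  have -> : expR (- (N / 2)) = expR (N / 2) * expR (- N) by rewrite -expRD; congr expR; lra.
  by rewrite /W; field; rewrite gt_eqF.
have vh := vvb h hn'; have vh0 := v0 h.
have m0 := mass_ge0 b2 N h.
have Dm : D * (2 * mass h) <= 1.
  apply: (@le_trans _ _ (2 * (D * W) * v h)).
    rewrite [leRHS](_ : _ = D * (2 * (W * v h))); last by ring.
    by rewrite ler_wpM2l ?(ltW D0)// ler_wpM2l.
  apply: le_trans small4; apply: ler_pM => //.
    by rewrite !mulr_ge0// ltW.
  by rewrite ler_wpM2l// (le_trans DW)// qQ.
have := mass_step b2 N0 sm1 sm2 Dm; rewrite -/M -/D.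
set eps := 8 * _ + _ + _ => rec; apply: (le_trans rec).
have epsq : eps <= q h by rewrite /eps /q -/M; lra.
have eps0 : 0 <= eps by rewrite /eps -/W; have := mulr_ge0 N0 e2; lra.
have -> : B ^+ h.+1 * expR (- N) = B * W by rewrite exprS -mulrA.
have vS : v h.+1 = v h + 2 ^+ b + 2 * C * vb ^+ 2 * q h.
  by rewrite /v big_ord_recr/= -natr1; ring.
have BW0 : 0 <= B * W by rewrite mulr_ge0.
have t1 : B * mass h <= B * W * v h by rewrite -mulrA ler_wpM2l.
have t2 : 2 ^+ b * (B * M * expR (- N)) = B * W * 2 ^+ b by rewrite /W; ring.
have t3 : B * eps * (B * 2 ^+ b * (2 * mass h)) <= B * W * (C * vb ^+ 2 * q h).
  apply: (@le_trans _ _ (B * eps * (B * 2 ^+ b * (2 * (W * v h))))).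
    by rewrite !ler_wpM2l// mulr_ge0// exprn_ge0.
  rewrite [leLHS](_ : _ = B * W * ((2 ^+ b.+1 * B) * v h * eps)); last by rewrite [2 ^+ b.+1]exprS; ring.
  rewrite ler_wpM2l//; apply: ler_pM => //; first by rewrite !mulr_ge0// exprn_ge0.
  by apply: ler_pM => //; apply: (le_trans vh); nra.
have t4 : 90 * B / D * (B ^+ 2 * 3 ^+ b * (D * (2 * mass h)) ^+ 2) <=
    B * W * (C * vb ^+ 2 * q h).
  apply: (@le_trans _ _ (90 * B / D * (B ^+ 2 * 3 ^+ b * (D * (2 * (W * v h))) ^+ 2))).
    rewrite ler_wpM2l ?mulr_ge0 ?invr_ge0 ?(ltW D0)// ler_wpM2l ?mulr_ge0 ?exprn_ge0//.
    have Dm0 : 0 <= D * (2 * mass h) by rewrite !mulr_ge0// ltW.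
    have Dle : D * (2 * mass h) <= D * (2 * (W * v h)).
      by rewrite ler_wpM2l ?(ltW D0)// ler_wpM2l.
    by rewrite lerXn2r ?nnegrE// (le_trans Dm0).
  (* Origin of C = 360 b^2 3^b: the 90 of [multi_mixed_bound] times the square of the 2 in
     [2 * mass h]. One factor [D] cancels, and [D * W] remains small. *)
  rewrite [leLHS](_ : _ = B * W * (C * v h ^+ 2 * (D * W))); last first.
    by rewrite CE; field; rewrite gt_eqF.
  have C0 : 0 <= C by lra.
  have vv : v h ^+ 2 <= vb ^+ 2 by rewrite lerXn2r ?nnegrE//; lra.
  have DW0 : 0 <= D * W := mulr_ge0 (ltW D0) W0'.
  have Cv0 : 0 <= C * v h ^+ 2 := mulr_ge0 C0 (sqr_ge0 _).
  apply: ler_wpM2l => //; apply: (ler_pM Cv0 DW0) => //.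
  exact: ler_wpM2l.
rewrite vS t2; move: t1 t3 t4; set A3 := B * eps * _; set A4 := 90 * B / D * _.
lra.
Qed.

(** At the apex there are no further ancestors, so the factors M u and exp (- N u^2) of the weight
    have to be removed: for u <= 1/2, exp (N u^2) <= exp (N u / 2) <= K M u by [expR_le_linear] with
    N / 2. *)
Lemma cut_sum_le n (C Q : R) :
  (0 < n)%N -> C = 360 * B ^+ 2 * 3 ^+ b ->
  Q = 81 * (B ^+ n * expR (- N)) + n%:R * ((N + 8) * expR (- (N / 2))) ->
  2 ^+ (b + 4) * C * (n%:R * Q) <= 1 ->
  \sum_(c : cfg n | mixed c) expR (- (N * ((B + 1) * varsum c))) <=
  2 ^+ (b + 2) * (n%:R * Q).
Proof.
move=> n0 CE QE small; have mle := mass_le n0 CE QE small.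
set M := B ^+ n in QE mle.
have M0 : 0 < M by rewrite exprn_gt0//; have := B2; lra.
set K := 3 + N / 2 * expR (N / 2 / 2) / M.
have K0 : 0 <= K by rewrite addr_ge0// !mulr_ge0 ?expR_ge0// ?invr_ge0 ltW.
apply: (@le_trans _ _ (K * \sum_(c : cfg n | mixed c) minor_weight c)).
  rewrite mulr_sumr; apply: ler_sum => c mc.
  set u := minor (dens c).
  have Mu : 1 <= M * u.
    case: (@mixed_minor R b b2 n c) => //; move: mc => /andP[h0 h1].
    by rewrite /minor minEle; case: ifP => _; lra.
  have u0 : 0 <= u by exact: minor_ge0 (@dens01 R b b2 n c).
  have u2 : u <= 1 / 2 by exact: minor_le2.
  have h := @expR_le_linear _ u (N / 2) M (divr_ge0 N0 (ler0n _ 2)) M0 Mu u2.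
  rewrite /minor_weight -/u -/M /gibbs mulrDr opprD expRD.
  rewrite [leRHS](_ : _ = (K * (M * u) * expR (- (N * u ^+ 2))) *
      expR (- (N * ((B + 1) * varsum c)))); last by ring.
  rewrite ler_peMl ?expR_ge0//.
  apply: (@le_trans _ _ (expR (N / 2 * u) * expR (- (N * u ^+ 2)))); last first.
    by rewrite ler_wpM2r ?expR_ge0.
  rewrite -expRD -[leLHS]expR0 ler_expR.
  have : 0 <= N * u * (1 / 2 - u) by rewrite !mulr_ge0// subr_ge0.
  lra.
apply: (@le_trans _ _ (K * (2 * (M * expR (- N) * (2 ^+ b.+1 * n%:R))))).
  rewrite ler_wpM2l//; apply: (le_trans (sum_minor_weight b2 N n)); by rewrite ler_wpM2l.
rewrite [leLHS](_ : _ = 2 ^+ (b + 2) * n%:R * (K * (M * expR (- N)))); last first.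
  by rewrite [2 ^+ b.+1]exprS exprD; ring.
rewrite [leRHS]mulrA ler_wpM2l ?mulr_ge0 ?exprn_ge0//.
have -> : K * (M * expR (- N)) = 3 * (M * expR (- N)) + N / 2 * expR (- (N / 2)) * expR (- (N / 4)).
  rewrite -[X in _ = _ + X]mulrA -expRD.
  have -> : - (N / 2) - N / 4 = N / 2 / 2 - N by lra.
  by rewrite /K expRD; field; exact: lt0r_neq0.
have e1 := expR_ge0 (- N : R); have e2 := expR_ge0 (- (N / 2) : R).
have e4 : expR (- (N / 4)) <= 1 by rewrite -[leRHS]expR0 ler_expR oppr_le0 divr_ge0.
have n1 : 1 <= n%:R :> R by rewrite ler1n.
rewrite QE; apply: lerD.
  by rewrite ler_wpM2r ?mulr_ge0 ?(ltW M0)// ler_nat.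
apply: (@le_trans _ _ (N / 2 * expR (- (N / 2)))).
  by rewrite ler_piMr// mulr_ge0//; have := N0; lra.
apply: (@le_trans _ _ ((N + 8) * expR (- (N / 2)))).
  by rewrite ler_wpM2r//; have := N0; lra.
by rewrite ler_peMl// mulr_ge0//; have := N0; lra.
Qed.

End CutSum.

(** * Energy and drift of indicator functions *)

Section Indicators.
Context {R : realType} (b : nat).
Local Notation B := (b%:R : R).
Hypothesis b2 : (2 <= b)%N.
Let B2 : 2 <= B. Proof. by rewrite ler_nat. Qed.
Let B0 : B != 0. Proof. by have := B2; lra. Qed.
Let Bpos : 0 < B. Proof. by have := B2; lra. Qed.

Fixpoint cfg_of (n : nat) (f : seq 'I_b -> bool) : cfg b n :=
  match n return cfg b n with
  | 0 => f [::]
  | m.+1 => [ffun i => cfg_of m (fun w => f (i :: w))]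
  end.

Definition ind (f : seq 'I_b -> bool) (w : seq 'I_b) : R := (f w)%:R.

Lemma dens_cfg_of n f : dens (cfg_of n f) = avg n (ind f).
Proof.
elim: n f => [//|n IH] f /=; congr (_ * _); apply: eq_bigr => i _.
by rewrite ffunE IH.
Qed.

Lemma esc_expb_ge1 n : (0 < n)%N -> 1 <= esc b n * B ^+ n :> R.
Proof.
move=> n0; rewrite /esc mulrC ler_pdivlMr ?subr_gt0 ?expb_gt1//; lra.
Qed.

(** Replaces every w_j by 1, which only lowers the cost; the recursion over configurations then has
    coefficients independent of the height. *)
Lemma varsum_le_energy n f :
  varsum (cfg_of n f) <= B ^+ n * energy n (ind f).
Proof.
elim: n f => [|n IH] f; first by rewrite /= mulr0.
have -> : varsum (cfg_of n.+1 f) =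
    child_var n (ind f) + \sum_(i < b) varsum (R := R) (cfg_of n (fun w => f (i :: w))).
  rewrite /child_var /=; congr (_ * _ - (_ * _) ^+ 2 + _); apply: eq_bigr => i _;
    by rewrite ffunE ?dens_cfg_of.
rewrite [energy _ _]/= mulrDr lerD//.
  rewrite mulrA [_ * esc _ _]mulrC ler_peMl ?child_var_ge0//.
  exact: esc_expb_ge1.
rewrite exprS mulrACA mulfV// mul1r mulr_sumr; apply: ler_sum => i _.
exact: IH.
Qed.

Lemma avg_prefix n x : (size x <= n)%N ->
  avg n (ind (prefix x)) = B^-1 ^+ size x.
Proof.
elim: x n => [|i x IH] n sx.
  rewrite (@eq_avg _ _ _ _ (fun=> 1)) ?avg_const ?expr0// => w _.
  by rewrite /ind prefix0s.
case: n sx => //= n sx; rewrite exprS (bigD1 i)//= big1 ?addr0 => [|j ji].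
  rewrite -(IH n)//; congr (_ * _); apply: eq_avg => w _.
  by rewrite /ind/= eqxx.
rewrite (@eq_avg _ _ _ _ (fun=> 0)) ?avg_const// => w _.
by rewrite /ind/= eq_sym (negbTE ji).
Qed.

Lemma sum_prefix n x : (size x <= n)%N ->
  \sum_(v : n.-tuple 'I_b) ind (prefix x) v = B ^+ (n - size x).
Proof.
move=> xn; rewrite (@sum_leaf _ _ b2 n (ind (prefix x))) avg_prefix//.
by rewrite -{1}(subnK xn) exprD exprVn mulfK// expf_neq0.
Qed.

Lemma eq_energy n (f g : seq 'I_b -> R) :
  (forall w, size w = n -> f w = g w) -> energy n f = energy n g.
Proof.
elim: n f g => [//|n IH] f g fg.
rewrite [LHS]/= [RHS]/= /child_var (eq_avg fg).
have fgi i : avg n (fun w => f (i :: w)) = avg n (fun w => g (i :: w)).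
  by apply: eq_avg => w sw; rewrite fg//= sw.
congr (_ * (_ * _ - _) + _ * _); apply: eq_bigr => i _; first by rewrite fgi.
by apply: IH => w sw; rewrite fg//= sw.
Qed.

Lemma energy0 n (c : R) : energy n (fun _ : seq 'I_b => c) = 0.
Proof.
elim: n => [//|n IH]; rewrite [LHS]/= /child_var !avg_const//.
rewrite IH !sumr_const card_ord mul0rn mulr0 addr0 -[(_ ^+ 2) *+ _]mulr_natl mulKf//.
by rewrite subrr mulr0.
Qed.

(* The energy of a subtree of height k inside a tree of height k + l. *)
Fixpoint cyl_energy (k l : nat) : R :=
  if l is m.+1 then
    esc b (k + l) * ((B - 1) * B^-1 ^+ l ^+ 2) + B^-1 * cyl_energy k m
  else 0.

Lemma energy_prefix k x :
  energy (k + size x) (ind (prefix x)) = cyl_energy k (size x).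
Proof.
elim: x => [|i x IH].
  rewrite addn0 (@eq_energy _ _ (fun=> 1)) ?energy0// => w _.
  by rewrite /ind prefix0s.
rewrite addnS [LHS]/= [RHS]/= addnS.
have hi w : ind (prefix (i :: x)) (i :: w) = ind (prefix x) w.
  by rewrite /ind/= eqxx.
have hj j w : j != i -> ind (prefix (i :: x)) (j :: w) = 0.
  by move=> ji; rewrite /ind/= eq_sym (negbTE ji).
congr (_ * _ + _ * _); last first.
  rewrite (bigD1 i)//= big1 ?addr0 => [|j ji].
    by rewrite -IH; apply: eq_energy => w _; rewrite hi.
  by rewrite (@eq_energy _ _ (fun=> 0)) ?energy0// => w _; rewrite hj.
rewrite /child_var avg_prefix/=; last by rewrite ltnS leq_addl.
rewrite (bigD1 i)//= big1 ?addr0 => [|j ji]; last first.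
  rewrite (@eq_avg _ _ _ _ (fun=> 0)) ?avg_const ?expr0n// => w _; exact: hj.
rewrite (@eq_avg _ _ _ _ (ind (prefix x))); last by move=> w _; rewrite hi.
by rewrite avg_prefix ?leq_addl//= ![_ ^+ (size x).+1]exprS; set r := _ ^+ size x; field; exact: B0.
Qed.

Lemma esc_expb_le k n : (k < n)%N -> esc b n * B ^+ n <= (1 - B^-1 ^+ k.+1)^-1 :> R.
Proof.
move=> kn; have n0 : (0 < n)%N by case: n kn.
have h1 : 1 < B ^+ n :> R by rewrite expb_gt1.
have e : esc b n * B ^+ n = (1 - B^-1 ^+ n)^-1 :> R.
  by rewrite /esc exprVn; field; rewrite expf_neq0//=; apply/eqP; lra.
have i1 : B^-1 < 1 :> R by rewrite invf_lt1//; have := B2; lra.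
rewrite e lef_pV2 ?posrE ?subr_gt0 ?exprn_ilt1 ?invr_ge0//; last by case: n n0 {kn h1 e}.
rewrite lerD2l lerN2 ler_wiXn2l ?invr_ge0//; exact: ltW.
Qed.

(** The ancestor i levels above the block contributes (b - 1)^2 b^(-2 i) w_(k+i), and w_(k+i) <= 1 /
    (1 - b^-(k+1)). The geometric sum of (b - 1)^2 b^(-2 i) is (b - 1) / (b + 1) (1 - b^(-2 l)):
    this is where the critical constant comes from. *)
Lemma cyl_energy_le k l :
  (B - 1) * (B ^+ (k + l) * cyl_energy k l) <=
  (B - 1) / (B + 1) * (1 - B^-1 ^+ (l.*2)) / (1 - B^-1 ^+ k.+1).
Proof.
have hB := B2.
elim: l => [|l IH]; first by rewrite /= mulr0 mulr0 expr0 subrr mulr0 mul0r.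
set c := (1 - B^-1 ^+ k.+1)^-1 in IH *.
rewrite addnS [cyl_energy _ _]/=.
have -> : (B - 1) * (B ^+ (k + l).+1 *
    (esc b (k + l.+1) * ((B - 1) * B^-1 ^+ l.+1 ^+ 2) + B^-1 * cyl_energy k l)) =
  (B - 1) ^+ 2 * (B^-1 ^+ l.+1) ^+ 2 * (esc b (k + l).+1 * B ^+ (k + l).+1) +
  (B - 1) * (B ^+ (k + l) * cyl_energy k l).
  by rewrite addnS [B ^+ (k + l).+1]exprS; field; exact: B0.
have le1 : esc b (k + l).+1 * B ^+ (k + l).+1 <= c by apply: esc_expb_le; rewrite ltnS leq_addr.
set r := B^-1 ^+ l.+1.
apply: (@le_trans _ _ ((B - 1) ^+ 2 * r ^+ 2 * c +
  (B - 1) / (B + 1) * (1 - B^-1 ^+ l.*2) * c)).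
  by rewrite lerD// ler_wpM2l// mulr_ge0 ?sqr_ge0.
rewrite le_eqVlt; apply/orP; left; apply/eqP.
rewrite -mulrDl; congr (_ * _).
have -> : B^-1 ^+ l.*2 = B ^+ 2 * r ^+ 2 :> R.
  rewrite /r -exprM exprVn exprVn muln2 doubleS !exprS; field.
  by rewrite expf_neq0//; exact: B0.
have -> : B^-1 ^+ (l.+1).*2 = r ^+ 2 :> R by rewrite /r -exprM muln2.
by field; lra.
Qed.

Lemma esc_le m n : (0 < m)%N -> (m <= n)%N -> esc b n <= esc b m :> R.
Proof.
move=> m0 mn; rewrite /esc lef_pV2 ?posrE ?subr_gt0 ?expb_gt1//; last by lia.
by rewrite lerD2r ler_weXn2l//; have := B2; lra.
Qed.

Lemma esc_ge0 n : 0 <= esc b n :> R.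
Proof. by rewrite invr_ge0 subr_ge0 exprn_ege1//; have := B2; lra. Qed.

Lemma drift_prefix_le m n y v : (m < size y)%N -> (size y <= n)%N ->
  take m.+1 y != take m.+1 v ->
  drift n (ind (prefix y)) v <= esc b (n - m) * B^-1 ^+ (size y - m).
Proof.
elim: m n y v => [|m IH] n y v.
  case: y => //= i y _; case: n => //= n sy; case: v => [_|j v].
    by rewrite mulr_ge0 ?esc_ge0 ?exprn_ge0 ?invr_ge0.
  move=> ij; have {}ij : i != j by apply: contraNneq ij => ->; rewrite /= !take0.
  have z : (fun w => ind (prefix (i :: y)) (j :: w)) = (fun=> 0).
    by apply/funext => w; rewrite /ind/= (negbTE ij).
  rewrite z drift_const// avg_const// subr0 addr0 -/(avg n.+1 _) avg_prefix//=.
case: y => //= i y my; case: n => //= n sy; case: v => [_|j v].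
  by rewrite mulr_ge0 ?esc_ge0 ?exprn_ge0 ?invr_ge0.
rewrite /= -/(avg n.+1 _) avg_prefix//= !subSS => ne.
have [ij|ij] := eqVneq i j; last first.
  have z : (fun w => ind (prefix (i :: y)) (j :: w)) = (fun=> 0).
    by apply/funext => w; rewrite /ind/= (negbTE ij).
  rewrite z drift_const// avg_const// subr0 addr0; apply: ler_pM.
  - exact: esc_ge0.
  - by rewrite exprn_ge0 ?invr_ge0.
  - by apply: esc_le; lia.
  - rewrite ler_wiXn2l ?invr_ge0//; first by rewrite invf_le1//; have := B2; lra.
    lia.
have z : (fun w => ind (prefix (i :: y)) (j :: w)) = ind (prefix y).
  by apply/funext => w; rewrite /ind/= ij eqxx.
rewrite z avg_prefix//; rewrite ij in ne.
have ne' : take m.+1 y != take m.+1 v by apply: contraNneq ne => ->.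
have := IH n y v my sy ne'; set U := esc _ (n - m) * _; set d := drift _ _ _.
have : esc b n.+1 * (B^-1 ^+ (size y).+1 - B^-1 ^+ size y) <= 0.
  rewrite mulr_ge0_le0 ?esc_ge0// subr_le0.
  rewrite ler_wiXn2l ?invr_ge0//; first by rewrite invf_le1//; have := B2; lra.
lra.
Qed.

End Indicators.

(** * Real-valued probabilities and finite partitions *)

Section FiniteProbability.
Context {R : realType} {d : measure_display} {T : measurableType d}.
Variable P : probability T R.

Definition prob (A : set T) : R := fine (P A).

Lemma prE A : measurable A -> P A = (prob A)%:E.
Proof. by move=> mA; rewrite /prob fineK ?fin_num_measure. Qed.

Lemma pr_ge0 A : 0 <= prob A.
Proof. by rewrite /prob fine_ge0. Qed.

Lemma pr_le A C : measurable A -> measurable C -> A `<=` C -> prob A <= prob C.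
Proof.
move=> mA mC AC; rewrite /prob fine_le ?fin_num_measure//.
by apply: le_measure; rewrite ?inE.
Qed.

Lemma prC A : measurable A -> prob (~` A) = 1 - prob A.
Proof. by move=> mA; rewrite /prob probability_setC// (prE mA). Qed.

Lemma prT : prob setT = 1.
Proof. by rewrite /prob probability_setT. Qed.

Lemma pr0 : prob set0 = 0.
Proof. by rewrite /prob measure0. Qed.

Lemma pr_union (I : finType) (F : I -> set T) : (forall i, measurable (F i)) ->
  (forall i j, i != j -> F i `&` F j = set0) ->
  prob (\bigcup_i F i) = \sum_i prob (F i).
Proof.
move=> mF dF; apply: EFin_inj; rewrite -prE; last first.
  by apply: fin_bigcup_measurable => //; exact: finite_finset.
rewrite measure_fin_bigcup//.
- rewrite -sumEFin (_ : [set: I] = [set` index_enum I]); last first.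
    by apply/seteqP; split=> // x _ /=; rewrite mem_index_enum.
  rewrite -fsbig_seq; last exact: index_enum_uniq.
  by apply: eq_bigr => i _; exact: prE.
- exact: finite_finset.
- move=> i j _ _ [x [Fi Fj]]; apply/eqP; apply: contraT => ij.
  by have : (F i `&` F j) x by []; rewrite dF.
Qed.

Lemma pr_total (I : finType) (Y : T -> I) (A : set T) : measurable A ->
  (forall i, measurable (Y @^-1` [set i])) ->
  prob A = \sum_i prob (A `&` Y @^-1` [set i]).
Proof.
move=> mA mY; rewrite -pr_union.
- congr prob; apply/seteqP; split=> [w Aw|w [i _ []//]].
  by exists (Y w).
- by move=> i; exact: measurableI.
- move=> i j ij; apply/seteqP; split=> // w [[_ /= Yi] [_ /= Yj]].
  by move: ij; rewrite -Yi -Yj eqxx.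
Qed.

Lemma pr_union_le (I : finType) (Q : pred I) (F : I -> set T) :
  (forall i, measurable (F i)) ->
  prob (\bigcup_(i in [set i | Q i]) F i) <= \sum_(i | Q i) prob (F i).
Proof.
move=> mF; pose U (s : seq I) := \bigcup_(i in [set i | (i \in s) && Q i]) F i.
have mU s : measurable (U s) by apply: fin_bigcup_measurable => //; exact: finite_finset.
rewrite (_ : \bigcup_(i in _) F i = U (index_enum I)); last first.
  by apply: eq_bigcupl; split=> i /=; rewrite mem_index_enum.
elim: (index_enum I) => [|i s IH].
  by rewrite big_nil (_ : U [::] = set0) ?pr0//; apply/seteqP; split=> // w [i].
rewrite big_cons.
have US : U (i :: s) `<=` (if Q i then F i else set0) `|` U s.
  move=> w [j /= /andP[]]; rewrite inE => /orP[/eqP ->|js] Qj Fj.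
    by left; rewrite Qj.
  by right; exists j => //=; rewrite js.
have mQ : measurable (if Q i then F i else set0) by case: ifP.
apply: (le_trans (pr_le (mU _) (measurableU _ _ mQ (mU s)) US)).
apply: (@le_trans _ _ (prob (if Q i then F i else set0) + prob (U s))).
  rewrite -lee_fin EFinD -!prE//; last exact: measurableU.
  exact: measureU2.
by case: ifP => _; rewrite ?pr0 ?add0r ?lerD2l.
Qed.

End FiniteProbability.

(** * Absorption probabilities of a finite Markov chain *)

Section Visits.
Context {d : measure_display} {T : measurableType d} (V : finType) (L : pred V).
Context (X : nat -> T -> V).

Definition traj t (w : T) : {ffun 'I_t.+1 -> V} := [ffun s : 'I_t.+1 => X s w].

(** Beyond time t this takes the default value of [inord]; only times s <= t are ever read. *)
Definition ext t (p : {ffun 'I_t.+1 -> V}) : nat -> V := fun s => p (inord s).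

Lemma trajE t p : traj t @^-1` [set p] = [set w | forall s, (s <= t)%N -> X s w = ext p s].
Proof.
apply/seteqP; split=> w /=.
  by move=> <- s st; rewrite /ext ffunE inordK.
move=> h; apply/ffunP => s; rewrite ffunE h; last by rewrite -ltnS.
by rewrite /ext inord_val.
Qed.

Hypothesis mX : forall t x, measurable (X t @^-1` [set x]).

Lemma measurable_traj t p : measurable (traj t @^-1` [set p]).
Proof.
rewrite (_ : _ @^-1` _ = \bigcap_(s in [set: 'I_t.+1]) (X s @^-1` [set p s])).
  by apply: fin_bigcap_measurable => //; exact: finite_finset.
apply/seteqP; split=> w /=; first by move=> <- s _; rewrite /= ffunE.
by move=> h; apply/ffunP => s; rewrite ffunE; exact: h.
Qed.

(** A taboo event: the set L is avoided strictly between 0 and t. Time 0 is exempt because the walks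
    start at leaves. *)
Definition visit t (u : V) : set T :=
  [set w | X t w = u /\ forall s, (0 < s < t)%N -> ~~ L (X s w)].

Lemma measurable_walk t (Q : pred {ffun 'I_t.+1 -> V}) :
  measurable [set w | Q (traj t w)].
Proof.
rewrite (_ : [set _ | _] = \bigcup_(p in [set p | Q p]) (traj t @^-1` [set p])).
  apply: fin_bigcup_measurable => [|p _]; last exact: measurable_traj.
  exact: finite_finset.
apply/seteqP; split=> w /=; first by move=> Qw; exists (traj t w).
by move=> [p /= Qp ->].
Qed.

Lemma visitE t u : visit t u =
  [set w | (traj t w ord_max == u) && [forall s : 'I_t.+1, (0 < s < t)%N ==> ~~ L (traj t w s)]].
Proof.
apply/seteqP; split=> w /=.
  move=> [Xu h]; rewrite ffunE /= Xu eqxx /=; apply/forallP => s; apply/implyP => st.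
  by rewrite ffunE; exact: h.
move=> /andP[/eqP <- /forallP h]; rewrite ffunE; split=> // s st.
have st' : (s < t.+1)%N by lia.
by have /implyP := h (Ordinal st'); rewrite ffunE; apply.
Qed.

Lemma measurable_visit t u : measurable (visit t u).
Proof.
rewrite visitE; exact: (measurable_walk (fun p : {ffun 'I_t.+1 -> V} => (p ord_max == u) &&
  [forall s : 'I_t.+1, (0 < s < t)%N ==> ~~ L (p s)])).
Qed.

Variable A : pred V.

Definition hit : set T :=
  \bigcup_t \bigcup_(u in [set u | L u && A u]) visit t.+1 u.

Lemma measurable_hit : measurable hit.
Proof.
apply: bigcup_measurable => t _; apply: fin_bigcup_measurable => [|u _].
  exact: finite_finset.
exact: measurable_visit.
Qed.

Lemma visit_inj t u t' u' x : L u -> L u' -> visit t.+1 u x -> visit t'.+1 u' x ->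
  (t, u) = (t', u').
Proof.
move=> Lu Lu' [Xu hu] [Xu' hu']; case: (ltngtP t t') => tt.
- by have := hu' t.+1; rewrite Xu Lu /= ltnS tt => /(_ isT).
- by have := hu t'.+1; rewrite Xu' Lu' /= ltnS tt => /(_ isT).
by rewrite tt in Xu *; rewrite -Xu -Xu'.
Qed.

End Visits.

Section Hitting.
Context {R : realType} {d : measure_display} {T : measurableType d}.
Context (P : probability T R) (V : finType) (e : rel V) (L : pred V) (v : V).
Context (X : nat -> T -> V).
Hypothesis walkX : simple_random_walk P e v X.
Local Notation pr := (prob P).
Local Notation traj := (@traj _ T V X).
Local Notation visit := (@visit _ T V L X).
Local Notation step := (@srw_step R V e).

Let mX t x : measurable (X t @^-1` [set x]). Proof. exact: walkX.1. Qed.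

Definition path_wt t (p : nat -> V) : R :=
  (p 0%N == v)%:R * \prod_(s < t) step (p s) (p s.+1).

Lemma pr_traj t p : pr (traj t @^-1` [set p]) = path_wt t (ext p).
Proof. by rewrite trajE /prob walkX.2. Qed.

Let ok t (p : {ffun 'I_t.+1 -> V}) := [forall s : 'I_t.+1, (0 < s)%N ==> ~~ L (p s)].

Let pathsum t (g : V -> R) : R :=
  \sum_(p : {ffun 'I_t.+1 -> V} | ok p) path_wt t (ext p) * g (p ord_max).

Lemma pr_visitS t z : pr (visit t.+1 z) = pathsum t (step ^~ z).
Proof.
rewrite (pr_total P (measurable_visit L mX t.+1 z) (measurable_traj mX (t := t))).
rewrite /pathsum [RHS]big_mkcond; apply: eq_bigr => p _; case: ifP => [okp|nok].
  pose q s := if (s <= t)%N then ext p s else z.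
  rewrite (_ : _ `&` _ = [set w | forall s, (s <= t.+1)%N -> X s w = q s]).
    rewrite /prob walkX.2 /= /path_wt big_ord_recr/= /q /= leqnn ltnn mulrA.
    rewrite /ext (_ : inord t = ord_max); last by apply: val_inj; rewrite /= inordK.
    congr (_ * _ * _); apply: eq_bigr => s _.
    by rewrite ltn_ord (ltnW (ltn_ord s)).
  rewrite trajE; apply/seteqP; split=> w /=.
    move=> [[Xz _] h] s; rewrite /q leq_eqVlt ltnS => /predU1P[->|st].
      by rewrite ltnn.
    by rewrite st h.
  move=> h; split; last by move=> s st; rewrite h ?/q ?st// ltnW.
  split; first by rewrite h// /q ltnn.
  move=> s /andP[s0 st]; rewrite h; last exact: ltnW.
  rewrite /q -ltnS st; move/forallP: okp => /(_ (inord s)).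
  by rewrite inordK// s0.
rewrite (_ : _ `&` _ = set0) ?pr0//; apply/seteqP; split=> // w [[_ h] pw].
move: nok; suff : ok p by move=> ->.
apply/forallP => s; apply/implyP => s0; move: pw => /= <-.
by rewrite ffunE; apply: h; rewrite s0 ltn_ord.
Qed.

Lemma pathsumE t g : (0 < t)%N ->
  pathsum t g = \sum_(y | ~~ L y) pr (visit t y) * g y.
Proof.
move=> t0.
have pv y : ~~ L y -> pr (visit t y) =
    \sum_(p : {ffun 'I_t.+1 -> V} | ok p && (p ord_max == y)) path_wt t (ext p).
  move=> Ly; rewrite (pr_total P (measurable_visit L mX t y) (measurable_traj mX (t := t))).
  rewrite [RHS]big_mkcond; apply: eq_bigr => p _; case: ifP => [/andP[okp /eqP py]|nok].
    rewrite -pr_traj; congr prob; rewrite setIidr// => w /= pw.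
    rewrite visitE /= pw py eqxx /=; apply/forallP => s; apply/implyP => /andP[s0 _].
    by move/forallP: okp => /(_ s); rewrite s0.
  rewrite (_ : _ `&` _ = set0) ?pr0//; apply/seteqP; split=> // w [].
  rewrite visitE /= => /andP[/eqP h1 /forallP h2] pw; rewrite pw in h1 h2.
  move: nok; rewrite h1 eqxx andbT; suff : ok p by move=> ->.
  apply/forallP => s; apply/implyP => s0; have [st|ts] := ltnP s t.
    by have := h2 s; rewrite s0 st.
  rewrite (_ : s = ord_max) ?h1//; apply: val_inj => /=; have := ltn_ord s; lia.
rewrite /pathsum (partition_big (fun p : {ffun 'I_t.+1 -> V} => p ord_max) (fun y => ~~ L y)); last first.
  by move=> p /forallP /(_ ord_max); rewrite /= t0.
apply: eq_bigr => y Ly; rewrite (pv y Ly) mulr_suml.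
by apply: eq_bigr => p /andP[_ /eqP ->].
Qed.

Lemma pr_visit1 z : pr (visit 1 z) = step v z.
Proof.
rewrite pr_visitS /pathsum (bigD1 [ffun=> v])/=; last first.
  by apply/forallP => s; rewrite (ord1 s).
rewrite /path_wt /ext ffunE eqxx big_ord0 ffunE !mul1r big1 ?addr0// => p /andP[_ pv].
rewrite (_ : p _ == v = false) ?mul0r//; apply: contraNF pv => /eqP h.
by apply/eqP/ffunP => s; rewrite ffunE -h; congr (p _); apply: val_inj; rewrite !ord1.
Qed.

Let mean (g : V -> R) (y : V) : R := \sum_z step y z * g z.
Let Gam t g : R := \sum_z pr (visit t z) * g z.

Lemma Gam_step t g : (0 < t)%N ->
  Gam t.+1 g = \sum_(y | ~~ L y) pr (visit t y) * mean g y.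
Proof.
move=> t0; rewrite -(@pathsumE t (mean g) t0) /Gam.
under eq_bigr do rewrite pr_visitS mulr_suml.
rewrite exchange_big/=; apply: eq_bigr => p _; rewrite /mean mulr_sumr.
by apply: eq_bigr => z _; rewrite mulrA.
Qed.

Variables (h w : V -> R) (A : pred V).
Hypothesis h_harm : forall y, ~~ L y -> mean h y = h y.
Hypothesis h_bnd : forall y, L y -> h y = (A y)%:R.
Hypothesis w_ge0 : forall y, 0 <= w y.
Hypothesis w_super : forall y, ~~ L y -> mean w y <= w y - 1.

Let S t : R := \sum_(y | ~~ L y) pr (visit t y).

Let GamID t g : Gam t g =
  \sum_(y | L y) pr (visit t y) * g y + \sum_(y | ~~ L y) pr (visit t y) * g y.
Proof. by rewrite /Gam (bigID L). Qed.

Let sumS K : \sum_(t < K) S t.+1 + Gam K.+1 w <= Gam 1 w.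
Proof.
elim: K => [|K IH]; first by rewrite big_ord0 add0r.
rewrite big_ord_recr/=; apply: le_trans IH; rewrite -addrA lerD2l.
rewrite (@Gam_step K.+1)// [leRHS]GamID.
apply: (@le_trans _ _ (\sum_(y | ~~ L y) pr (visit K.+1 y) * w y)); last first.
  by rewrite lerDr sumr_ge0// => y _; rewrite mulr_ge0// pr_ge0.
rewrite /S -big_split; apply: ler_sum => y Ly /=.
have := w_super Ly; have := pr_ge0 P (visit K.+1 y); nra.
Qed.

Let sumA K : \sum_(t < K) \sum_(y | L y) pr (visit t.+1 y) * h y + Gam K.+1 h = Gam 1 h.
Proof.
elim: K => [|K IH]; first by rewrite big_ord0 add0r.
rewrite big_ord_recr/= -IH -addrA; congr (_ + _).
rewrite (@Gam_step K.+1)// [RHS]GamID; congr (_ + _).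
by apply: eq_bigr => y Ly; rewrite h_harm.
Qed.

Lemma pr_hit_partial K :
  \sum_(t < K) \sum_(y | L y) pr (visit t.+1 y) * h y <= pr (hit L X A).
Proof.
pose F (p : 'I_K * V) : set T := if L p.2 && A p.2 then visit p.1.+1 p.2 else set0.
have mF p : measurable (F p).
  by rewrite /F; case: ifP => _; [exact: measurable_visit|exact: measurable0].
rewrite [leLHS](_ : _ = pr (\bigcup_p F p)); last first.
  rewrite pr_union//.
    rewrite -(pair_bigA _ (fun (t : 'I_K) y => pr (F (t, y))))/=; apply: eq_bigr => t _.
    rewrite big_mkcond; apply: eq_bigr => y _; rewrite /F /=; case: ifP => [Ly|]; last by rewrite pr0.
    by rewrite h_bnd//=; case: (A y); rewrite ?mulr1 ?mulr0 ?pr0.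
  move=> [t u] [t' u'] ne; apply/seteqP; split=> // x [] /=; rewrite /F /=.
  case: ifP => // /andP[Lu _]; case: ifP => // /andP[Lu' _] h1 h2.
  have [tt uu] := visit_inj Lu Lu' h1 h2.
  by move: ne; rewrite (val_inj tt) uu eqxx.
apply: pr_le.
- by apply: fin_bigcup_measurable => // ; exact: finite_finset.
- exact: measurable_hit.
move=> x [[t u] _]; rewrite /F /=; case: ifP => // LA vx.
by exists t => //; exists u.
Qed.

(* h(X_t) is a martingale until the absorption in L, so the bound can fail only by
   the mass S t not yet absorbed at time t. The supersolution w bounds the sum of
   all S t, so S t is arbitrarily small for some t. *)
Lemma pr_hit_ge : mean h v <= pr (hit L X A).
Proof.
have Gam1 g : Gam 1 g = mean g v.
  by rewrite /Gam /mean; apply: eq_bigr => z _; rewrite pr_visit1.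
rewrite -Gam1; apply/ler_addgt0Pr => eps eps0.
pose C := 1 + \sum_y `|h y|.
have C0 : 0 < C by rewrite ltr_pwDl// sumr_ge0.
have [K SK] : exists K, S K.+1 <= eps / C.
  apply: contrapT => /forallNP nS.
  have big K : K%:R * (eps / C) <= Gam 1 w.
    apply: le_trans (sumS K); rewrite ler_wpDr//.
      by apply: sumr_ge0 => y _; rewrite mulr_ge0// pr_ge0.
    rewrite -{1}[K]card_ord mulr_natl -sumr_const; apply: ler_sum => t _.
    by apply: ltW; rewrite ltNge; apply/negP/nS.
  have := big (Num.truncn (Gam 1 w / (eps / C))).+1; apply/negP; rewrite -ltNge.
  by rewrite -ltr_pdivrMr ?divr_gt0// real_truncnS_gt// num_real.
apply: (@le_trans _ _ (\sum_(t < K.+1) \sum_(y | L y) pr (visit t.+1 y) * h y + eps)); last first.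
  by rewrite lerD2r pr_hit_partial.
rewrite -(sumA K.+1) lerD2l (@Gam_step K.+1)//.
apply: (@le_trans _ _ (\sum_(y | ~~ L y) pr (visit K.+1 y) * C)).
  apply: ler_sum => y Ly; rewrite h_harm// ler_wpM2l ?pr_ge0//.
  apply: (le_trans (ler_norm _)); rewrite /C (bigD1 y)//= addrCA lerDl.
  by rewrite addr_ge0// sumr_ge0.
rewrite -mulr_suml -/(S K.+1); by rewrite -ler_pdivlMr.
Qed.

End Hitting.

(** * The simple random walk on the tree *)

Section TreeWalk.
Context {R : realType} (b n : nat).
Local Notation B := (b%:R : R).
Hypothesis b2 : (2 <= b)%N.
Hypothesis n0 : (0 < n)%N.
Let B2 : 2 <= B. Proof. by rewrite ler_nat. Qed.
Let B0 : B != 0. Proof. by have := B2; lra. Qed.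

Implicit Types (y z : vertex b n) (g : seq 'I_b -> R).

(** At most one label and one direction can witness adjacency, so the existential is a sum and means
    over neighbours become linear computations. *)
Lemma tree_adj_sum (y z : vertex b n) : (tree_adj y z)%:R =
  \sum_(c < b) ((val z == rcons y c)%:R + (val y == rcons z c)%:R) :> R.
Proof.
rewrite /tree_adj; case: existsP => [[c]|none]; last first.
  rewrite big1// => c _; have : ~ ((val z == rcons y c) || (val y == rcons z c)).
    by move=> h; apply: none; exists c.
  by move/negP; rewrite negb_or => /andP[/negbTE -> /negbTE ->]; rewrite addr0.
have sz (s s' : seq 'I_b) c1 c2 : s = rcons s' c1 -> s' = rcons s c2 -> False.
  by move=> -> /(congr1 size); rewrite !size_rcons; lia.
have ne (s s' : seq 'I_b) c1 c2 : s = rcons s' c1 -> c2 != c1 -> (s == rcons s' c2) = false.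
  by move=> -> cc; apply/negbTE/eqP => /rcons_inj[] /esym/eqP; rewrite (negbTE cc).
have nr (s s' : seq 'I_b) c1 c2 : s = rcons s' c1 -> (s' == rcons s c2) = false.
  by move=> e; apply/negbTE/eqP => /(sz _ _ _ _ e).
move=> /orP[] e0; have e := eqP e0; rewrite (bigD1 c)//= big1 ?addr0 => [|c' cc].
- by rewrite e0 (nr _ _ _ _ e) addr0.
- by rewrite (ne _ _ _ _ e cc) (nr _ _ _ _ e) addr0.
- by rewrite e0 (nr _ _ _ _ e) add0r.
- by rewrite (ne _ _ _ _ e cc) (nr _ _ _ _ e) addr0.
Qed.

Lemma sum_eq_val (s : seq 'I_b) g : (size s <= n)%N ->
  \sum_(z : vertex b n) (val z == s)%:R * g z = g s.
Proof.
move=> sn; rewrite (bigD1 (Bseq sn))//= eqxx mul1r big1 ?addr0// => z zs.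
by case: eqP => [e|]; rewrite ?mul0r//; move: zs; rewrite -val_eqE /= e eqxx.
Qed.

(** [belast i t] is [i :: t] without its last letter, the parent. The value 0 at the root makes one
    formula cover all inner vertices. *)
Definition parent_val (s : seq 'I_b) g : R :=
  if s is i :: t then g (belast i t) else 0.

Lemma parent_val_rcons s c g : parent_val (rcons s c) g = g s.
Proof.
by case: s => [|i s] //=; rewrite belast_rcons.
Qed.

Lemma sum_parent y g :
  \sum_(z : vertex b n) (\sum_(c < b) (val y == rcons z c)%:R) * g (val z) = parent_val y g.
Proof.
case: y => s sn /=; case/lastP: s sn => [|s c] sn.
  by rewrite big1// => z _; rewrite big1 ?mul0r// => c _; case: (val z).
rewrite parent_val_rcons -(@sum_eq_val s); last by move: sn; rewrite size_rcons => /ltnW.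
apply: eq_bigr => z _; congr (_ * _).
rewrite (bigD1 c)//= big1 ?addr0 => [|c' cc].
  by congr (nat_of_bool _)%:R; apply/eqP/eqP => [/rcons_inj[]->|->].
by rewrite (_ : (_ == _) = false)//; apply/negbTE/eqP => /rcons_inj[_] /esym/eqP; rewrite (negbTE cc).
Qed.

Lemma sum_neighbours y g : (size y < n)%N ->
  \sum_(z : vertex b n) (tree_adj y z)%:R * g z = \sum_c g (rcons y c) + parent_val y g.
Proof.
move=> yn; rewrite -sum_parent.
under eq_bigr do rewrite tree_adj_sum big_split/= mulrDl.
rewrite big_split/=; congr (_ + _).
under eq_bigr do rewrite mulr_suml.
rewrite exchange_big/=; apply: eq_bigr => c _.
by rewrite sum_eq_val// size_rcons.
Qed.

Lemma sum_neighbours_leaf y g : size y = n ->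
  \sum_(z : vertex b n) (tree_adj y z)%:R * g z = parent_val y g.
Proof.
move=> yn; rewrite -sum_parent.
under eq_bigr do rewrite tree_adj_sum big_split/= mulrDl.
rewrite big_split/= big1 ?add0r// => z _; rewrite big1 ?mul0r// => c _.
rewrite (_ : (_ == _) = false)//; apply/negbTE/eqP => e.
by have := size_bseq z; rewrite e size_rcons yn ltnn.
Qed.

Lemma step_mean y g :
  \sum_(z : vertex b n) srw_step (tree_adj (b:=b) (n:=n)) y z * g z =
  (\sum_(z : vertex b n) (tree_adj y z)%:R * g z) / (\sum_(z : vertex b n) (tree_adj y z)%:R * 1).
Proof.
rewrite mulr_suml; apply: eq_bigr => z _.
rewrite /srw_step; have -> : \sum_(z : vertex b n) (tree_adj y z)%:R * 1 = #|[pred z | tree_adj y z]|%:R :> R.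
  rewrite -sum1_card natr_sum [RHS]big_mkcond; apply: eq_bigr => u _.
  by rewrite mulr1 inE; case: ifP.
by case: (tree_adj y z); rewrite ?mul0r ?mul1r// mulrC.
Qed.

Lemma mean_root g (y : vertex b n) : val y = [::] ->
  \sum_(z : vertex b n) srw_step (tree_adj (b:=b) (n:=n)) y z * g z = (\sum_c g [:: c]) / B.
Proof.
move=> y0; have yn : (size y < n)%N by rewrite [X in size X]y0.
rewrite step_mean !(sum_neighbours _ yn) (sum_neighbours (fun=> 1) yn) y0 /= !addr0.
by rewrite sumr_const card_ord.
Qed.

Lemma mean_node g (y : vertex b n) s c : val y = rcons s c -> (size y < n)%N ->
  \sum_(z : vertex b n) srw_step (tree_adj (b:=b) (n:=n)) y z * g z =
  (\sum_e g (rcons y e) + g s) / (B + 1).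
Proof.
move=> ye yn; rewrite step_mean (sum_neighbours _ yn) (sum_neighbours (fun=> 1) yn).
by rewrite [in parent_val _ g]ye [in parent_val _ (fun=> 1)]ye !parent_val_rcons sumr_const card_ord.
Qed.

Lemma mean_leaf g (y : vertex b n) s c : val y = rcons s c -> size y = n ->
  \sum_(z : vertex b n) srw_step (tree_adj (b:=b) (n:=n)) y z * g z = g s.
Proof.
move=> ye yn; rewrite step_mean (sum_neighbours_leaf _ yn) (sum_neighbours_leaf (fun=> 1) yn).
by rewrite ye !parent_val_rcons divr1.
Qed.

Lemma vertex_cases y : val y = [::] \/ exists s c, val y = rcons s c.
Proof. by case: (lastP (val y)) => [|s c]; [left|right; exists s, c]. Qed.

Lemma harm_mean (f : seq 'I_b -> R) (y : vertex b n) : (size y < n)%N ->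
  \sum_(z : vertex b n) srw_step (tree_adj (b:=b) (n:=n)) y z * harm n f z = harm n f y.
Proof.
move=> yn; have [y0|[s [c yc]]] := vertex_cases y.
  by rewrite (mean_root _ y0) harm_root// y0 mulrC mulKf.
rewrite (mean_node _ yc yn) yc harm_node//.
  by rewrite mulrC mulKf//; have := B2; lra.
by move: yn; rewrite [X in size X]yc size_rcons -{1}(prednK n0) ltnS.
Qed.

(** From an inner vertex other than the apex the height falls by (b - 1) / (b + 1) per step on
    average, so this multiple of it falls by exactly 1; at the apex it falls by (b + 1) / (b -
    1). *)
Definition exit_time_bound (s : seq 'I_b) : R := (B + 1) / (B - 1) * (n - size s)%:R.

Lemma exit_time_bound_super y : (size y < n)%N ->
  \sum_(z : vertex b n) srw_step (tree_adj (b:=b) (n:=n)) y z * exit_time_bound z <=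
  exit_time_bound y - 1.
Proof.
have hB := B2; have B1 : 0 < B - 1 by lra.
have K1 : 1 <= (B + 1) / (B - 1) by rewrite ler_pdivlMr//; lra.
move=> yn; have [y0|[s [c yc]]] := vertex_cases y.
  rewrite (mean_root _ y0) /exit_time_bound y0 /= sumr_const card_ord -[_ *+ b]mulr_natl.
  rewrite [B * _]mulrC mulfK// subn0 subn1 -[in leRHS](prednK n0) -natr1.
  by rewrite mulrDr; lra.
rewrite (mean_node _ yc yn) /exit_time_bound yc; move: yn; rewrite [X in size X]yc size_rcons => sn.
have -> : (n - size s = (n - (size s).+1).+1)%N by lia.
rewrite (eq_bigr (fun=> (B + 1) / (B - 1) * ((n - (size s).+1)%:R - 1))); last first.
  move=> e _; rewrite !size_rcons; congr (_ * _).
  by rewrite -[X in _ = X%:R - 1](@prednK (n - (size s).+1)) ?subn_gt0// -subnS -natr1; ring.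
rewrite sumr_const card_ord -[_ *+ b]mulr_natl -natr1 le_eqVlt; apply/orP; left; apply/eqP.
by field; rewrite lt0r_neq0//=; lra.
Qed.

End TreeWalk.

(** * The law of the stopping leaf *)

Section StopLaw.
Context {R : realType} {d : measure_display} {T : measurableType d}.
Context (P : probability T R) (b n : nat) (v : leaf b n) (X : nat -> T -> vertex b n).
Hypothesis b2 : (2 <= b)%N.
Hypothesis n0 : (0 < n)%N.
Implicit Types f : seq 'I_b -> bool.
Local Notation B := (b%:R : R).
Local Notation L := (@is_leaf b n).
Local Notation hit := (hit L X).

Definition stop (w : T) : leaf b n := stop_leaf v (fun t => X t w).

Lemma leaf_vertex_inj : injective (@leaf_vertex b n).
Proof. by move=> x y /(congr1 val)/= h; apply: val_inj. Qed.

Lemma is_leafP (u : vertex b n) : reflect (exists x : leaf b n, leaf_vertex x = u) (L u).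
Proof.
apply: (iffP idP) => [|[x <-]]; last by rewrite /is_leaf/= size_tuple.
by move=> Lu; exists (Tuple Lu); apply: val_inj.
Qed.

Lemma first_returnE (w : T) (u : leaf b n) :
  first_return (fun t => X t w) u <-> exists t, visit L X t.+1 (leaf_vertex u) w.
Proof.
split=> [[[|t] [//_ Xu h]]|[t [Xu h]]]; first by exists t.
by exists t.+1.
Qed.

Lemma stop_eq (w : T) (u : leaf b n) :
  first_return (fun t => X t w) u -> stop w = u.
Proof.
move=> fu; rewrite /stop /stop_leaf; case: xgetP => [u' _ /= fu'|/(_ u)//].
have [t ht] := (first_returnE _ _).1 fu; have [t' ht'] := (first_returnE _ _).1 fu'.
have Lu (x : leaf b n) : L (leaf_vertex x) by apply/is_leafP; exists x.
exact: leaf_vertex_inj (congr1 snd (visit_inj (Lu _) (Lu _) ht' ht)).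
Qed.

Lemma hit_first_return f (w : T) : hit (fun u => f u) w ->
  exists2 u : leaf b n, first_return (fun t => X t w) u & f u.
Proof.
move=> [t _ [u /= /andP[/is_leafP[x xu] fu] vw]]; exists x.
  by apply/first_returnE; exists t; rewrite xu.
by move: fu; rewrite -xu.
Qed.

(** The default leaf [v] matters exactly where neither [f] nor its complement is hit. In this form
    measurability follows without knowing that the walk returns almost surely. *)
Lemma stop_setE f : [set w | f (stop w)] =
  hit (fun u => f u) `|`
  (if f v then ~` (hit (fun u => f u) `|` hit (fun u => ~~ f u)) else set0).
Proof.
apply/seteqP; split=> w /=.
  move=> fs; have [[u fu]|none] := pselect (exists u, first_return (fun t => X t w) u).
    left; have [t vt] := (first_returnE _ _).1 fu.
    exists t => //; exists (leaf_vertex u) => //=; apply/andP; split.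
      by apply/is_leafP; exists u.
    by rewrite -(stop_eq fu).
  right; move: fs; rewrite /stop /stop_leaf xgetPN; last first.
    by move=> u /= fu; apply: none; exists u.
  move=> -> /= [/hit_first_return|/(@hit_first_return (fun u => ~~ f u))] [u fu _]; by apply: none; exists u.
move=> [/hit_first_return[u fu uf]|]; first by rewrite (stop_eq fu).
case: ifP => // fv no; rewrite /stop /stop_leaf xgetPN// => u /= fu; apply: no.
have [t vt] := (first_returnE _ _).1 fu.
have Lu : L (leaf_vertex u) by apply/is_leafP; exists u.
by case: (boolP (f u)) => h; [left|right]; exists t => //; exists (leaf_vertex u) => //=; rewrite Lu.
Qed.

Lemma measurable_stop f :
  (forall t x, measurable (X t @^-1` [set x])) -> measurable [set w | f (stop w)].
Proof.
move=> mX; rewrite stop_setE; apply: measurableU; first exact: measurable_hit.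
case: ifP => _ //; apply: measurableC; apply: measurableU; exact: measurable_hit.
Qed.

Hypothesis walkX : simple_random_walk P (@tree_adj b n) (leaf_vertex v) X.

Let hit_sub f : hit (fun u => f u) `<=` [set w | f (stop w)].
Proof. by move=> w /hit_first_return[u fu uf] /=; rewrite (stop_eq fu). Qed.

Lemma pr_stop_ge f :
  ind (R := R) f v + (B - 1) * drift n (ind f) v <= prob P [set w | f (stop w)].
Proof.
have mX := walkX.1.
have := @pr_hit_ge _ _ _ P _ _ L _ X walkX (fun y => harm n (ind (R := R) f) y)
  (fun y => exit_time_bound (R := R) n y) (fun u => f u).
have nl (y : vertex b n) : ~~ L y -> (size y < n)%N.
  by rewrite /is_leaf ltn_neqAle => -> /=; apply: size_bseq.
have [s [c vc]] : exists s c, val (leaf_vertex v) = rcons s c.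
  case: (vertex_cases (leaf_vertex v)) => // v0.
  have h : size (val (leaf_vertex v)) = n := size_tuple v.
  by rewrite v0 /= in h; have := lt0n_neq0 n0; rewrite -{1}h.
have sv : (size s).+1 = n by rewrite -(size_rcons s c) -vc /= size_tuple.
(* The only neighbour of a leaf is its parent, where the extension, written with the data of the
   child [v], is f v + (b^1 - 1) times the drift at [v]. *)
rewrite (mean_leaf b2 n0 (harm n (ind f)) vc); last by rewrite /= size_tuple.
move=> H; apply: le_trans (le_trans (H _ _ _ _) _).
- rewrite (@harm_parent _ _ b2 _ _ _ c); last by rewrite -sv.
  rewrite -vc block_avg_leaf/= ?size_tuple//.
  by rewrite -[X in (X - size s)%N]sv subSnn expr1.
- by move=> y /nl yn; exact: harm_mean.
- by move=> y /eqP Ly; rewrite harm_leaf.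
- move=> y; rewrite mulr_ge0 ?divr_ge0 ?subr_ge0//; last by rewrite ler1n; lia.
- by move=> y /nl yn; exact: exit_time_bound_super.
- apply: pr_le; [exact: measurable_hit|exact: measurable_stop|exact: hit_sub].
Qed.

(* The lower bound holds for f and for its complement, and the bounds add up to 1. *)
Lemma pr_stop f :
  prob P [set w | f (stop w)] = ind f v + (B - 1) * drift n (ind f) v.
Proof.
have mX := walkX.1.
apply/eqP; rewrite eq_le pr_stop_ge andbT.
have := pr_stop_ge (fun u => ~~ f u).
rewrite (_ : [set w | ~~ f (stop w)] = ~` [set w | f (stop w)]); last first.
  by apply/seteqP; split=> w /= /negP.
rewrite prC; last exact: measurable_stop.
have -> : ind (R := R) (fun u => ~~ f u) = fun u => 1 + (-1) * ind f u.
  by apply/funext => u; rewrite /ind; case: (f u) => /=; lra.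
rewrite driftD driftZ drift_const//; lra.
Qed.

End StopLaw.

(** * Thinning of the Poisson particles *)

Section Particles.
Context {R : realType} {d : measure_display} {T : measurableType d}.
Context (P : probability T R) (b n : nat).
Context (N : leaf b n -> {RV P >-> nat}).
Context (X : leaf b n -> nat -> nat -> T -> vertex b n).
Variable lam : R.
Hypothesis b2 : (2 <= b)%N.
Hypothesis n0 : (0 < n)%N.
Hypothesis lam0 : 0 < lam.
Hypothesis particles : poisson_particles N X lam.
Local Notation B := (b%:R : R).
Local Notation pr := (prob P).

Let walkX v i : simple_random_walk P (@tree_adj b n) (leaf_vertex v) (X v i).
Proof. by case: particles. Qed.

Let mX v i t x : measurable (X v i t @^-1` [set x]).
Proof. exact: (walkX v i).1. Qed.

Let mN v (A : set nat) : measurable (N v @^-1` A).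
Proof. by rewrite -[_ @^-1` _]setTI; exact: measurable_funP. Qed.

Definition stop_in (G : leaf b n -> seq 'I_b -> bool) v i : set T :=
  [set w | G v (stop v (X v i) w)].

Let m_stop_in G v i : measurable (stop_in G v i).
Proof. exact: (@measurable_stop _ _ _ _ v _ (G v) (mX v i)). Qed.

Definition all_in (G : leaf b n -> seq 'I_b -> bool) : set T :=
  [set w | forall v i, (i < N v w)%N -> stop_in G v i w].

Definition stay_prob (G : leaf b n -> seq 'I_b -> bool) v : R :=
  ind (G v) v + (B - 1) * drift n (ind (G v)) v.

Let pmf (k : nat) : R := (lam / 2) ^+ k * k`!%:R^-1 * expR (- (lam / 2)).

Lemma pr_count v k : pr (N v @^-1` [set k]) = pmf k.
Proof.
case: particles => /(_ v [set k]) + _ _.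
rewrite /distribution/= /pushforward /prob => ->.
rewrite /poisson_prob divr_gt0// esum_set1; last by rewrite lee_fin poisson_pmf_ge0.
by rewrite /= /poisson_pmf divr_gt0.
Qed.

Lemma pr_stop_in G v i : pr (stop_in G v i) = stay_prob G v.
Proof. exact: (pr_stop b2 n0 (walkX v i) (G v)). Qed.

(* Bounding the numbers of particles by K makes every sum finite; then K tends to
   infinity. *)
Definition counts_in K (G : leaf b n -> seq 'I_b -> bool)
    (k : {ffun leaf b n -> 'I_K}) : set T :=
  [set w | forall v, N v w = k v /\ forall i, (i < k v)%N -> stop_in G v i w].

(** [measurable_stop] holds on any measurable space; it is applied to T equipped with the
    sigma-algebra generated by this one trajectory. *)
Lemma source_sigma_stop G v i : source_sigma N X (inr (v, i)) (stop_in G v i).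
Proof.
pose S0 := [set A | exists t x, A = X v i t @^-1` [set x]].
apply: (@measurable_stop _ (g_sigma_algebraType S0) _ _ v (X v i) (G v)) => t x.
by apply: sub_sigma_algebra; exists t, x.
Qed.

Lemma source_sigma_count v k : source_sigma N X (inl v) (N v @^-1` [set k]).
Proof. by exists [set k] => //; rewrite setTI. Qed.

Lemma pr_counts_in K G (k : {ffun leaf b n -> 'I_K}) :
  pr (counts_in G k) = \prod_v (pmf (k v) * stay_prob G v ^+ (k v)).
Proof.
(* The sources that the event depends on: all counts, and the walks that are particles for the
   prescribed counts k. *)
pose J : seq (leaf b n + leaf b n * nat) :=
  [seq inl v | v <- enum (leaf b n)] ++
  [seq inr (v, i) | v <- enum (leaf b n), i <- iota 0 (k v)].
pose A (j : leaf b n + leaf b n * nat) : set T :=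
  match j with
  | inl v => N v @^-1` [set (k v : nat)]
  | inr (v, i) => stop_in G v i
  end.
have uJ : uniq J.
  rewrite cat_uniq map_inj_uniq ?enum_uniq/=; last by move=> x y [].
  apply/andP; split.
    by apply/hasPn => j /allpairsPdep[v [i [_ _ ->]]]; apply/negP => /mapP[].
  apply: allpairs_uniq_dep => //; first exact: enum_uniq.
    by move=> v _; exact: iota_uniq.
  by move=> [v i] [v' i'] _ _ /= [-> ->].
have -> : counts_in G k = \bigcap_(j in [set` J]) A j.
  apply/seteqP; split=> w /=.
    move=> h j /=; rewrite mem_cat => /orP[/mapP[v _ ->]|/allpairsPdep[v [i [_ + ->]]]].
      by have [] := h v.
    by rewrite mem_iota add0n => /= ik; apply: (h v).2.
  move=> h v; split.
    apply: (h (inl v)); rewrite /= mem_cat; apply/orP; left.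
    by apply/mapP; exists v; rewrite ?mem_enum.
  move=> i ik; apply: (h (inr (v, i))); rewrite /= mem_cat; apply/orP; right.
  by apply/allpairsPdep; exists v, i; rewrite mem_enum mem_iota add0n.
case: particles => _ _ /(_ J A uJ) indep.
rewrite /prob indep; last first.
  move=> j; rewrite mem_cat => /orP[/mapP[v _ ->]|/allpairsPdep[v [i [_ _ ->]]]].
    exact: source_sigma_count.
  exact: source_sigma_stop.
have mA j : measurable (A j) by case: j => [v|[v i]] /=.
rewrite (eq_bigr (fun j => (pr (A j))%:E)) => [|j _]; last exact: prE.
rewrite prodEFin /= big_cat/= big_map big_allpairs_dep/= !big_enum/= big_split/=.
congr (_ * _); first by apply: eq_bigr => v _; rewrite pr_count.
apply: eq_bigr => v _; under eq_bigr do rewrite pr_stop_in.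
by rewrite big_const_seq count_predT size_iota -Monoid.iteropE.
Qed.

Lemma measurable_counts_in K G (k : {ffun leaf b n -> 'I_K}) : measurable (counts_in G k).
Proof.
rewrite (_ : counts_in G k = \bigcap_(v in [set: leaf b n])
   (N v @^-1` [set (k v : nat)] `&` \bigcap_(i in [set i | (i < k v)%N]) stop_in G v i)).
  apply: fin_bigcap_measurable => [|v _]; first exact: finite_finset.
  by apply: measurableI => //; apply: fin_bigcap_measurable => //; exact: finite_II.
apply/seteqP; split=> w /=.
  by move=> h v _; have [h1 h2] := h v; split.
by move=> h v; have [h1 h2] := h v I; split.
Qed.

Let bounded K G : set T := \bigcup_(k : {ffun leaf b n -> 'I_K}) counts_in G k.

Let pr_bounded K G :
  pr (bounded K G) = \prod_v \sum_(j < K) pmf j * stay_prob G v ^+ j.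
Proof.
rewrite pr_union; last 2 first.
- by move=> k; exact: measurable_counts_in.
- move=> k k' kk; apply/seteqP; split=> // w [h h']; move: kk => /eqP; apply.
  by apply/ffunP => v; apply: val_inj => /=; rewrite -(h v).1 -(h' v).1.
rewrite bigA_distr_bigA; apply: eq_bigr => k _; exact: pr_counts_in.
Qed.

Let m_bounded K G : measurable (bounded K G).
Proof.
apply: fin_bigcup_measurable => [|k _]; first exact: finite_finset.
exact: measurable_counts_in.
Qed.

Let all_inE G : all_in G = \bigcup_K bounded K G.
Proof.
apply/seteqP; split=> w.
  move=> h; exists (\max_v N v w).+1 => //.
  have Nb v : (N v w < (\max_v N v w).+1)%N by rewrite ltnS; apply: leq_bigmax.
  exists [ffun v => Ordinal (Nb v)] => // v; rewrite ffunE /=; split=> // i iN.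
  exact: h.
by move=> [K _ [k _ h]] v i; have [-> h2] := h v; exact: h2.
Qed.

Lemma measurable_all_in G : measurable (all_in G).
Proof. by rewrite all_inE; apply: bigcup_measurable => K _; exact: m_bounded. Qed.

(** The generating function of Po(lam / 2) at q, the probability that one particle from v is
    allowed: exp (- lam / 2) times the exponential series of lam q / 2. *)
Lemma pr_all_in G :
  pr (all_in G) = \prod_v expR (- (lam / 2 * (1 - stay_prob G v))).
Proof.
have ndb : nondecreasing_seq (bounded ^~ G).
  apply/nondecreasing_seqP => K; apply/subsetPset => w [k _ h].
  exists [ffun v => widen_ord (leqnSn K) (k v)] => // v; rewrite ffunE /=.
  exact: h.
have c1 := nondecreasing_cvg_mu (fun K => m_bounded K G) (bigcup_measurable (fun K _ => m_bounded K G)) ndb.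
rewrite -all_inE in c1.
have c2 : (fun K => pr (bounded K G)) @ \oo --> \prod_v expR (- (lam / 2 * (1 - stay_prob G v))).
  under eq_fun do rewrite pr_bounded.
  apply: cvg_big => [|v _]; first exact: mul_continuous.
  set q := stay_prob G v.
  have -> : (fun K => \sum_(j < K) pmf j * q ^+ j) =
      (fun K => expR (- (lam / 2)) * series (exp_coeff (lam / 2 * q)) K).
    apply/funext => K; rewrite /series /= big_mkord mulr_sumr.
    by apply: eq_bigr => j _; rewrite /pmf /exp_coeff /= [(lam / 2 * q) ^+ j]exprMn; ring.
  have -> : - (lam / 2 * (1 - q)) = - (lam / 2) + lam / 2 * q by ring.
  rewrite expRD; apply: cvgM; [exact: cvg_cst|exact: is_cvg_series_exp_coeff].
have mA : measurable (all_in G) := measurable_all_in G.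
have e := prE P mA.
have {}c1 : (fun K => P (bounded K G)) @ \oo --> (pr (all_in G))%:E by rewrite -e; exact: c1.
exact: (cvg_unique (@norm_hausdorff _ _) (fine_cvg c1) c2).
Qed.

End Particles.

(** * Isolated sets of leaves and disconnectedness *)

Section ConfigurationSets.
Context (b : nat).

Fixpoint cfg_mem (n : nat) : cfg b n -> seq 'I_b -> bool :=
  match n return cfg b n -> seq 'I_b -> bool with
  | 0 => fun c _ => c
  | m.+1 => fun (c : {ffun 'I_b -> cfg b m}) s =>
      if s is i :: t then cfg_mem (c i) t else false
  end.

Lemma cfg_memK n (c : cfg b n) : cfg_of n (cfg_mem c) = c.
Proof. by elim: n c => [//|n IH] c /=; apply/ffunP => i; rewrite ffunE -[RHS]IH. Qed.

Lemma cfg_ofK n (f : seq 'I_b -> bool) s : size s = n -> cfg_mem (cfg_of n f) s = f s.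
Proof.
elim: n f s => [|n IH] f s /=; first by move/size0nil => ->.
by case: s => //= i s [sn]; rewrite ffunE (IH (fun w => f (i :: w))).
Qed.

Lemma cfg_of_const_mixed (R : realType) n (c : cfg b n) (s t : seq 'I_b) : (2 <= b)%N ->
  size s = n -> size t = n -> cfg_mem c s != cfg_mem c t -> mixed (R := R) c.
Proof.
move=> b2 sn tn; apply: contraR => /(not_mixed b2) h.
have [a ->] : exists a : bool, c = cfg_of n (fun=> a).
  case: h => h; [exists false; apply: (@dens0_inj R b b2 n _ _ h)|exists true; apply: (@dens1_inj R b b2 n _ _ h)];
    by rewrite dens_cfg_of /ind avg_const.
by rewrite !cfg_ofK.
Qed.

End ConfigurationSets.

Lemma prefix_eq_size (T : eqType) (x y v : seq T) :
  size x = size y -> prefix x v -> prefix y v -> x = y.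
Proof. by move=> xy /prefixP[s ->] /prefixP[t] /eqP; rewrite eqseq_cat// => /andP[/eqP]. Qed.

Section Isolation.
Context {R : realType} {d : measure_display} {T : measurableType d}.
Context (P : probability T R) (b n : nat).
Context (N : leaf b n -> {RV P >-> nat}).
Context (X : leaf b n -> nat -> nat -> T -> vertex b n).
Variable lam : R.
Hypothesis b2 : (2 <= b)%N.
Hypothesis n0 : (0 < n)%N.
Hypothesis lam0 : 0 < lam.
Hypothesis particles : poisson_particles N X lam.
Local Notation B := (b%:R : R).
Local Notation pr := (prob P).
Implicit Types f : seq 'I_b -> bool.

Definition isolated_set f : set T := all_in N X (fun v u => f u == f v).

Lemma measurable_isolated_set f : measurable (isolated_set f).
Proof. exact: measurable_all_in particles _. Qed.

Definition leave_prob f (v : leaf b n) : R :=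
  (1 - 2 * ind f v) * ((B - 1) * drift n (ind f) v).

Lemma stay_prob_eq f v :
  stay_prob (R := R) (fun (v : leaf b n) u => f u == f v) v = 1 - leave_prob f v.
Proof.
rewrite /stay_prob /leave_prob {1}/ind eqxx; case: (boolP (f v)) => fv.
  have -> : ind (R := R) (fun u => f u == true) = ind f.
    by apply/funext => u; rewrite /ind eqb_id.
  by rewrite {2}/ind fv /=; ring.
have -> : ind (R := R) (fun u => f u == false) = fun u => 1 + (-1) * ind f u.
  by apply/funext => u; rewrite /ind; case: (f u) => /=; ring.
rewrite driftD driftZ drift_const// {2}/ind (negbTE fv) /=; ring.
Qed.

Lemma sum_leave_prob f :
  \sum_(v : leaf b n) leave_prob f v = 2 * ((B - 1) * (B ^+ n * energy n (ind f))).
Proof.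
rewrite [RHS](_ : _ = (B - 1) * (2 * B ^+ n * energy n (ind f))); last by ring.
rewrite -sum_drift_sign// mulr_sumr; apply: eq_bigr => v _; rewrite /leave_prob; ring.
Qed.

(** Particles cross the cut from both sides at equal total rates, and this factor 2 cancels the 1/2
    of the mean lam / 2. *)
Lemma pr_isolated_set f :
  pr (isolated_set f) = expR (- (lam * ((B - 1) * (B ^+ n * energy n (ind f))))).
Proof.
rewrite (pr_all_in b2 n0 lam0 particles) -expR_sum; congr expR.
rewrite sumrN -mulr_sumr; congr (- _).
rewrite (eq_bigr (leave_prob f)); last by move=> v _; rewrite stay_prob_eq; ring.
by rewrite sum_leave_prob; field.
Qed.

Lemma isolatedP f w : isolated_set f w <->
  forall v u, (v, u) \in particle_graph N X w -> f u = f v.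
Proof.
split=> [h v u /allpairsPdep[v' [i [_ + []]]] -> ->|h v i iN].
  by rewrite mem_iota add0n => /= iN; apply/eqP; exact: h.
apply/eqP/h; apply/allpairsPdep; exists v, i.
by rewrite mem_enum mem_iota add0n.
Qed.

Lemma isolated_disconnected f (u v : leaf b n) w : f u != f v ->
  isolated_set f w -> ~~ mg_connected (particle_graph N X w).
Proof.
move=> fuv /isolatedP h; apply/negP => /forallP/(_ u)/forallP/(_ v) /connectP[p].
elim: p u fuv => [|x p IH] u fuv /=; first by move=> _ e; rewrite e eqxx in fuv.
move=> /andP[ux px] lp; apply: (IH x) => //.
by move: ux => /orP[] /h e; rewrite ?e// -?e.
Qed.

Lemma disconnected_isolated w : ~~ mg_connected (particle_graph N X w) ->
  exists2 f : seq 'I_b -> bool, (exists u v : leaf b n, f u != f v) & isolated_set f w.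
Proof.
move=> /forallPn[u /forallPn[v nuv]].
set E := particle_graph N X w in nuv *.
(* The component of [u]; the value on words that are not leaves is arbitrary. *)
pose f (s : seq 'I_b) := if insub s is Some t then connect (mg_adj E) u t else false.
have fE (x : leaf b n) : f x = connect (mg_adj E) u x by rewrite /f valK.
exists f; first by exists u, v; rewrite !fE connect0 (negbTE nuv).
apply/isolatedP => x y xy; rewrite !fE.
by apply/idP/idP => h; apply: (connect_trans h); apply: connect1; rewrite /mg_adj xy ?orbT.
Qed.

Lemma disconnectedE : [set w | ~~ mg_connected (particle_graph N X w)] =
  \bigcup_(c in [set c : cfg b n | mixed (R := R) c]) isolated_set (cfg_mem c).
Proof.
apply/seteqP; split=> w /=.
  move=> /disconnected_isolated[f [u [v fuv]] iso].
  have fE (x : leaf b n) : cfg_mem (cfg_of n f) x = f x by rewrite cfg_ofK ?size_tuple.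
  exists (cfg_of n f) => /=.
    by apply: (@cfg_of_const_mixed _ _ _ _ u v); rewrite ?size_tuple// !fE.
  by move=> v' i iN; rewrite /stop_in /= !fE; exact: iso.
move=> [c /= mc iso].
have [u [v uv]] : exists u v : leaf b n, cfg_mem c u != cfg_mem c v.
  apply: contrapT => /forallNP h.
  pose x : leaf b n := nseq_tuple n (Ordinal (ltnW b2 : (0 < b)%N)).
  have cx s : size s = n -> cfg_mem c s = cfg_mem c x.
    move=> /eqP sn; have := h (Tuple sn) => /forallNP/(_ x) /negP.
    by rewrite negbK => /eqP.
  have dc : dens c = (cfg_mem c x)%:R :> R.
    rewrite -{1}[c]cfg_memK dens_cfg_of (@eq_avg _ _ _ _ (fun=> (cfg_mem c x)%:R)).
      by rewrite avg_const.
    by move=> s sn; rewrite /ind cx.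
  by move: mc; rewrite /mixed dc; case: (cfg_mem c x); rewrite ?ltxx ?andbF.
exact: isolated_disconnected uv iso.
Qed.

Lemma measurable_disconnected :
  measurable [set w | ~~ mg_connected (particle_graph N X w)].
Proof.
rewrite disconnectedE; apply: fin_bigcup_measurable => [|c _].
  exact: finite_finset.
exact: measurable_isolated_set.
Qed.

Lemma pr_disconnected_le :
  pr [set w | ~~ mg_connected (particle_graph N X w)] <=
  \sum_(c : cfg b n | mixed (R := R) c)
    expR (- (lam * (B - 1) / (B + 1) * ((B + 1) * varsum c))).
Proof.
have B2 : 2 <= B by rewrite ler_nat.
rewrite disconnectedE; apply: le_trans (pr_union_le _ _ _) _.
  by move=> c; exact: measurable_isolated_set.
apply: ler_sum => c _; rewrite pr_isolated_set ler_expR lerN2.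
rewrite [leLHS](_ : _ = lam * ((B - 1) * varsum c)); last by field; lra.
rewrite ler_wpM2l ?(ltW lam0)// ler_wpM2l ?subr_ge0//; first by lra.
by rewrite -{1}[c]cfg_memK varsum_le_energy.
Qed.

(** The two isolation events share only the particles running between the two blocks, which the
    product counts twice. Their rate from a leaf of one block is (b - 1) times the drift of the
    other block's indicator, bounded by [drift_prefix_le]. *)
Lemma pr_isolated_pair (x y : seq 'I_b) m : size x = size y -> (size x <= n)%N ->
  (m < size x)%N -> take m.+1 x != take m.+1 y ->
  pr (isolated_set (prefix x) `&` isolated_set (prefix y)) <=
  pr (isolated_set (prefix x)) * pr (isolated_set (prefix y)) *
  expR (lam * ((B - 1) * (B ^+ (n - size x) * (esc b (n - m) * B^-1 ^+ (size x - m))))).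
Proof.
have B2 : 2 <= B by rewrite ler_nat.
move=> xy xn mx txy.
pose G (v : leaf b n) (u : seq 'I_b) :=
  (prefix x u == prefix x v) && (prefix y u == prefix y v).
have -> : isolated_set (prefix x) `&` isolated_set (prefix y) = all_in N X G.
  apply/seteqP; split=> w.
    by move=> [h1 h2] v i iN; rewrite /stop_in /G /= h1// h2.
  by move=> h; split=> v i iN; have /andP[] := h v i iN.
set c := esc b (n - m) * _.
have far v : prefix x v -> drift n (ind (R := R) (prefix y)) v <= c.
  move=> /prefixP[s vE]; rewrite /c xy; apply: drift_prefix_le; rewrite -?xy//.
  by rewrite vE takel_cat// eq_sym.
have far' v : prefix y v -> drift n (ind (R := R) (prefix x)) v <= c.
  move=> /prefixP[s vE]; rewrite /c; apply: drift_prefix_le => //.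
  by rewrite vE takel_cat// -xy.
have ne v : prefix x v -> prefix y v -> False.
  by move=> h1 h2; move: txy; rewrite (prefix_eq_size xy h1 h2) eqxx.
have key (v : leaf b n) : leave_prob (prefix x) v + leave_prob (prefix y) v
    - (B - 1) * c * (ind (prefix x) v + ind (prefix y) v) <= 1 - stay_prob (R := R) G v.
  rewrite /stay_prob /leave_prob.
  case: (boolP (prefix x v)) => xv; case: (boolP (prefix y v)) => yv.
  - by case: (ne v xv yv).
  - have -> : ind (R := R) (G v) = ind (prefix x).
      apply/funext => u; rewrite /ind /G xv (negbTE yv) eqb_id.
      case: (boolP (prefix x u)) => xu //=; case: (boolP (prefix y u)) => // yu.
      by case: (ne u xu yu).
    have := far v xv; rewrite /ind xv (negbTE yv) /=; nra.
  - have -> : ind (R := R) (G v) = ind (prefix y).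
      apply/funext => u; rewrite /ind /G yv (negbTE xv) eqb_id.
      case: (boolP (prefix y u)) => yu; rewrite ?andbT ?andbF//.
      by case: (boolP (prefix x u)) => // xu; case: (ne u xu yu).
    have := far' v yv; rewrite /ind yv (negbTE xv) /=; nra.
  - have -> : ind (R := R) (G v) = fun u => 1 + (-1) * (ind (prefix x) u + ind (prefix y) u).
      apply/funext => u; rewrite /ind /G (negbTE xv) (negbTE yv).
      case: (boolP (prefix x u)) => xu; case: (boolP (prefix y u)) => yu /=; try by ring.
      by case: (ne u xu yu).
    rewrite driftD driftZ driftD drift_const// /ind (negbTE xv) (negbTE yv) /=.
    lra.
rewrite (pr_all_in b2 n0 lam0 particles) !pr_isolated_set -expR_sum -!expRD ler_expR.
rewrite sumrN -mulr_sumr.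
have := ler_sum (index_enum (leaf b n)) (P := predT) (fun v _ => key v).
rewrite sumrB -mulr_sumr !big_split/= !sum_leave_prob !sum_prefix//; last by rewrite -xy.
rewrite -xy; set S := \sum_(i : leaf b n) _; set e1 := (B - 1) * (B ^+ n * _).
set e2 := (B - 1) * (B ^+ n * energy n (ind (prefix y))).
move=> h; have l0 := lam0; nra.
Qed.

End Isolation.

(** * The second moment method *)

Section SecondMoment.
Context {R : realType} {d : measure_display} {T : measurableType d}.
Variable P : probability T R.
Context (I : finType) (F : I -> set T).
Hypothesis mF : forall i, measurable (F i).
Local Notation pr := (prob P).

(** The vector of occurrences takes finitely many values, so all moments are finite sums over its
    atoms. *)
Let Y (w : T) : {ffun I -> bool} := [ffun i => `[< F i w >]].

Let mY y : measurable (Y @^-1` [set y]).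
Proof.
rewrite (_ : _ @^-1` _ = \bigcap_(i in [set: I]) (if y i then F i else ~` F i)).
  apply: fin_bigcap_measurable => [|i _]; first exact: finite_finset.
  by case: ifP => // _; exact: measurableC.
apply/seteqP; split=> w /=.
  by move=> <- i _; rewrite ffunE; case: asboolP.
move=> h; apply/ffunP => i; rewrite ffunE; have := h i Logic.I.
by case: (y i) => Fi; apply/asboolP.
Qed.

Let atom y := pr (Y @^-1` [set y]).

Let pr_atoms (A : set T) (q : pred {ffun I -> bool}) : measurable A ->
  (forall w, A w <-> q (Y w)) -> pr A = \sum_(y : {ffun I -> bool}) (q y)%:R * atom y.
Proof.
move=> mA Aq; rewrite (pr_total P mA mY); apply: eq_bigr => y _.
case: (boolP (q y)) => qy.
  rewrite mul1r; congr prob; apply/seteqP; split=> w /=; first by case.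
  by move=> Yw; split=> //; apply/Aq; rewrite Yw.
rewrite mul0r (_ : _ `&` _ = set0) ?pr0//; apply/seteqP; split=> // w [/Aq + /= Yw].
by rewrite Yw (negbTE qy).
Qed.

(* Chebyshev: P(Y = 0) <= E (1 - Y / E Y)^2 for the number Y of events F i that
   occur. *)
Lemma second_moment : 0 < \sum_i pr (F i) ->
  1 - pr (\bigcup_i F i) <=
  (\sum_i \sum_j pr (F i `&` F j)) / (\sum_i pr (F i)) ^+ 2 - 1.
Proof.
set mu := \sum_i pr (F i) => mu0.
have mU : measurable (\bigcup_i F i).
  by apply: fin_bigcup_measurable => // ; exact: finite_finset.
have YE w i : Y w i <-> F i w by rewrite ffunE; split=> [/asboolP|h]; [|apply/asboolP].
have e1 i : pr (F i) = \sum_(y : {ffun I -> bool}) (y i)%:R * atom y.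
  by apply: (@pr_atoms _ (fun y : {ffun I -> bool} => y i)) => // w; rewrite YE.
have e2 i j : pr (F i `&` F j) = \sum_(y : {ffun I -> bool}) ((y i)%:R * (y j)%:R) * atom y.
  rewrite (@pr_atoms _ (fun y : {ffun I -> bool} => y i && y j)); last 2 first.
  - exact: measurableI.
  - by move=> w; split=> [[/YE -> /YE ->]//|/andP[/YE ? /YE ?]].
  by apply: eq_bigr => y _; rewrite -natrM mulnb.
have e0 : 1 = \sum_(y : {ffun I -> bool}) atom y.
  rewrite -[LHS](prT P) (@pr_atoms _ predT)//.
  by apply: eq_bigr => y _; rewrite mul1r.
have e3 : pr (\bigcup_i F i) = \sum_(y : {ffun I -> bool}) [exists i, (y i : bool)]%:R * atom y.
  apply: (@pr_atoms _ (fun y : {ffun I -> bool} => [exists i, y i])) => // w; split.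
    by move=> [i _ /YE Fi]; apply/existsP; exists i.
  by move=> /existsP[i /YE Fi]; exists i.
have s1 : mu = \sum_(y : {ffun I -> bool}) (\sum_i (y i)%:R) * atom y.
  rewrite /mu; under eq_bigr do rewrite e1; rewrite exchange_big/=.
  by apply: eq_bigr => y _; rewrite mulr_suml.
have s2 : \sum_i \sum_j pr (F i `&` F j) = \sum_(y : {ffun I -> bool}) (\sum_i (y i)%:R) ^+ 2 * atom y.
  under eq_bigr do (under eq_bigr do rewrite e2; rewrite exchange_big/=).
  rewrite exchange_big/=; apply: eq_bigr => y _; rewrite expr2 -mulrA mulr_suml.
  apply: eq_bigr => i _; rewrite mulr_suml mulr_sumr; apply: eq_bigr => j _.
  by rewrite mulrA.
rewrite s2 e3.
have key (y : {ffun I -> bool}) : 1 - [exists i, (y i : bool)]%:R <=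
    (1 - (\sum_i (y i)%:R) / mu) ^+ 2 :> R.
  case: (boolP [exists i, y i]) => [_|]; first by rewrite subrr sqr_ge0.
  rewrite negb_exists => /forallP h; rewrite big1 ?mul0r ?subr0 ?expr1n//.
  by move=> i _; rewrite (negbTE (h i)).
have : \sum_(y : {ffun I -> bool}) (1 - [exists i, (y i : bool)]%:R) * atom y <=
    \sum_(y : {ffun I -> bool}) (1 - (\sum_i (y i)%:R) / mu) ^+ 2 * atom y.
  by apply: ler_sum => y _; rewrite ler_wpM2r ?key// /atom pr_ge0.
have -> : \sum_(y : {ffun I -> bool}) (1 - [exists i, (y i : bool)]%:R) * atom y = 1 - \sum_(y : {ffun I -> bool}) [exists i, (y i : bool)]%:R * atom y.
  by rewrite [X in _ = X - _]e0 -sumrB; apply: eq_bigr => y _; rewrite mulrBl mul1r.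
have -> : \sum_(y : {ffun I -> bool}) (1 - (\sum_i (y i)%:R) / mu) ^+ 2 * atom y =
    1 - 2 / mu * mu + (\sum_(y : {ffun I -> bool}) (\sum_i (y i)%:R) ^+ 2 * atom y) / mu ^+ 2.
  rewrite [X in _ = X - _ + _]e0 [X in _ - 2 / mu * X + _]s1 mulr_sumr mulr_suml -sumrB -big_split/=.
  by apply: eq_bigr => y _; field; rewrite gt_eqF.
rewrite mulfVK ?gt_eqF//; lra.
Qed.

End SecondMoment.

(** Leaves room in the tree for the two scales k and 2 k. For b = 2 and n = 4 it fails, hence the
    threshold 5. *)
Lemma two_trunc_log b n : (2 <= b)%N -> (5 <= n)%N -> ((trunc_log b n).*2.+1 <= n)%N.
Proof.
move=> b2 n5; have /andP[h _] := trunc_log_bounds b2 (ltnW (ltnW (ltnW (ltnW n5)))).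
have [k3|k3] := leqP 3 (trunc_log b n); last by rewrite -muln2; lia.
have h2 : (2 ^ trunc_log b n <= b ^ trunc_log b n)%N by rewrite leq_exp2r//; lia.
apply: leq_trans (leq_trans h2 h).
elim: (trunc_log b n) k3 => // k IH; rewrite leq_eqVlt => /predU1P[<-//|k3].
by have := IH k3; rewrite expnS -!muln2; lia.
Qed.

(** * Isolated subtrees of logarithmic height *)

Section DisconnectedBound.
Context {R : realType} {d : measure_display} {T : measurableType d}.
Context (P : probability T R) (b n : nat).
Context (N : leaf b n -> {RV P >-> nat}).
Context (X : leaf b n -> nat -> nat -> T -> vertex b n).
Variable lam : R.
Hypothesis b2 : (2 <= b)%N.
Hypothesis n5 : (5 <= n)%N.
Hypothesis lam0 : 0 < lam.
Hypothesis particles : poisson_particles N X lam.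
Local Notation B := (b%:R : R).
Local Notation pr := (prob P).
Variable g : R.
Hypothesis g0 : 0 <= g.
Hypothesis lamE : lam * (B - 1) / (B + 1) = n%:R * ln B - g.

Variables k l : nat.
Hypothesis kl : (k + l = n)%N.
Hypothesis k_lt_l : (k < l)%N.
Hypothesis kn : (b ^ k <= n < b ^ k.+1)%N.
Let r : R := B^-1 ^+ k.+1.

Let n0 : (0 < n)%N. Proof. exact: leq_trans n5. Qed.
Let B2 : 2 <= B. Proof. by rewrite ler_nat. Qed.
Let B0 : B != 0. Proof. by have := B2; lra. Qed.
Let Bpos : 0 < B. Proof. by have := B2; lra. Qed.
Let nR : 5 <= n%:R :> R. Proof. by rewrite ler_nat. Qed.
Let Bk : B ^+ k <= n%:R.
Proof. by rewrite -natrX ler_nat; have /andP[] := kn. Qed.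
Let r0 : 0 < r. Proof. by rewrite exprn_gt0 ?invr_gt0. Qed.
Let rn : r * n%:R <= 1.
Proof.
rewrite /r exprVn mulrC ler_pdivrMr ?exprn_gt0// mul1r -natrX ler_nat.
by have /andP[_ /ltnW] := kn.
Qed.
Let r2 : r <= 1 / 2. Proof. by have := rn; have := nR; have := r0; nra. Qed.
Let r_inv : (1 - r)^-1 <= 1 + 2 * r.
Proof. by rewrite -div1r ler_pdivrMr; have := r2; have := r0; nra. Qed.
Let lnB0 : 0 <= ln B. Proof. by apply: ln_ge0; have := B2; lra. Qed.

Let A : R := lam * (B - 1) / (B + 1).
Let A0 : 0 < A.
Proof. by rewrite divr_gt0 ?mulr_gt0//; have := B2; lra. Qed.
Let An : A <= n%:R * ln B. Proof. by rewrite /A lamE lerBlDr lerDl. Qed.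
Let lam_A : lam = A * (B + 1) / (B - 1).
Proof. by rewrite /A; field; rewrite !lt0r_neq0//; have := B2; lra. Qed.
Let Ar : A * r <= ln B.
Proof.
apply: (@le_trans _ _ (n%:R * ln B * r)); first by rewrite ler_wpM2r// ltW.
by rewrite mulrAC ler_piMl// mulrC.
Qed.
Let expB m : expR (m%:R * ln B) = B ^+ m.
Proof. by rewrite expRM_natl lnK// posrE. Qed.

Let p : R := expR (- (lam * ((B - 1) * (B ^+ n * cyl_energy b k l)))).
Let F (x : l.-tuple 'I_b) : set T := isolated_set N X (prefix x).

Let pr_F x : pr (F x) = p.
Proof.
rewrite /F (pr_isolated_set b2 n0 lam0 particles) /p; congr (expR (- (_ * (_ * (_ * _))))).
by rewrite -[in LHS]kl -{1}(size_tuple x) energy_prefix// size_tuple.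
Qed.

(** The finite height raises the exponent from A to at most A (1 + 2 r) <= A + 2 ln b, since A r <=
    ln b; this is the b^2. The factor n bounds b^k, lost by counting b^l blocks rather than b^n. *)
Let p_ge : expR g / (n%:R * B ^+ 2) <= B ^+ l * p.
Proof.
have h : lam * ((B - 1) * (B ^+ n * cyl_energy b k l)) <= A + 2 * ln B.
  apply: (@le_trans _ _ (lam * ((B - 1) / (B + 1) * (1 - B^-1 ^+ (l.*2)) / (1 - r)))).
    by rewrite ler_wpM2l ?(ltW lam0)// -{1}kl cyl_energy_le.
  apply: (@le_trans _ _ (A * (1 + 2 * r))); last first.
    by have := Ar; lra.
  rewrite [leLHS](_ : _ = A * ((1 - B^-1 ^+ (l.*2)) * (1 - r)^-1)); last first.
    by rewrite /A; field; rewrite !lt0r_neq0//; have := B2; have := r2; lra.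
  rewrite ler_wpM2l ?(ltW A0)// -[leRHS]mul1r ler_pM//.
  - by rewrite subr_ge0 exprn_ile1 ?invr_ge0 ?invf_le1//; have := B2; lra.
  - by rewrite invr_ge0; have := r2; lra.
have hp : expR (- (A + 2 * ln B)) <= p by rewrite ler_expR lerN2.
have e : expR (- (A + 2 * ln B)) = expR g / (B ^+ n * B ^+ 2).
  rewrite {1}/A lamE (_ : - _ = g - (n + 2)%:R * ln B); last by rewrite natrD; ring.
  by rewrite expRB expB exprD.
apply: (@le_trans _ _ (B ^+ l * expR (- (A + 2 * ln B)))); last first.
  by rewrite ler_wpM2l// exprn_ge0.
rewrite e -{2}kl exprD.
rewrite [leRHS](_ : _ = expR g / (B ^+ k * B ^+ 2)); last first.
  by field; rewrite !expf_neq0 ?B0.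
rewrite ler_wpM2l ?expR_ge0// lef_pV2 ?posrE ?mulr_gt0 ?exprn_gt0//; last by have := nR; lra.
by rewrite ler_wpM2r ?exprn_ge0.
Qed.

(** The extreme case is that of sibling blocks, with exponent about A (b + 1) / b^2 <= 3 A / 4,
    attained for b = 2. As 3/4 < 1, near pairs, a fraction b^k / b^l of all pairs, stay
    negligible. *)
Let near_le : lam * ((B - 1) * (B ^+ k * (esc b k.+1 * B^-1))) <=
  3 / 4 * (n%:R * ln B) + 3 / 2 * ln B.
Proof.
have e1 : esc b k.+1 * B ^+ k.+1 <= 1 + 2 * r.
  by apply: le_trans r_inv; apply: esc_expb_le.
have -> : lam * ((B - 1) * (B ^+ k * (esc b k.+1 * B^-1))) =
   A * ((B + 1) / B ^+ 2) * (esc b k.+1 * B ^+ k.+1).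
  by rewrite lam_A [B ^+ k.+1]exprS; field; rewrite B0 /=; apply: lt0r_neq0; have := B2; lra.
have e2 : (B + 1) / B ^+ 2 <= 3 / 4.
  by rewrite ler_pdivrMr ?exprn_gt0//; have := B2; nra.
apply: (@le_trans _ _ (A * (3 / 4) * (1 + 2 * r))).
  apply: ler_pM => //.
  - by apply: mulr_ge0; [exact: ltW|rewrite divr_ge0 ?exprn_ge0 ?addr_ge0].
  - by rewrite mulr_ge0 ?esc_ge0// exprn_ge0.
  - by rewrite ler_wpM2l// ltW.
by have := Ar; have := An; lra.
Qed.

(** A common ancestor above height 2 k gives an exponent of order A r^2, where A r is bounded and r
    <= 1 / n. *)
Let far_le : lam * ((B - 1) * (B ^+ k * (esc b k.*2.+1 * B^-1 ^+ k.+1))) <=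
  2 * (B + 1) * ln B / n%:R.
Proof.
have e1 : esc b k.*2.+1 * B ^+ k.*2.+1 <= 2.
  apply: le_trans (_ : (1 - r)^-1 <= 2); last by rewrite invf_ple ?posrE; have := r2; lra.
  by apply: (esc_expb_le b2); rewrite ltnS -addnn leq_addr.
have -> : lam * ((B - 1) * (B ^+ k * (esc b k.*2.+1 * B^-1 ^+ k.+1))) =
   A * r * (B + 1) * r * (esc b k.*2.+1 * B ^+ k.*2.+1).
  rewrite lam_A /r -addnn !exprS exprD !exprVn; field.
  by rewrite !expf_neq0//= B0 /=; apply: lt0r_neq0; have := B2; lra.
have rn' : r <= n%:R^-1 by rewrite -div1r ler_pdivlMr//; have := nR; lra.
apply: (@le_trans _ _ (ln B * (B + 1) * n%:R^-1 * 2)); last first.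
  by rewrite le_eqVlt; apply/orP; left; apply/eqP; ring.
have Ar0 : 0 <= A * r by rewrite mulr_ge0 ?(ltW A0) ?(ltW r0).
have Bp1 : 0 <= B + 1 by have := B2; lra.
apply: ler_pM => //.
- by rewrite mulr_ge0 ?(ltW r0)// mulr_ge0.
- by rewrite mulr_ge0 ?esc_ge0// exprn_ge0// ltW.
apply: ler_pM => //; [by rewrite mulr_ge0|exact: ltW|].
by rewrite ler_wpM2r.
Qed.

Let E1 := expR (3 / 4 * (n%:R * ln B) + 3 / 2 * ln B).
Let E2 := expR (2 * (B + 1) * ln B / n%:R).
(** Pairs agreeing in their first l - k letters have a common ancestor of height at most 2 k. There
    are only b^k such [y] for each [x], so a crude correlation bound suffices for them. *)
Let pair_le (x y : l.-tuple 'I_b) : pr (F x `&` F y) <=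
  (x == y)%:R * p + (take (l - k) x == take (l - k) y)%:R * (p ^+ 2 * E1) + p ^+ 2 * E2.
Proof.
have mF z : measurable (F z) by exact: (measurable_isolated_set particles).
have pp e : 0 <= p ^+ 2 * expR e by rewrite mulr_ge0 ?sqr_ge0 ?expR_ge0.
have [->|ne] := eqVneq x y.
  rewrite setIid pr_F eqxx !mul1r -addrA lerDl addr_ge0 ?mulr_ge0// ?sqr_ge0 ?expR_ge0//.
rewrite mul0r add0r.
have sx (z : l.-tuple 'I_b) : size z = l by rewrite size_tuple.
have nl : (n - l = k)%N by rewrite -kl addnK.
have ln' : (l <= n)%N by rewrite -kl leq_addl.
have main m : (m < l)%N -> take m.+1 x != take m.+1 y ->
    pr (F x `&` F y) <= p ^+ 2 * expR (lam * ((B - 1) * (B ^+ k *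
      (esc b (n - m) * B^-1 ^+ (l - m))))).
  move=> ml txy.
  have := @pr_isolated_pair _ _ _ P b n N X lam b2 n0 lam0 particles x y m.
  rewrite !sx nl => /(_ erefl ln' ml txy) h; apply: (le_trans h).
  by rewrite -!/(F _) !pr_F -expr2.
have [_|tne] := eqVneq (take (l - k) x) (take (l - k) y).
  rewrite mul1r; apply: ler_wpDr; first exact: pp.
  (* Distinct words of length l differ at the latest in their last letter, so m = l - 1 is always
     admissible. *)
  have l0 : (0 < l)%N by apply: leq_ltn_trans k_lt_l.
  apply: (le_trans (main l.-1 _ _)).
  - by rewrite prednK.
  - by rewrite prednK// !take_oversize ?sx//.
  have -> : (n - l.-1 = k.+1)%N by move: kl l0; clear => *; lia.
  have -> : (l - l.-1 = 1)%N by move: l0; clear => *; lia.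
  by rewrite expr1 ler_wpM2l ?sqr_ge0// ler_expR near_le.
rewrite mul0r add0r.
have e : (l - k = (l - k.+1).+1)%N by move: k_lt_l; clear => *; lia.
apply: (le_trans (main (l - k.+1)%N _ _)).
- by move: k_lt_l; clear => *; lia.
- by rewrite -e.
have -> : (n - (l - k.+1) = k.*2.+1)%N by move: kl k_lt_l; clear; rewrite -muln2 => *; lia.
have -> : (l - (l - k.+1) = k.+1)%N by move: k_lt_l; clear => *; lia.
by rewrite ler_wpM2l ?sqr_ge0// ler_expR far_le.
Qed.

Let sum_near (x : l.-tuple 'I_b) :
  \sum_(y : l.-tuple 'I_b) (take (l - k) x == take (l - k) y)%:R = B ^+ k :> R.
Proof.
have st : size (take (l - k) x) = (l - k)%N by rewrite size_takel// size_tuple leq_subr.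
have := @sum_prefix R b b2 l (take (l - k) x); rewrite st => /(_ (leq_subr _ _)).
rewrite subKn; last exact: ltnW.
move=> <-; apply: eq_bigr => y _; rewrite /ind prefixE st.
by rewrite eq_sym.
Qed.

Lemma pr_connected_le :
  1 - pr [set w | ~~ mg_connected (particle_graph N X w)] <=
  B ^+ 2 * (n%:R * expR (- g)) + B ^+ 2 * (n%:R ^+ 2 * expR (- (n%:R * ln B / 4)))
  + (expR (2 * (B + 1) * ln B / n%:R) - 1).
Proof.
have mF z : measurable (F z) by exact: (measurable_isolated_set particles).
have l0 : (0 < l)%N by apply: leq_ltn_trans k_lt_l.
have ln' : (l <= n)%N by rewrite -kl leq_addl.
have sub : \bigcup_x F x `<=` [set w | ~~ mg_connected (particle_graph N X w)].
  move=> w [x _ iso].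
  (* If the indicator were constant, the block size b^(n-l) would be b^n or 0. *)
  have [u [v uv]] : exists u v : leaf b n, prefix x u != prefix x v.
    apply: contrapT => /forallNP same.
    pose u0 : leaf b n := nseq_tuple n (Ordinal (ltnW b2 : (0 < b)%N)).
    have := @sum_prefix R b b2 n x; rewrite size_tuple => /(_ ln').
    rewrite (eq_bigr (fun=> (prefix x u0)%:R)) => [|v _]; last first.
      have /forallNP/(_ u0)/negP := same v; rewrite negbK => /eqP e.
      by rewrite /ind e.
    rewrite sumr_const card_tuple card_ord; case: (prefix x u0) => /=.
      rewrite -natrX => /eqP; rewrite -/((b ^ n)%:R) eqr_nat eqn_exp2l//; move: kl k_lt_l l0; clear => *; lia.
    by move/eqP; rewrite mul0rn eq_sym expf_eq0 (negbTE B0) andbF.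
  exact: isolated_disconnected uv iso.
have mU : measurable (\bigcup_x F x).
  by apply: fin_bigcup_measurable => //; exact: finite_finset.
have md := measurable_disconnected b2 particles.
have Bl0 : 0 < B ^+ l by rewrite exprn_gt0.
have pp : 0 < p by exact: expR_gt0.
have sF : \sum_x pr (F x) = B ^+ l * p.
  rewrite (eq_bigr (fun=> p)) => [|x _]; last exact: pr_F.
  by rewrite sumr_const card_tuple card_ord -[p *+ _]mulr_natl natrX.
have s2 : \sum_x \sum_y pr (F x `&` F y) <=
    B ^+ l * p + B ^+ l * B ^+ k * (p ^+ 2 * E1) + (B ^+ l) ^+ 2 * (p ^+ 2 * E2).
  apply: (@le_trans _ _ (\sum_(x : l.-tuple 'I_b) (p + B ^+ k * (p ^+ 2 * E1) +
      B ^+ l * (p ^+ 2 * E2)))); last first.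
    rewrite sumr_const card_tuple card_ord -[(_ + _) *+ _]mulr_natl natrX.
    by rewrite le_eqVlt; apply/orP; left; apply/eqP; ring.
  apply: ler_sum => x _.
  apply: (le_trans (ler_sum _ (fun y _ => pair_le x y))).
  rewrite !big_split/= -[X in X + _ + _]mulr_suml -[X in _ + X + _]mulr_suml sum_near sumr_const card_tuple card_ord -[(_ * E2) *+ _]mulr_natl natrX.
  rewrite (bigD1 x)//= eqxx big1 ?addr0 ?mul1r// => y yx.
  by rewrite eq_sym (negbTE yx).
have mu0 : 0 < \sum_x pr (F x) by rewrite sF mulr_gt0.
have := second_moment mF mu0; rewrite sF => sm.
apply: (@le_trans _ _ (1 - pr (\bigcup_x F x))).
  by rewrite lerD2l lerN2; apply: pr_le.
apply: (le_trans sm).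
have q2 : 0 < (B ^+ l * p) ^+ 2 by rewrite exprn_gt0// mulr_gt0.
(* Relative to the squared mean, the diagonal gives the inverse of the mean, the near pairs b^k /
   b^l times E1, and the far pairs E2, which tends to 1. *)
apply: (@le_trans _ _ ((B ^+ l * p)^-1 + B ^+ k / B ^+ l * E1 + E2 - 1)).
  rewrite lerD2r ler_pdivrMr//; apply: (le_trans s2).
  rewrite le_eqVlt; apply/orP; left; apply/eqP; field.
  by rewrite !gt_eqF.
rewrite -[leRHS]addrA -addrA -addrA lerD//.
  rewrite -[leRHS]invrK lef_pV2 ?posrE ?mulr_gt0//; last first.
    by rewrite invr_gt0 !mulr_gt0 ?exprn_gt0 ?expR_gt0//; have := nR; lra.
  apply: le_trans p_ge; rewrite le_eqVlt; apply/orP; left; apply/eqP.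
  rewrite expRN; field; rewrite !gt_eqF ?expR_gt0//; have := nR; lra.
rewrite lerD2r.
have E1E : E1 = B ^+ n * expR (- (n%:R * ln B / 4)) * expR (3 / 2 * ln B).
  by rewrite /E1 -expB -!expRD; congr expR; field.
have e32 : expR (3 / 2 * ln B) <= B ^+ 2.
  by rewrite -expB ler_expR; have := lnB0; lra.
rewrite E1E -{1}kl exprD.
rewrite [leLHS](_ : _ = expR (3 / 2 * ln B) * ((B ^+ k) ^+ 2 * expR (- (n%:R * ln B / 4)))); last first.
  by field; rewrite expf_neq0.
apply: ler_pM; rewrite ?expR_ge0 ?mulr_ge0 ?expR_ge0 ?sqr_ge0//.
by rewrite ler_wpM2r ?expR_ge0// lerXn2r ?nnegrE ?exprn_ge0.
Qed.

End DisconnectedBound.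

(** * Limits of the error terms *)

Section Asymptotics.
Context {R : realType}.

Lemma cvg_expRN_ln (c : R) : 0 < c ->
  (fun n : nat => expR (- (c * ln n%:R))) @ \oo --> (0 : R).
Proof.
move=> c0; apply/cvgr0Pnorm_le => e e0.
near=> n.
have n0 : 0 < n%:R :> R by rewrite ltr0n; near: n; exact: nbhs_infty_gt.
rewrite ger0_norm ?expR_ge0// -[leRHS](lnK (_ : e \in Num.pos)) ?posrE// ler_expR lerNl.
rewrite mulrC -ler_pdivrMr// -[leLHS]expRK ler_ln ?posrE ?expR_gt0//.
near: n; exact: nbhs_infty_ger.
Unshelve. all: by end_near. Qed.

Lemma cvg_natV : (fun n : nat => n%:R^-1) @ \oo --> (0 : R).
Proof. by rewrite -cvg_shiftS; exact: cvg_harmonic. Qed.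

Lemma cvg_poly_expRN (c : R) (j : nat) : 0 < c ->
  (fun n : nat => n%:R ^+ j * expR (- (n%:R * c))) @ \oo --> (0 : R).
Proof.
move=> c0; pose K : R := (j.+1)`!%:R / c ^+ j.+1.
have K0 : 0 < K by rewrite divr_gt0 ?exprn_gt0// ltr0n fact_gt0.
apply: (@squeeze_cvgr _ _ _ _ (fun=> 0) (fun n => K * n%:R^-1)).
- near=> n; rewrite mulr_ge0 ?exprn_ge0 ?expR_ge0//=.
  have n0 : 0 < n%:R :> R by rewrite ltr0n; near: n; exact: nbhs_infty_gt.
  have h : (n%:R * c) ^+ j.+1 / (j.+1)`!%:R <= expR (n%:R * c).
    apply: le_trans (expR_ge1Dxn j _); last by rewrite mulr_ge0// ltW.
    by rewrite lerDr.
  rewrite expRN ler_pdivrMr ?expR_gt0//.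
  apply: (@le_trans _ _ (K / n%:R * ((n%:R * c) ^+ j.+1 / (j.+1)`!%:R))); last first.
    by rewrite ler_wpM2l// divr_ge0// ltW.
  rewrite le_eqVlt; apply/orP; left; apply/eqP; rewrite /K exprMn [n%:R ^+ j.+1]exprSr.
  by field; rewrite !gt_eqF ?exprn_gt0// ltr0n fact_gt0.
- exact: cvg_cst.
- rewrite -[X in _ --> X](mulr0 K); apply: cvgM; first exact: cvg_cst.
  exact: cvg_natV.
Unshelve. all: by end_near. Qed.

Lemma near_ln_le (e : R) : 0 < e -> \forall n \near \oo, ln n%:R <= e * n%:R.
Proof.
move=> e0; have /cvgr0Pnorm_le/(_ 1 ltr01) := cvg_poly_expRN 1 e0.
apply: filterS2 (nbhs_infty_gt 0) => n n0.
have n1 : 0 < n%:R :> R by rewrite ltr0n.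
rewrite expr1 ger0_norm ?mulr_ge0 ?expR_ge0// expRN ler_pdivrMr ?expR_gt0// mul1r => h.
by rewrite -[leRHS]expRK ler_ln ?posrE ?expR_gt0// mulrC.
Qed.

Lemma whp_of_le (d : nat -> measure_display) (T : forall n, measurableType (d n))
    (P : forall n, probability (T n) R) (A : forall n, set (T n)) (u : nat -> R) :
  (\forall n \near \oo, measurable (A n) /\ 1 - prob (P n) (A n) <= u n) ->
  u @ \oo --> 0 -> whp P A.
Proof.
move=> h u0; rewrite /whp.
apply: (@squeeze_cvge _ _ _ _ (fun n => (1 - u n)%:E) _ (fun=> 1%E)).
- near=> n.
  have [mA le] : measurable (A n) /\ 1 - prob (P n) (A n) <= u n by near: n.
  by rewrite probability_le1// andbT prE// lee_fin lerBlDr -lerBlDl.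
- apply: cvg_EFin; first by near=> n.
  rewrite -[X in _ --> X]subr0; apply: cvgB => //; exact: cvg_cst.
- exact: cvg_cst.
Unshelve. all: by end_near. Qed.

End Asymptotics.

(** * The two phases of the graph *)

Section Main.
Context {R : realType} (b : nat).
Hypothesis b2 : (2 <= b)%N.
Local Notation B := (b%:R : R).
Let B2 : 2 <= B. Proof. by rewrite ler_nat. Qed.
Let lnB0 : 0 < ln B. Proof. by apply: ln_gt0; have := B2; lra. Qed.

Let sigma0 : 0 < sigma_crit R b.
Proof. by rewrite /sigma_crit mulr_gt0// divr_gt0//; have := B2; lra. Qed.

Context (d : nat -> measure_display) (T : forall n, measurableType (d n)).
Context (P : forall n, probability (T n) R).
Context (N : forall n, leaf b n -> {RV (P n) >-> nat}).
Context (X : forall n, leaf b n -> nat -> nat -> T n -> vertex b n).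
Arguments N : clear implicits.
Arguments X : clear implicits.

Let near_sigma (a : R) : \forall n \near \oo,
  a * ln n%:R <= sigma_crit R b / 2 * n%:R.
Proof.
have a0 : 0 < `|a| + 1 by rewrite ltr_wpDl.
have e0 : 0 < sigma_crit R b / 2 / (`|a| + 1) by rewrite !divr_gt0.
apply: filterS2 (near_ln_le e0) (nbhs_infty_gt 0) => n h n0.
have l0 : 0 <= ln (n%:R : R) by rewrite ln_ge0// ler1n.
apply: (@le_trans _ _ ((`|a| + 1) * ln n%:R)).
  by rewrite ler_wpM2r// (le_trans (ler_norm _))// lerDl.
by rewrite mulrC -ler_pdivlMr// mulrAC.
Qed.

Lemma whp_connected (alpha : R) : B + 1 < alpha ->
  (\forall n \near \oo, poisson_particles (@N n) (@X n)
        (sigma_crit R b * n%:R + alpha * ln n%:R)) ->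
  whp P (fun n => [set w | mg_connected (particle_graph (@N n) (@X n) w)]).
Proof.
move=> ha part; have hB := B2.
(* The cost is then N = n ln b + gam ln n, so n b^n exp (- N) = n^(1 - gam); alpha > b + 1 gives gam
   > b - 1 >= 1. *)
set gam := alpha * (B - 1) / (B + 1).
have gam1 : 1 < gam by rewrite /gam ltr_pdivlMr; nra.
pose C : R := 360 * B ^+ 2 * 3 ^+ b.
pose v n : R := 81 * expR (- ((gam - 1) * ln n%:R)) +
  (ln B + gam + 8) * (n%:R ^+ 3 * expR (- (n%:R * (ln B / 2)))).
have v0 : v @ \oo --> 0.
  rewrite -[X in _ --> X](_ : 81 * 0 + (ln B + gam + 8) * 0 = 0); last by rewrite !mulr0 addr0.
  apply: cvgD; apply: cvgM; try exact: cvg_cst.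
    by apply: cvg_expRN_ln; rewrite subr_gt0.
  by apply: cvg_poly_expRN; rewrite divr_gt0.
apply: (@whp_of_le _ _ _ _ _ (fun n => 2 ^+ (b + 2) * v n)); last first.
  by rewrite -[X in _ --> X](mulr0 (2 ^+ (b + 2))); apply: cvgM => //; exact: cvg_cst.
have C0 : 0 < 2 ^+ (b + 4) * C by rewrite !mulr_gt0 ?exprn_gt0//; lra.
have small : \forall n \near \oo, 2 ^+ (b + 4) * C * v n <= 1.
  have e0 : 0 < (2 ^+ (b + 4) * C)^-1 by rewrite invr_gt0.
  move/cvgr0Pnorm_le: v0 => /(_ _ e0); apply: filterS => n h.
  by rewrite mulrC -ler_pdivlMr// div1r (le_trans (ler_norm _)).
apply: filterS3 part small (nbhs_infty_gt 0) => n {}part small n0.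
set lam := sigma_crit R b * n%:R + alpha * ln n%:R in part.
have l0 : 0 <= ln (n%:R : R) by rewrite ln_ge0// ler1n.
have nR : 1 <= n%:R :> R by rewrite ler1n.
have lam0 : 0 < lam.
  have s0 : 0 < sigma_crit R b * n%:R by rewrite mulr_gt0// ltr0n.
  have a0 : 0 <= alpha * ln n%:R by rewrite mulr_ge0//; lra.
  by rewrite /lam; lra.
have md := measurable_disconnected b2 part.
have mc : [set w | mg_connected (particle_graph (@N n) (@X n) w)] =
    ~` [set w | ~~ mg_connected (particle_graph (@N n) (@X n) w)].
  by apply/seteqP; split=> w /= ; [move=> ->|move/negP; rewrite negbK].
split; first by rewrite mc; exact: measurableC.
rewrite mc prC// opprB addrC subrK.
apply: (le_trans (pr_disconnected_le b2 n0 lam0 part)).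
set M := lam * (B - 1) / (B + 1).
have ME : M = n%:R * ln B + gam * ln n%:R.
  by rewrite /M /lam /gam /sigma_crit; field; rewrite !lt0r_neq0//; lra.
have M0 : 0 <= M by rewrite ME addr_ge0 ?mulr_ge0 ?(ltW lnB0)//; lra.
pose Q : R := 81 * (B ^+ n * expR (- M)) + n%:R * ((M + 8) * expR (- (M / 2))).
have nQ : n%:R * Q <= v n.
  rewrite /Q /v mulrDr lerD//.
    rewrite ME opprD expRD [expR (- (n%:R * ln B))]expRN expRM_natl lnK ?posrE; last by lra.
    rewrite mulrCA ler_wpM2l// mulrA mulfV ?expf_neq0 ?lt0r_neq0//; last by lra.
    rewrite mul1r -{1}(@lnK R n%:R) ?posrE; last by lra.
    by rewrite -expRD ler_expR; lra.
  have M1 : M + 8 <= (ln B + gam + 8) * n%:R.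
    have := ln_sublinear (lt_le_trans ltr01 nR) => /ltW ln_le.
    have : gam * ln n%:R <= gam * n%:R by rewrite ler_wpM2l//; lra.
    by rewrite ME; nra.
  have M2 : expR (- (M / 2)) <= expR (- (n%:R * (ln B / 2))).
    rewrite ler_expR lerN2 ME.
    have : 0 <= gam * ln n%:R by rewrite mulr_ge0//; lra.
    lra.
  rewrite [leLHS](_ : _ = n%:R ^+ 2 * ((M + 8) * expR (- (M / 2)))); last by ring.
  rewrite [leRHS](_ : _ = n%:R ^+ 2 *
    (((ln B + gam + 8) * n%:R) * expR (- (n%:R * (ln B / 2))))); last by ring.
  rewrite ler_wpM2l ?sqr_ge0//; apply: ler_pM => //; rewrite ?expR_ge0//.
  exact: addr_ge0.
apply: (le_trans (@cut_sum_le _ _ b2 M M0 n C Q n0 erefl erefl _)).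
  by apply: le_trans small; rewrite ler_wpM2l// ltW.
by rewrite ler_wpM2l// exprn_ge0.
Qed.

Lemma whp_disconnected (beta : R) : (B + 1) / (B - 1) < beta ->
  (\forall n \near \oo, poisson_particles (@N n) (@X n)
        (sigma_crit R b * n%:R - beta * ln n%:R)) ->
  whp P (fun n => [set w | ~~ mg_connected (particle_graph (@N n) (@X n) w)]).
Proof.
move=> hb part; have hB := B2.
(* Now g = gam ln n, the inverse mean is at most b^2 n^(1 - gam), and gam > 1 is the hypothesis on
   beta. *)
set gam := beta * (B - 1) / (B + 1).
have gam1 : 1 < gam.
  rewrite /gam ltr_pdivlMr; last by lra.
  by rewrite mul1r -ltr_pdivrMr//; lra.
pose c : R := 2 * (B + 1) * ln B.
pose v n : R := B ^+ 2 * expR (- ((gam - 1) * ln n%:R)) +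
  B ^+ 2 * (n%:R ^+ 2 * expR (- (n%:R * (ln B / 4)))) + (expR (c * n%:R^-1) - 1).
have v0 : v @ \oo --> 0.
  rewrite -[X in _ --> X](_ : B ^+ 2 * 0 + B ^+ 2 * 0 + (expR (c * 0) - 1) = 0); last first.
    by rewrite !mulr0 addr0 add0r expR0 subrr.
  apply: cvgD; first apply: cvgD; try (apply: cvgM; first exact: cvg_cst).
  - by apply: cvg_expRN_ln; rewrite subr_gt0.
  - by apply: cvg_poly_expRN; rewrite divr_gt0.
  apply: cvgB; last exact: cvg_cst.
  apply: (@cvg_comp _ _ _ (fun n : nat => c * n%:R^-1) expR).
    by apply: cvgM; [exact: cvg_cst|exact: cvg_natV].
  exact: continuous_expR.
apply: (@whp_of_le _ _ _ _ _ v) => //.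
apply: filterS3 part (near_sigma beta) (nbhs_infty_ge 5) => n part hs n5.
set lam := sigma_crit R b * n%:R - beta * ln n%:R in part.
have n0 : (0 < n)%N by apply: leq_trans n5.
have nR : 5 <= n%:R :> R by rewrite ler_nat.
have l0 : 0 <= ln (n%:R : R) by rewrite ln_ge0// ler1n.
have s0 : 0 < sigma_crit R b * n%:R by rewrite mulr_gt0// ltr0n.
have lam0 : 0 < lam by rewrite /lam; lra.
split; first exact: (measurable_disconnected b2 part).
have lamE : lam * (B - 1) / (B + 1) = n%:R * ln B - gam * ln n%:R.
  by rewrite /lam /gam /sigma_crit; field; rewrite !lt0r_neq0//; lra.
have g0 : 0 <= gam * ln n%:R by rewrite mulr_ge0//; lra.
set k := trunc_log b n.
have kn : (k.*2.+1 <= n)%N := two_trunc_log b2 n5.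
have kl : (k + (n - k) = n)%N by move: kn; rewrite -muln2; lia.
have k_lt_l : (k < n - k)%N by move: kn; rewrite -muln2; lia.
apply: (le_trans (pr_connected_le b2 n5 lam0 part g0 lamE kl k_lt_l (trunc_log_bounds b2 n0))).
rewrite /v -/c; apply: lerD; last by [].
apply: lerD.
  rewrite ler_wpM2l ?exprn_ge0// -{1}(@lnK R n%:R) ?posrE; last by lra.
  by rewrite -expRD ler_expR; lra.
by rewrite [n%:R * (ln B / 4)]mulrA.
Qed.

End Main.

Theorem theorem7p6 (R : realType) (b : nat) (hb : (2 <= b)%N)
    (d : nat -> measure_display) (T : forall n, measurableType (d n))
    (P : forall n, probability (T n) R)
    (N : forall n, leaf b n -> {RV (P n) >-> nat})
    (X : forall n, leaf b n -> nat -> nat -> T n -> vertex b n) :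
  (forall alpha : R, b%:R + 1 < alpha ->
    (\forall n \near \oo,
      poisson_particles (@N n) (@X n)
        (sigma_crit R b * n%:R + alpha * ln n%:R)) ->
    whp P (fun n => [set w | mg_connected (particle_graph (@N n) (@X n) w)]))
  /\
  (forall beta : R, (b%:R + 1) / (b%:R - 1) < beta ->
    (\forall n \near \oo,
      poisson_particles (@N n) (@X n)
        (sigma_crit R b * n%:R - beta * ln n%:R)) ->
    whp P (fun n => [set w | ~~ mg_connected (particle_graph (@N n) (@X n) w)])).
Proof.
split=> [alpha|beta] h part; first exact: whp_connected h part.
exact: whp_disconnected h part.
Qed.
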